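(* Assume (A) and consider testing $H_0:\mathbf{G}\sim\mathsf{G}(n,p)$ versus $H_1:\mathbf{G}\sim\mathsf{RGG}(n,\mathbb{T}^d,\mathsf{Unif},\sigma^\infty_p,p)$. (1) The signed 4-cycle test $\mathsf{SC}_{C_4}$ succeeds if $d=\tilde o(np)$ and fails if $d=\tilde\omega(np)$. (2) The signed triangle test $\mathsf{SC}_{C_3}$ succeeds if $d=\tilde o((np)^{3/4})$ and fails if $d=\tilde\omega((np)^{3/4})$.
   Context: Torus $\mathbb{T}^d=\mathbb{R}^d/2\mathbb{Z}^d$ with uniform measure; circular distance $|x-y|_C\in[0,1]$ on a circle of circumference 2; $\|\mathbf{x}-\mathbf{y}\|_\infty=\max_i|x_i-y_i|_C$. $\tau^\infty_p$ satisfies $\mathbf{P}[\|\mathbf{x}-\mathbf{y}\|_\infty\le\tau^\infty_p]=p$ for $\mathbf{x},\mathbf{y}$ iid uniform. $\mathsf{RGG}(n,\mathbb{T}^d,\mathsf{Unif},\sigma^\infty_p,p)$: sample $\mathbf{x}^1,\dots,\mathbf{x}^n$ iid uniform on $\mathbb{T}^d$ and join $i,j$ iff $\|\mathbf{x}^i-\mathbf{x}^j\|_\infty\le\tau^\infty_p$. $\mathsf{G}(n,p)$ is Erdős–Rényi. Assumption (A): absolute constants $\delta,\epsilon>0$ with $n^{-1+\epsilon}\le p\le1/2$, $n^\delta\le d$. For a graph $H\subseteq K_n$ (given by an edge set) and a graph $G$ on $[n]$ with adjacency entries $G_{ij}\in\{0,1\}$, the signed weight is $\mathsf{SW}_H(G)=\prod_{(ij)\in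 E(H)}(G_{ij}-p)$, and the signed count is $\mathsf{SC}_H(G)=\sum_{H_1}\mathsf{SW}_{H_1}(G)$ over all subgraphs $H_1$ of $K_n$ isomorphic to $H$. The signed $H$-count test succeeds if $|\mathbf{E}_{\mathsf{RGG}}\mathsf{SC}_H|=\omega\big(\sqrt{\mathrm{Var}_{\mathsf{G}(n,p)}\mathsf{SC}_H+\mathrm{Var}_{\mathsf{RGG}}\mathsf{SC}_H}\big)$ and fails if the same quantity is $o(\cdot)$ of the right-hand side. $\tilde o,\tilde\omega$ hide polylogarithmic factors in $n$. *)

(* Defs.v *)
From HB Require Import structures.
From mathcomp Require Import all_boot all_order all_algebra.
From mathcomp Require Import all_classical all_reals all_analysis.
Set Implicit Arguments. Unset Strict Implicit. Unset Printing Implicit Defensive.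
Import Order.TTheory GRing.Theory Num.Theory.
Local Open Scope ring_scope.

Section Defs.
Variable R : realType.

(* circular distance on R/2Z, for representatives in [0,2) : value in [0,1] *)
Definition circ_dist (a b : R) : R := Num.min `|a - b| (2 - `|a - b|).

(* A configuration of n points in T^d is a coordinate vector x : nat -> R,
   point i has coordinates x (i*d + k), k < d, each a representative in [0,2). *)
Definition linf_dist (d : nat) (x : nat -> R) (i j : nat) : R :=
  \big[Num.max/0]_(k < d) circ_dist (x (i * d + k)%N) (x (j * d + k)%N).

Definition upd (v : nat -> R) (k : nat) (t : R) : nat -> R :=
  fun j => if j == k then t else v j.

(* Expectation of F when coordinates 0..K-1 of the argument are iid uniform on
   [0,2] (i.e. uniform on the circle of circumference 2), written as an
   iterated Lebesgue integral of the uniform density 1/2. *)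
Fixpoint iter_unif (K : nat) (F : (nat -> R) -> R) (v : nat -> R) : R :=
  match K with
  | 0 => F v
  | K'.+1 => 2^-1 * Rintegral (@lebesgue_measure R) `[0, 2]%classic
               (fun t => iter_unif K' F (upd v K' t))
  end.

Definition unif_expect (K : nat) (F : (nat -> R) -> R) : R :=
  iter_unif K F (fun _ => 0).

Definition linf_cdf (d : nat) (tau : R) : R :=
  unif_expect (2 * d) (fun x => ((linf_dist d x 0 1 <= tau)%R : bool)%:R).

(* graphs on [n] as edge sets: sets of 2-subsets of 'I_n *)
Definition pairs (n : nat) : {set {set 'I_n}} := [set e : {set 'I_n} | #|e| == 2].

Definition iso_copy (m n : nat) (H : {set {set 'I_m}}) (H1 : {set {set 'I_n}}) : Prop :=
  exists f : 'I_m -> 'I_n, injective f /\ H1 = [set f @: e | e : {set 'I_m} in H].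

Definition SW (n : nat) (p : R) (H1 g : {set {set 'I_n}}) : R :=
  \prod_(e in H1) ((e \in g)%:R - p).

Definition SC (m n : nat) (p : R) (H : {set {set 'I_m}}) (g : {set {set 'I_n}}) : R :=
  \sum_(H1 : {set {set 'I_n}} | `[< iso_copy H H1 >]) SW p H1 g.

Definition cycle_graph (k : nat) : {set {set 'I_k}} :=
  [set [set i; ordS i] | i : 'I_k].

Definition ER_expect (n : nat) (p : R) (F : {set {set 'I_n}} -> R) : R :=
  \sum_(g in powerset (pairs n))
     (\prod_(e in pairs n) (if e \in g then p else 1 - p)) * F g.

Definition ER_var (n : nat) (p : R) (F : {set {set 'I_n}} -> R) : R :=
  ER_expect p (fun g => F g ^+ 2) - (ER_expect p F) ^+ 2.

Definition rgg_graph (n d : nat) (tau : R) (x : nat -> R) : {set {set 'I_n}} :=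
  [set e in pairs n | [forall i in e, forall j in e,
                         (i == j) || (linf_dist d x i j <= tau)]].

Definition RGG_expect (n d : nat) (tau : R) (F : {set {set 'I_n}} -> R) : R :=
  unif_expect (n * d) (fun x => F (rgg_graph n d tau x)).

Definition RGG_var (n d : nat) (tau : R) (F : {set {set 'I_n}} -> R) : R :=
  RGG_expect d tau (fun g => F g ^+ 2) - (RGG_expect d tau F) ^+ 2.

Definition SC_test_succeeds (m : nat) (H : {set {set 'I_m}})
  (p : nat -> R) (d : nat -> nat) (tau : nat -> R) : Prop :=
  forall M : R, 0 < M -> exists N : nat, forall n : nat, (N <= n)%N ->
    M * Num.sqrt (ER_var (p n) (SC (p n) H : {set {set 'I_n}} -> R)
                  + RGG_var (d n) (tau n) (SC (p n) H : {set {set 'I_n}} -> R))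
    <= `| RGG_expect (d n) (tau n) (SC (p n) H : {set {set 'I_n}} -> R) |.

Definition SC_test_fails (m : nat) (H : {set {set 'I_m}})
  (p : nat -> R) (d : nat -> nat) (tau : nat -> R) : Prop :=
  forall eta : R, 0 < eta -> exists N : nat, forall n : nat, (N <= n)%N ->
    `| RGG_expect (d n) (tau n) (SC (p n) H : {set {set 'I_n}} -> R) |
    <= eta * Num.sqrt (ER_var (p n) (SC (p n) H : {set {set 'I_n}} -> R)
                  + RGG_var (d n) (tau n) (SC (p n) H : {set {set 'I_n}} -> R)).

(* Assumption (A) with constants delta, eps, for all large n, together with
   tau n = tau^inf_{p n} (defined by its equation) *)
Definition assumption_A (delta eps : R) (p : nat -> R) (d : nat -> nat)
  (tau : nat -> R) : Prop :=
  exists N : nat, forall n : nat, (N <= n)%N ->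
    [/\ n%:R `^ (-1 + eps) <= p n, p n <= 2^-1, n%:R `^ delta <= (d n)%:R
      & linf_cdf (d n) (tau n) = p n].

Definition tilde_o (C : R) (f g : nat -> R) : Prop :=
  forall eta : R, 0 < eta -> exists N : nat, forall n : nat, (N <= n)%N ->
    f n * ln (n%:R) `^ C <= eta * g n.

Definition tilde_omega (C : R) (f g : nat -> R) : Prop :=
  forall M : R, 0 < M -> exists N : nat, forall n : nat, (N <= n)%N ->
    M * g n * ln (n%:R) `^ C <= f n.

End Defs.

(* Main.v *)
Require Import Defs.
From HB Require Import structures.
From mathcomp Require Import all_boot all_order all_algebra.
From mathcomp Require Import all_classical all_reals all_analysis.
From mathcomp Require Import measurable_realfun zify ring lra.
Set Implicit Arguments. Unset Strict Implicit. Unset Printing Implicit Defensive.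
Import Order.TTheory GRing.Theory Num.Theory.
Import numFieldNormedType.Exports.
Local Open Scope classical_set_scope.
Local Open Scope ring_scope.

(* Write l = 1 - tau for the chance that a given coordinate separates a given
   pair of points, so that tau^d = p and 1/2 <= d l <= ln n.  An edge is present
   iff no coordinate is bad for it, coordinates are independent, and the bad
   events of a coordinate are independent along forests.  On a triangle they are
   incompatible (two points far from a third one are close to each other), on a
   4-cycle they all occur with probability of order l^3.  Hence the expected
   signed weight of a k-cycle (k = 3, 4) is of order p^k d l^3, and the expected
   signed count of order (np)^k d l^3.  Under G(n, p) the variance is of order
   (np)^k.  Under the geometric graph the covariance of two cycles vanishes when
   they are disjoint, is O(p^(2k) d l^4) when they share one vertex, and is
   O(p^(2k - v) d l^3) when they are distinct and share v >= 2 vertices, because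
   any three edges not forming a triangle have bad probability at most l^3.
   Comparing these orders gives the thresholds d^4 = (np)^k up to logarithms. *)

(** The signed expansion isolates the order l^3. A proper part of a cycle has exactly its
    Erdos-Renyi probability, so only the full cycle survives in the mean of a signed weight, and
    only the pair of full cycles in the covariance of two cycles with at most one common vertex.
    Passing to d slots multiplies d factors, each within a relative error theta = A l^3 of a power
    of tau. As d l is at most ln n while d is at least a power of n, d theta falls below 1/2, (1 +
    theta)^d stays below 2, and the errors simply add up. A = 4^8 absorbs (2/tau)^m for the m <= 8
    edges of two cycles. The logarithm enters through (d l^3)^2 d^4 = (d l)^6 <= (ln n)^6 in the
    failure regime; the exponent 2 lies above 6/4. The obstacle is the encoding: expectation is an
    iterated integral over bare sequences of reals, where linearity and exchange of integrals call
    for integrability. Hence the preliminary theory of bounded measurable functions of a sequence,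
    with independence expressed by disjoint sets of coordinates. *)

Definition cylinders (R : realType) : set (set (nat -> R)) :=
  [set A | exists i (B : set R), measurable B /\ A = (fun v => v i) @^-1` B].

Notation seqR R := (g_sigma_algebraType (@cylinders R)).

(** * Averaging one coordinate of a bounded measurable function *)

Section measurable_sequences.
Variable R : realType.
Local Notation U := `[0%R, 2%R]%classic.
Local Notation leb := (@lebesgue_measure R).
Implicit Types (F G : (nat -> R) -> R) (v : nat -> R) (k : nat).

Lemma measurable_coord k : measurable_fun setT (fun v : seqR R => v k).
Proof.
move=> _ B mB; rewrite setTI; apply: sub_sigma_algebra.
by exists k, B.
Qed.

Lemma measurable_fun_seqR (d : measure_display) (T : measurableType d)
    (g : T -> nat -> R) :
  (forall k, measurable_fun setT (fun x => g x k)) ->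
  measurable_fun setT (g : T -> seqR R).
Proof.
move=> mg; apply: (@measurability _ _ T (seqR R) setT g (@cylinders R)) => //.
move=> _ [_ [i [B [mB ->]]] <-].
by rewrite setTI -[X in measurable X]setTI; exact: mg.
Qed.

(** Joint measurability in the sequence and the new value is what Tonelli's theorem asks for when
    one coordinate is integrated. *)
Lemma measurable_upd k :
  measurable_fun setT (fun z : seqR R * R => upd z.1 k z.2 : seqR R).
Proof.
apply: measurable_fun_seqR => i; rewrite /upd.
case: (i == k); first exact: measurable_snd.
exact: (measurableT_comp (measurable_coord i) measurable_fst).
Qed.

(** Boundedness makes every one-coordinate slice integrable on [0, 2], and the class is stable under
    averaging, so the iterated integral is linear on it. *)
Definition bmeas F := measurable_fun setT (F : seqR R -> R) /\
  exists M, forall v, `|F v| <= M.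

Definition avg k F v := 2^-1 * Rintegral leb U (fun t => F (upd v k t)).

Lemma bmeas_cst c : bmeas (fun=> c).
Proof. by split; [exact: measurable_cst|exists `|c|]. Qed.

Lemma bmeasD F G : bmeas F -> bmeas G -> bmeas (fun v => F v + G v).
Proof.
move=> [mF [M hM]] [mG [N hN]]; split; first exact: measurable_funD.
by exists (M + N) => v; rewrite (le_trans (ler_normD _ _))// lerD.
Qed.

Lemma bmeasM F G : bmeas F -> bmeas G -> bmeas (fun v => F v * G v).
Proof.
move=> [mF [M hM]] [mG [N hN]]; split; first exact: measurable_funM.
by exists (M * N) => v; rewrite normrM ler_pM.
Qed.

Lemma bmeasZ c F : bmeas F -> bmeas (fun v => c * F v).
Proof. by move=> ?; apply: bmeasM => //; exact: bmeas_cst. Qed.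

Lemma bmeas_sum (I : Type) (r : seq I) (P : pred I) (F : I -> (nat -> R) -> R) :
  (forall i, P i -> bmeas (F i)) -> bmeas (fun v => \sum_(i <- r | P i) F i v).
Proof.
move=> h; elim: r => [|i r IH].
  by under eq_fun do rewrite big_nil; exact: bmeas_cst.
under eq_fun do rewrite big_cons.
by case: (boolP (P i)) => Pi //; apply: bmeasD => //; exact: h.
Qed.

Lemma bmeas_prod (I : Type) (r : seq I) (P : pred I) (F : I -> (nat -> R) -> R) :
  (forall i, P i -> bmeas (F i)) -> bmeas (fun v => \prod_(i <- r | P i) F i v).
Proof.
move=> h; elim: r => [|i r IH].
  by under eq_fun do rewrite big_nil; exact: bmeas_cst.
under eq_fun do rewrite big_cons.
by case: (boolP (P i)) => Pi //; apply: bmeasM => //; exact: h.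
Qed.

Lemma measurable_upd2 v k : measurable_fun setT (fun t : R => upd v k t : seqR R).
Proof.
apply: measurable_fun_seqR => i; rewrite /upd.
by case: (i == k); [exact: measurable_id|exact: measurable_cst].
Qed.

Lemma lebU : leb U = 2%:E.
Proof. by rewrite lebesgue_measure_itv/= lte_fin ltr0n/= sube0. Qed.

Lemma integrable_upd F v k : bmeas F ->
  leb.-integrable U (EFin \o (fun t => F (upd v k t))).
Proof.
move=> [mF [M hM]]; apply: measurable_bounded_integrable => //.
- by rewrite -[X in (X < _)%E]/(leb U) lebU ltry.
- by apply: measurable_funTS; exact: (measurableT_comp mF (@measurable_upd2 v k)).
- exists M; split; first by rewrite num_real.
  by move=> x Mx y _; exact: le_trans (hM _) (ltW Mx).
Qed.

Lemma avgD k F G v : bmeas F -> bmeas G ->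
  avg k (fun v => F v + G v) v = avg k F v + avg k G v.
Proof.
by move=> bF bG; rewrite /avg RintegralD ?mulrDr//; exact: integrable_upd.
Qed.

Lemma avgZ k c F v : bmeas F -> avg k (fun v => c * F v) v = c * avg k F v.
Proof.
by move=> bF; rewrite /avg RintegralZl; [rewrite mulrCA| |exact: integrable_upd].
Qed.

Lemma avg_cst k c v : avg k (fun=> c) v = c.
Proof. by rewrite /avg Rintegral_cst// -[X in fine X]/(leb U) lebU/= mulrCA mulVf ?mulr1. Qed.

(** The integrals see only values in [0, 2], where [circ_dist] is a distance on the circle;
    pointwise facts are therefore asked for on [box] alone. *)
Definition box v := forall i, 0 <= v i <= 2.

Lemma box_upd v k t : box v -> 0 <= t <= 2 -> box (upd v k t).
Proof. by move=> bv bt i; rewrite /upd; case: ifP. Qed.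

Lemma eq_avg k F G v : box v -> (forall w, box w -> F w = G w) ->
  avg k F v = avg k G v.
Proof.
move=> bv FG; congr (_ * _); apply: eq_Rintegral => t.
by rewrite inE/= in_itv/= => bt; apply: FG; exact: box_upd.
Qed.

Lemma avg_ge0 k F v : box v -> (forall w, box w -> 0 <= F w) -> 0 <= avg k F v.
Proof.
move=> bv F0; apply: mulr_ge0; first by rewrite invr_ge0.
apply: Rintegral_ge0 => t; rewrite /= in_itv/= => bt; apply: F0; exact: box_upd.
Qed.

Lemma le_avgT k F G v : bmeas F -> bmeas G ->
  (forall w, F w <= G w) -> avg k F v <= avg k G v.
Proof.
move=> bF bG FG; rewrite ler_wpM2l ?invr_ge0//.
by apply: le_Rintegral => //; exact: integrable_upd.
Qed.

(** Tonelli's theorem wants nonnegative integrands; adding a bound provides this and shifts every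
    average by a known constant. *)
Let nonneg_shift F : bmeas F -> exists2 M,
  bmeas (fun v => F v + M) & forall v, 0 <= F v + M.
Proof.
move=> bF; have [_ [M hM]] := bF; exists M; first by apply: bmeasD => //; exact: bmeas_cst.
by move=> v; have := hM v; rewrite ler_norml => /andP[]; lra.
Qed.

Let avg_shift k F M v : bmeas F -> avg k F v = avg k (fun v => F v + M) v - M.
Proof.
by move=> bF; rewrite avgD ?avg_cst ?addrK//; exact: bmeas_cst.
Qed.

(** The restriction to [0, 2] is moved into the integrand, so that the average becomes an inner
    integral over the whole line. *)
Let uF F k (z : seqR R * R) : \bar R :=
  (F (upd z.1 k z.2) * \1_(U : set R) z.2)%:E.

Let measurable_uF F k : bmeas F -> measurable_fun setT (uF F k).
Proof.
move=> [mF _]; apply/measurable_EFinP; apply: measurable_funM.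
  exact: (measurableT_comp mF (@measurable_upd k)).
apply: measurableT_comp; last exact: measurable_snd.
exact: measurable_indic.
Qed.

Let integral_uF F k v : (\int[leb]_(t in U) (F (upd v k t))%:E)%E =
  (\int[leb]_t uF F k (v, t))%E.
Proof.
rewrite integral_mkcond; apply: eq_integral => t _.
rewrite /uF patchE indicE/=; case: ifP => _; by rewrite ?mulr1 ?mulr0.
Qed.

(** Measurability is the one that Tonelli's theorem gives for inner integrals; the bound survives
    since averaging is monotone and fixes constants. *)
Lemma bmeas_avg k F : bmeas F -> bmeas (avg k F).
Proof.
move=> bF; have [M bM M0] := nonneg_shift bF; split; last first.
  have [_ [N hN]] := bF; exists N => v; rewrite ler_norml; apply/andP; split.
    rewrite -[X in X <= _](avg_cst k _ v); apply: le_avgT => //.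
      exact: bmeas_cst.
    by move=> w; have := hN w; rewrite ler_norml => /andP[].
  rewrite -[X in _ <= X](avg_cst k _ v); apply: le_avgT => //.
    exact: bmeas_cst.
  by move=> w; have := hN w; rewrite ler_norml => /andP[].
rewrite (_ : avg k F = fun v => avg k (fun v => F v + M) v - M); last first.
  by apply/funext => v; exact: avg_shift.
apply: measurable_funB; last exact: measurable_cst.
apply: measurable_funM; first exact: measurable_cst.
apply: measurableT_comp; first exact: fine_measurable.
rewrite (_ : (fun x => _) = fubini_F leb (uF (fun v => F v + M) k)); last first.
  by apply/funext => v; exact: integral_uF.
apply: (@measurable_fun_fubini_tonelli_F _ _ (seqR R) _ R leb (uF _ k)).
  exact: measurable_uF.
by move=> x; rewrite lee_fin mulr_ge0.
Qed.

Let avgE F k v : bmeas F ->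
  (\int[leb]_t uF F k (v, t) = (2 * avg k F v)%:E)%E.
Proof.
move=> bF; rewrite -integral_uF /avg mulrA mulfV ?mul1r// fineK//.
by apply: integrable_fin_num => //; exact: integrable_upd.
Qed.

Lemma updC v a b s t : a != b -> upd (upd v a s) b t = upd (upd v b t) a s.
Proof.
move=> ab; apply/funext => i; rewrite /upd.
by have [->|//] := eqVneq i b; rewrite eq_sym (negbTE ab).
Qed.

Let avg_swap_ge0 a b F v : a != b -> bmeas F -> (forall v, 0 <= F v) ->
  avg a (avg b F) v = avg b (avg a F) v.
Proof.
move=> ab bF F0.
pose f (z : R * R) := (F (upd (upd v a z.1) b z.2) * \1_(U : set R) z.1 *
  \1_(U : set R) z.2)%:E.
have mf : measurable_fun setT f.
  apply/measurable_EFinP; apply: measurable_funM; [apply: measurable_funM|].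
  - case: (bF) => mF _; apply: (measurableT_comp mF).
    apply: (measurableT_comp (@measurable_upd b)
      (g := fun z : R * R => (upd v a z.1 : seqR R, z.2))).
    apply: measurable_fun_pair; last exact: measurable_snd.
    exact: (measurableT_comp (@measurable_upd2 v a) measurable_fst).
  - by apply: measurableT_comp; [exact: measurable_indic|exact: measurable_fst].
  - by apply: measurableT_comp; [exact: measurable_indic|exact: measurable_snd].
have f0 z : (0 <= f z)%E by rewrite lee_fin !mulr_ge0.
have := @fubini_tonelli _ _ _ _ R leb leb f mf f0.
(* Each inner integral is 2 times an average, so both double integrals carry the same factor 4,
   cancelled at the end. *)
have -> : (\int[leb]_x \int[leb]_y f (x, y) = (2 * (2 * avg a (avg b F) v))%:E)%E.
  rewrite -(avgZ a 2 v (bmeas_avg b bF)) -avgE; last exact/bmeasZ/bmeas_avg.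
  apply: eq_integral => x _; rewrite /f /uF/=.
  rewrite indicE; case: (x \in _); rewrite ?mulr0 ?mulr1.
    rewrite -avgE//; apply: eq_integral => y _; by rewrite mulr1.
  by under eq_integral do rewrite mulr0 mul0r; rewrite integral0.
have -> : (\int[leb]_y \int[leb]_x f (x, y) = (2 * (2 * avg b (avg a F) v))%:E)%E.
  rewrite -(avgZ b 2 v (bmeas_avg a bF)) -avgE; last exact/bmeasZ/bmeas_avg.
  apply: eq_integral => x _; rewrite /f /uF/=.
  rewrite indicE; case: (x \in _); rewrite ?mulr0 ?mulr1.
    rewrite -avgE//; apply: eq_integral => y _; by rewrite mulr1 updC.
  by under eq_integral do rewrite mulr0; rewrite integral0.
have n2 : 2 != 0 :> R by rewrite pnatr_eq0.
by case=> /(mulfI n2)/(mulfI n2).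
Qed.

Lemma avg_swap a b F v : bmeas F -> avg a (avg b F) v = avg b (avg a F) v.
Proof.
have [->//|ab] := eqVneq a b.
move=> bF; have [M bM M0] := nonneg_shift bF.
have E c e : avg c (avg e F) v = avg c (avg e (fun v => F v + M)) v - M.
  rewrite (_ : avg e F = fun v => avg e (fun v => F v + M) v + - M).
    by rewrite avgD ?avg_cst//; [exact: bmeas_avg|exact: bmeas_cst].
  by apply/funext => w; exact: avg_shift.
by rewrite !E avg_swap_ge0.
Qed.

End measurable_sequences.

(** * Iterated averages and independence *)

Section iterated_average.
Variable R : realType.
Implicit Types (F G : (nat -> R) -> R) (v : nat -> R) (k K : nat) (A B : set nat).

Lemma iter_unifS K F v : iter_unif K.+1 F v = avg K (iter_unif K F) v.
Proof. by []. Qed.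

Lemma bmeas_iter K F : bmeas F -> bmeas (iter_unif K F).
Proof. by move=> bF; elim: K => //= K; exact: bmeas_avg. Qed.

Lemma iter_unifD K F G v : bmeas F -> bmeas G ->
  iter_unif K (fun v => F v + G v) v = iter_unif K F v + iter_unif K G v.
Proof.
move=> bF bG; elim: K v => // K IH v; rewrite !iter_unifS -avgD; try exact: bmeas_iter.
by congr avg; apply/funext.
Qed.

Lemma iter_unifZ K c F v : bmeas F ->
  iter_unif K (fun v => c * F v) v = c * iter_unif K F v.
Proof.
move=> bF; elim: K v => // K IH v; rewrite !iter_unifS -avgZ; try exact: bmeas_iter.
by congr avg; apply/funext.
Qed.

Lemma iter_unif_cst K c v : iter_unif K (fun=> c) v = c.
Proof.
elim: K v => // K IH v; rewrite iter_unifS -[RHS](avg_cst K c v).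
by congr avg; apply/funext.
Qed.

Lemma eq_iter_unif K F G v : box v -> (forall w, box w -> F w = G w) ->
  iter_unif K F v = iter_unif K G v.
Proof.
move=> bv FG; elim: K v bv => [|K IH] v bv; first exact: FG.
by rewrite !iter_unifS; exact: eq_avg.
Qed.

Lemma iter_unif_ge0 K F v : box v -> (forall w, box w -> 0 <= F w) ->
  0 <= iter_unif K F v.
Proof.
move=> bv F0; elim: K v bv => [|K IH] v bv; first exact: F0.
by rewrite iter_unifS; exact: avg_ge0.
Qed.

Lemma avg_id k F v : avg k (avg k F) v = avg k F v.
Proof.
rewrite -[RHS](avg_cst k _ v) /avg; congr (_ * _).
apply: eq_Rintegral => t _; congr (_ * _); apply: eq_Rintegral => s _; congr F.
by apply/funext => i; rewrite /upd; case: (i == k).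
Qed.

Lemma avg_iter_unif k K F v : bmeas F ->
  avg k (iter_unif K F) v = iter_unif K (avg k F) v.
Proof.
move=> bF; elim: K v => // K IH v; rewrite !iter_unifS avg_swap; last exact: bmeas_iter.
by congr avg; apply/funext.
Qed.

(** Idempotence when k is the outermost coordinate, commutation of averages otherwise. It allows any
    chosen coordinate to be integrated out first. *)
Lemma iter_unif_avg k K F v : bmeas F -> (k < K)%N ->
  iter_unif K (avg k F) v = iter_unif K F v.
Proof.
move=> bF; elim: K v => // K IH v; rewrite ltnS leq_eqVlt => /predU1P[<-|kK].
  by rewrite !iter_unifS -[RHS]avg_id; congr avg; apply/funext => w; rewrite -avg_iter_unif.
by rewrite !iter_unifS; congr avg; apply/funext => w; exact: IH.
Qed.

Definition depends_on A F := forall v w, (forall i, A i -> v i = w i) -> F v = F w.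

Lemma depends_on_avg A k F : depends_on A F -> depends_on A (avg k F).
Proof.
move=> dF v w vw; congr (_ * _); apply: eq_Rintegral => t _; apply: dF => i Ai.
by rewrite /upd; case: ifP => // _; exact: vw.
Qed.

Lemma depends_on_iter A K F : depends_on A F -> depends_on A (iter_unif K F).
Proof. by move=> dF; elim: K => // K; exact: depends_on_avg. Qed.

Lemma depends_on_upd A k F v t : depends_on A F -> ~ A k -> F (upd v k t) = F v.
Proof.
by move=> dF Ak; apply: dF => i Ai; rewrite /upd; case: eqP => // ik; rewrite ik in Ai.
Qed.

Lemma depends_onS A B F : A `<=` B -> depends_on A F -> depends_on B F.
Proof. by move=> AB dF v w vw; apply: dF => i Ai; apply: vw; exact: AB. Qed.

Lemma depends_on_prod (I : Type) (r : seq I) (P : pred I) A (F : I -> (nat -> R) -> R) :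
  (forall i, P i -> depends_on A (F i)) -> depends_on A (fun v => \prod_(i <- r | P i) F i v).
Proof. by move=> dF v w vw; apply: eq_bigr => i Pi; exact: dF. Qed.

Lemma avgMl A k F G v : bmeas F -> depends_on A G -> ~ A k ->
  avg k (fun v => G v * F v) v = G v * avg k F v.
Proof.
move=> bF dG Ak; rewrite -avgZ//; congr (_ * _); apply: eq_Rintegral => t _.
by rewrite (depends_on_upd _ _ dG).
Qed.

(** Independence: the coordinate integrated at each stage lies in at most one of A and B, so one of
    the two factors leaves the integral. *)
Lemma iter_unifM A B K F G v : bmeas F -> bmeas G -> depends_on A F ->
  depends_on B G -> A `&` B = set0 ->
  iter_unif K (fun v => F v * G v) v = iter_unif K F v * iter_unif K G v.
Proof.
move=> bF bG dF dG AB; elim: K v => // K IH v; rewrite !iter_unifS.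
rewrite (_ : iter_unif K _ = (fun v => iter_unif K F v * iter_unif K G v)); last exact/funext.
have [AK|AK] := pselect (A K); last first.
  have dF' := depends_on_iter K dF.
  rewrite (@avgMl A)//; last exact: bmeas_iter.
  congr (_ * _); rewrite -[LHS](avg_cst K _ v); congr (_ * _).
  by apply: eq_Rintegral => t _; rewrite (depends_on_upd _ _ dF').
have BK : ~ B K by move=> BK; have : (A `&` B) K by []; rewrite AB.
have dG' := depends_on_iter K dG.
rewrite (_ : (fun v => _) = (fun v => iter_unif K G v * iter_unif K F v)); last first.
  by apply/funext => w; rewrite mulrC.
rewrite (@avgMl B)//; last exact: bmeas_iter.
rewrite mulrC; congr (_ * _); rewrite -[LHS](avg_cst K _ v); congr (_ * _).
by apply: eq_Rintegral => t _; rewrite (depends_on_upd _ _ dG').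
Qed.

End iterated_average.

(** * The expectation functional *)

Section expectation.
Variable R : realType.
Implicit Types (F G : (nat -> R) -> R) (k K : nat) (A B : set nat).

Lemma box0 : box (fun=> 0 : R).
Proof. by move=> i; rewrite lexx ler0n. Qed.

Lemma unif_expectD K F G : bmeas F -> bmeas G ->
  unif_expect K (fun v => F v + G v) = unif_expect K F + unif_expect K G.
Proof. exact: iter_unifD. Qed.

Lemma unif_expectZ K c F : bmeas F ->
  unif_expect K (fun v => c * F v) = c * unif_expect K F.
Proof. exact: iter_unifZ. Qed.

Lemma unif_expect_cst K c : unif_expect K (fun=> c) = c :> R.
Proof. exact: iter_unif_cst. Qed.

Lemma eq_unif_expect K F G : (forall w, box w -> F w = G w) ->
  unif_expect K F = unif_expect K G.
Proof. by apply: eq_iter_unif; exact: box0. Qed.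

Lemma unif_expect_ge0 K F : (forall w, box w -> 0 <= F w) -> 0 <= unif_expect K F.
Proof. by apply: iter_unif_ge0; exact: box0. Qed.

Lemma le_unif_expect K F G : bmeas F -> bmeas G ->
  (forall w, box w -> F w <= G w) -> unif_expect K F <= unif_expect K G.
Proof.
move=> bF bG FG; rewrite -subr_ge0 -mulN1r -unif_expectZ// -unif_expectD//; last exact: bmeasZ.
by apply: unif_expect_ge0 => w /FG; rewrite mulN1r subr_ge0.
Qed.

Lemma unif_expect_sum (I : Type) (r : seq I) (P : pred I) K (F : I -> (nat -> R) -> R) :
  (forall i, P i -> bmeas (F i)) ->
  unif_expect K (fun v => \sum_(i <- r | P i) F i v) =
  \sum_(i <- r | P i) unif_expect K (F i).
Proof.
move=> bF; elim: r => [|i r IH].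
  by under eq_fun do rewrite big_nil; rewrite unif_expect_cst big_nil.
under eq_fun do rewrite big_cons; rewrite big_cons.
case: (boolP (P i)) => Pi //; rewrite unif_expectD ?IH//; first exact: bF.
exact: bmeas_sum.
Qed.

Lemma unif_expect_avg k K F : bmeas F -> (k < K)%N ->
  unif_expect K (avg k F) = unif_expect K F.
Proof. exact: iter_unif_avg. Qed.

Lemma unif_expectM A B K F G : bmeas F -> bmeas G -> depends_on A F ->
  depends_on B G -> A `&` B = set0 ->
  unif_expect K (fun v => F v * G v) = unif_expect K F * unif_expect K G.
Proof. exact: iter_unifM. Qed.

Lemma unif_expect_prod (I : eqType) (r : seq I) K (F : I -> (nat -> R) -> R)
    (A : I -> set nat) : uniq r ->
  (forall i, bmeas (F i)) -> (forall i, depends_on (A i) (F i)) ->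
  (forall i j, i != j -> A i `&` A j = set0) ->
  unif_expect K (fun v => \prod_(i <- r) F i v) = \prod_(i <- r) unif_expect K (F i).
Proof.
move=> ur bF dF dA; elim: r ur => [_|i r IH] /=.
  by under eq_fun do rewrite big_nil; rewrite unif_expect_cst big_nil.
move=> /andP[ir ur].
under eq_fun do rewrite big_cons; rewrite big_cons -IH//.
apply: (@unif_expectM (A i) (\bigcup_(j in [set` r]) A j)) => //.
- exact: bmeas_prod.
- move=> v w vw; apply: eq_big_seq => j jr; apply: dF => l Al.
  by apply: vw; exists j.
- rewrite setI_bigcupr bigcup0// => j /= jr; apply: dA.
  by apply: contraNneq ir => ->.
Qed.

End expectation.

(** * Far points on one circle *)

Section circle.
Variable R : realType.
Local Notation U := `[0%R, 2%R]%classic.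
Local Notation leb := (@lebesgue_measure R).
Implicit Types (a b c t tau : R) (v : nat -> R).

Lemma circ_distC a b : circ_dist a b = circ_dist b a.
Proof. by rewrite /circ_dist distrC. Qed.

Lemma lt_circ_dist tau a b :
  (tau < circ_dist a b) = (tau < `|a - b|) && (`|a - b| < 2 - tau).
Proof. by rewrite /circ_dist lt_min; congr (_ && _); apply/idP/idP; lra. Qed.

(* Both neighbours of [b] lie near its antipode, hence near each other. *)
Lemma circ_dist_antipodal tau a b c : 0 <= a <= 2 -> 0 <= b <= 2 -> 0 <= c <= 2 ->
  tau < circ_dist a b -> tau < circ_dist b c -> circ_dist a c <= 2 * (1 - tau).
Proof.
move=> ha hb hc; rewrite !lt_circ_dist /circ_dist ge_min.
case: (ger0P (a - b)) => ?; case: (ger0P (b - c)) => ?; case: (ger0P (a - c)) => ?;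
move=> /andP[? ?] /andP[? ?]; apply/orP; try (by left; lra); by right; lra.
Qed.

(** The far points form an arc of length 2 (1 - tau) around the antipode of b. The three cases tell
    whether the cut of the circle at 0 splits that arc. *)
Lemma far_from_mid tau b : 0 <= tau <= 1 -> 0 <= b <= 2 ->
  leb ([set t | tau < circ_dist t b] `&` U) = (2 * (1 - tau))%:E.
Proof.
move=> ht hb.
have [bt|bt] := leP b tau.
  have -> : [set t | tau < circ_dist t b] `&` U = `]b + tau, b + 2 - tau[%classic.
    apply/seteqP; split => t /=; rewrite lt_circ_dist !in_itv/=.
      by case: (ger0P (t - b)); lra.
    by case: (ger0P (t - b)); lra.
  rewrite lebesgue_measure_itv/= lte_fin; case: ifPn => ?.
    by rewrite -EFinB; congr EFin; ring.
  by congr EFin; lra.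
have [bt2|bt2] := leP (2 - tau) b.
  have -> : [set t | tau < circ_dist t b] `&` U = `]b - 2 + tau, b - tau[%classic.
    apply/seteqP; split => t /=; rewrite lt_circ_dist !in_itv/=.
      by case: (ger0P (t - b)); lra.
    by case: (ger0P (t - b)); lra.
  rewrite lebesgue_measure_itv/= lte_fin; case: ifPn => ?.
    by rewrite -EFinB; congr EFin; ring.
  by congr EFin; lra.
have -> : [set t | tau < circ_dist t b] `&` U = `[0, b - tau[%classic `|` `]b + tau, 2]%classic.
  apply/seteqP; split => t /=; rewrite lt_circ_dist !in_itv/=.
    case: (ger0P (t - b)) => ? h; [right|left]; lra.
  by case: (ger0P (t - b)) => ? []; lra.
rewrite measureU//; last first.
  by apply/seteqP; split => t //=; rewrite !in_itv/=; lra.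
rewrite -[X in (X + _)%E]/(leb _) -[X in (_ + X)%E]/(leb _).
rewrite !lebesgue_measure_itv/= !lte_fin !ifT; [|lra..].
by rewrite -!EFinB -EFinD; congr EFin; ring.
Qed.

Definition far tau (a b : nat) v : R :=
  ((tau < circ_dist (v a) (v b))%R : bool)%:R.

Lemma farC tau (a b : nat) v : far tau a b v = far tau b a v.
Proof. by rewrite /far circ_distC. Qed.

Lemma bmeas_far tau (a b : nat) : bmeas (far tau a b).
Proof.
split; last by exists 1 => v; rewrite /far; case: (_ < _); rewrite ?normr1 ?normr0.
rewrite (_ : far tau a b =
  \1_[set v : seqR R | tau < circ_dist (v a) (v b)]); last first.
  by apply/funext => v; rewrite /far indicE mem_setE.
apply: measurable_indic.
rewrite [X in measurable X](_ : _ =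
   setT `&` (fun v : seqR R => circ_dist (v a) (v b)) @^-1` `]tau, +oo[); last first.
  by rewrite setTI; apply/seteqP; split => v/=; rewrite in_itv/= andbT.
have mab : measurable_fun setT (fun v : seqR R => `|v a - v b|).
  apply: measurableT_comp => //; apply: measurable_funB; exact: measurable_coord.
suff : measurable_fun setT (fun v : seqR R => circ_dist (v a) (v b)) by apply.
apply: measurable_minr => //.
by apply: measurable_funB => //; exact: measurable_cst.
Qed.

Lemma avg_far tau (a b : nat) v : 0 <= tau <= 1 -> a != b -> box v ->
  avg a (far tau a b) v = 1 - tau.
Proof.
move=> ht ab bv; rewrite /avg (_ : Rintegral _ _ _ = 2 * (1 - tau)).
  by rewrite mulrA mulVf ?mul1r.
rewrite (_ : (fun t => _) = \1_[set t | tau < circ_dist t (v b)]); last first.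
  apply/funext => t; rewrite /far indicE mem_setE /upd eqxx.
  by rewrite eq_sym (negbTE ab).
rewrite /Rintegral integral_indic//.
- by rewrite -[X in fine X]/(leb _) far_from_mid.
- rewrite [X in measurable X](_ : _ =
    setT `&` (fun t : R => circ_dist t (v b)) @^-1` `]tau, +oo[); last first.
    by rewrite setTI; apply/seteqP; split => t/=; rewrite in_itv/= andbT.
  have mab : measurable_fun setT (fun t : R => `|t - v b|).
    by apply: measurableT_comp => //; apply: measurable_funB.
  suff : measurable_fun setT (fun t : R => circ_dist t (v b)) by apply.
  by apply: measurable_minr => //; apply: measurable_funB.
Qed.

Lemma depends_on_far tau (a b : nat) :
  depends_on [set i | i = a \/ i = b] (far tau a b).
Proof. by move=> v w vw; rewrite /far !vw//=; [right|left]. Qed.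

(** Coordinate a is averaged first: by rotation invariance the mean of [far] is 1 - tau whatever the
    value at b, and F does not see a. *)
Lemma unif_expect_far tau (a b K : nat) (A : set nat) F : 0 <= tau <= 1 -> a != b ->
  (a < K)%N -> bmeas F -> depends_on A F -> ~ A a ->
  unif_expect K (fun v => far tau a b v * F v) = (1 - tau) * unif_expect K F.
Proof.
move=> ht ab aK bF dF Aa.
have bf : bmeas (fun v => far tau a b v * F v) by apply: bmeasM => //; exact: bmeas_far.
rewrite -(@unif_expect_avg _ a)// -unif_expectZ//; apply: eq_unif_expect => v bv.
rewrite [LHS](_ : _ = avg a (fun v => F v * far tau a b v) v); last first.
  by congr avg; apply/funext => w; rewrite mulrC.
by rewrite (@avgMl _ A)//; [rewrite avg_far// mulrC|exact: bmeas_far].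
Qed.

(** Two far pairs force the third distance below 2 (1 - tau), which is at most tau once tau >=
    2/3. *)
Lemma far_triangle tau (a b c : nat) v : 2%:R / 3%:R <= tau -> box v ->
  far tau a b v * far tau b c v * far tau c a v = 0.
Proof.
move=> ht bv; rewrite /far.
case: (boolP (tau < circ_dist (v a) (v b))) => [h1|_]; last by rewrite !mul0r.
case: (boolP (tau < circ_dist (v b) (v c))) => [h2|_]; last by rewrite mulr0 mul0r.
have := circ_dist_antipodal (bv a) (bv b) (bv c) h1 h2.
rewrite circ_distC => h; rewrite (_ : _ < _ = false) ?mulr0//.
by apply/negbTE; rewrite -leNgt; lra.
Qed.

(* Cauchy-Schwarz: the measure g of the common far points of [a] and [c] has mean
   (1 - tau)^2 and is supported on a set of measure 2 (1 - tau). *)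
Lemma far_4cycle tau (a b c e K : nat) : 2%:R / 3%:R <= tau <= 1 -> uniq [:: a; b; c; e] ->
  (a < K)%N -> (b < K)%N -> (c < K)%N -> (e < K)%N ->
  (1 - tau) ^+ 3 / 2 <= unif_expect K (fun v =>
    far tau a b v * far tau b c v * (far tau c e v * far tau e a v)).
Proof.
move=> ht; rewrite /= !inE !negb_or => /and4P[/and3P[ab ac ae] /andP[bc be] ce _].
move=> aK bK cK eK.
pose h z v := far tau a z v * far tau z c v.
pose g := avg b (h b).
have bh z : bmeas (h z) by apply: bmeasM; exact: bmeas_far.
have bg : bmeas g by exact: bmeas_avg.
have dh z : depends_on [set i | i = z \/ (i = a \/ i = c)] (h z).
  by move=> v w vw; rewrite /h /far !vw //=; tauto.
have dg : depends_on [set i | i = a \/ i = c] g.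
  move=> v w vw; congr (_ * _); apply: eq_Rintegral => t _; apply: dh => i /=.
  by rewrite /upd; case: eqP => // ib; case=> // ac'; exact: vw.
have gE : avg e (h e) = g.
  apply/funext => v; congr (_ * _); apply: eq_Rintegral => t _.
  rewrite /h /far /upd !eqxx (negbTE ab) (negbTE ae).
  by rewrite (eq_sym c b) (negbTE bc) (negbTE ce).
(* The two paths from a to c, through b and through e, are independent given a and c and have the
   same conditional mean g. *)
have -> : unif_expect K (fun v =>
    far tau a b v * far tau b c v * (far tau c e v * far tau e a v)) =
    unif_expect K (fun v => g v * g v).
  rewrite (_ : (fun v => _) = (fun v => h b v * h e v)); last first.
    apply/funext => v; rewrite /h; congr (_ * _).
    by rewrite (farC tau c e) (farC tau e a) mulrC.
  rewrite -(@unif_expect_avg _ e)//; last exact: bmeasM.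
  rewrite (_ : avg e _ = fun v => g v * h b v); last first.
    apply/funext => v; rewrite (avgMl _ (bh e) (dh b)) ?gE 1?mulrC//=.
    by case=> [eb|[ea|ec]]; [rewrite eb eqxx in be|rewrite ea eqxx in ae|rewrite ec eqxx in ce].
  rewrite -(@unif_expect_avg _ b)//; last exact: bmeasM.
  congr unif_expect; apply/funext => v; rewrite (avgMl _ (bh b) dg)//=.
  by case=> [eb|ec]; [rewrite eb eqxx in ab|rewrite ec eqxx in bc].
pose l := 1 - tau.
have Eg : unif_expect K g = l ^+ 2.
  rewrite unif_expect_avg// /h (@unif_expect_far _ _ _ _ [set i | i = b \/ i = c])//.
  - rewrite (_ : far _ _ _ = fun v => far tau c b v * 1); last first.
      by apply/funext => v; rewrite mulr1 farC.
    rewrite (@unif_expect_far _ _ _ _ set0) ?unif_expect_cst ?mulr1//.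
    + by lra.
    + by rewrite eq_sym.
    + exact: bmeas_cst.
  - by lra.
  - exact: bmeas_far.
  - exact: depends_on_far.
  - by case=> [eb|ec]; [rewrite eb eqxx in ab|rewrite ec eqxx in ac].
(* D indicates that a and c are within 2 l of each other; g vanishes where D does. *)
pose D v : R := 1 - far (2 * l) a c v.
have bD : bmeas D.
  rewrite (_ : D = fun v => 1 + (-1) * far (2 * l) a c v).
    by apply: bmeasD; [exact: bmeas_cst|exact/bmeasZ/bmeas_far].
  by apply/funext => v; rewrite mulN1r.
have ED : unif_expect K D = 2 * l.
  rewrite (_ : D = fun v => 1 + (-1) * (far (2 * l) a c v * 1)); last first.
    by apply/funext => v; rewrite mulN1r mulr1.
  rewrite unif_expectD; last 2 first.
  - exact: bmeas_cst.
  - by apply/bmeasZ/bmeasM; [exact: bmeas_far|exact: bmeas_cst].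
  rewrite unif_expectZ; last by apply/bmeasM; [exact: bmeas_far|exact: bmeas_cst].
  rewrite (@unif_expect_far _ _ _ _ set0) ?unif_expect_cst//.
  - by rewrite /l; ring.
  - by rewrite /l; lra.
  - exact: bmeas_cst.
have g0 v : box v -> far (2 * l) a c v = 1 -> g v = 0.
  move=> bv; rewrite /far; case: ltP => hl; last by move/eqP; rewrite eq_sym oner_eq0.
  move=> _; rewrite -[RHS](avg_cst b 0 v); congr (_ * _); apply: eq_Rintegral => t.
  rewrite inE/= in_itv/= => bt; rewrite /h /far /upd !eqxx (negbTE ab).
  rewrite (eq_sym c b) (negbTE bc).
  case: (boolP (tau < circ_dist (v a) t)) => [h1|_]; last by rewrite mul0r.
  case: (boolP (tau < circ_dist t (v c))) => [h2|_]; last by rewrite mulr0.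
  by have := circ_dist_antipodal (bv a) bt (bv c) h1 h2; rewrite -/l leNgt hl.
(* Cauchy-Schwarz in linear form: g^2 >= l g - (l/2)^2 D pointwise, where l/2 is the quotient of the
   means l^2 of g and 2 l of D. The right side has mean l^3 - l^3/2. *)
have lw : l ^+ 3 / 2 = unif_expect K (fun v => l * g v + (- (l / 2) ^+ 2) * D v).
  rewrite unif_expectD; [|exact: bmeasZ..].
  by rewrite (unif_expectZ K l bg) (unif_expectZ K _ bD) Eg ED; field; rewrite ?pnatr_eq0.
rewrite -/l lw; apply: le_unif_expect.
- by apply: bmeasD; exact: bmeasZ.
- exact: bmeasM.
move=> v bv; have [fac|fac] := eqVneq (far (2 * l) a c v) 1.
  by rewrite g0// /D fac subrr !mulr0 addr0.
have -> : D v = 1 by move: fac; rewrite /D /far; case: ltP; rewrite ?eqxx ?subr0.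
by have := sqr_ge0 (g v - l / 2); rewrite !expr2; lra.
Qed.

End circle.

(** * Expansion of products over subsets *)

Local Notation cover := finset.cover.

Lemma prodrD_subset (R : comNzRingType) (I : finType) (S : {set I}) (f g : I -> R) :
  \prod_(i in S) (f i + g i) = \sum_(T : {set I} | T \subset S)
    (\prod_(i in T) f i) * (\prod_(i in S :\: T) g i).
Proof.
(* Extending f by 0 and g by 1 outside S reduces the claim to the expansion over all subsets of
   I. *)
pose F i := if i \in S then f i else 0; pose G i := if i \in S then g i else 1.
have -> : \prod_(i in S) (f i + g i) = \prod_i (F i + G i).
  rewrite big_mkcond; apply: eq_bigr => i _; rewrite /F /G.
  by case: ifP; rewrite ?add0r.
rewrite (bigA_distr 1 +%R F G) [RHS]big_mkcond; apply: eq_bigr => T _.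
case: ifPn => [TS|]; last first.
  move=> /subsetPn[i iT iS]; rewrite (bigD1 i)//= iT /F (negbTE iS) mul0r //.
rewrite [X in _ = X * _]big_mkcond [X in _ = _ * X]big_mkcond -big_split/=.
apply: eq_bigr => i _; rewrite inE /F /G.
have [iT|iT] := boolP (i \in T); first by rewrite (fintype.subsetP TS)//= mulr1.
by rewrite mul1r.
Qed.

Lemma natr_forall_in (R : comNzRingType) (I : finType) (A P : pred I) :
  ([forall (i | A i), P i])%:R = \prod_(i | A i) (P i)%:R :> R.
Proof.
have [/forallP h|/forallPn[i]] := boolP [forall (i | A i), P i].
  by rewrite big1// => i Ai; move: (h i); rewrite Ai => /= ->.
by rewrite negb_imply => /andP[Ai nPi]; rewrite (bigD1 i)//= (negbTE nPi) mul0r.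
Qed.

Lemma natr_forall (R : comNzRingType) (I : finType) (P : pred I) :
  ([forall i, P i])%:R = \prod_i (P i)%:R :> R.
Proof.
by rewrite -natr_forall_in; congr ((nat_of_bool _)%:R); apply: eq_forallb.
Qed.

(** * Bad and good edges within one slot *)

Section slot.
Variables (R : realType) (n d : nat) (tau : R).
Implicit Types (k : nat) (e : {set 'I_n}) (S T : {set {set 'I_n}}) (v : nat -> R).

(* Slot [k] consists of the coordinates [i * d + k], one for each vertex [i]; an
   edge is present iff it is bad in none of the [d] slots. *)
Definition bad_edge k e v : bool :=
  ~~ [forall i in e, forall j in e, (i == j) ||
        ((circ_dist (v (i * d + k)%N) (v (j * d + k)%N) <= tau)%R : bool)].

Definition bad_expect k T : R :=
  unif_expect (n * d) (fun v => \prod_(e in T) (bad_edge k e v)%:R).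

Definition good_expect k S : R :=
  unif_expect (n * d) (fun v => \prod_(e in S) (1 - (bad_edge k e v)%:R)).

Lemma bad_edge2 k (a b : 'I_n) v : a != b ->
  (bad_edge k [set a; b] v)%:R = far tau (a * d + k) (b * d + k) v :> R.
Proof.
move=> ab; rewrite /far ltNge; congr ((~~ _)%:R : R); apply/idP/idP.
  move=> /forallP/(_ a)/implyP; rewrite !inE eqxx/= => /(_ isT)/forallP/(_ b)/implyP.
  by rewrite !inE eqxx orbT (negbTE ab)/=; apply.
move=> h; apply/forallP => i; apply/implyP => ie; apply/forallP => j; apply/implyP.
move: ie; rewrite !inE => /orP[]/eqP-> /orP[]/eqP->; rewrite ?eqxx// ?h ?orbT//.
by rewrite circ_distC h orbT.
Qed.

Lemma bmeas_bad k e : bmeas (fun v => (bad_edge k e v)%:R : R).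
Proof.
rewrite (_ : (fun v => _) = fun v => 1 + (-1) * \prod_(i in e) \prod_(j in e)
    ((i == j) || ((circ_dist (v (i * d + k)%N) (v (j * d + k)%N) <= tau)%R : bool))%:R);
    last first.
  apply/funext => v; rewrite /bad_edge.
  under eq_bigr do rewrite -natr_forall_in.
  by rewrite -natr_forall_in; case: [forall _ in _, _]; rewrite /= mulN1r ?subrr ?subr0.
apply: bmeasD; [exact: bmeas_cst|apply: bmeasZ].
apply: bmeas_prod => i _; apply: bmeas_prod => j _.
have [_|ij] /= := eqVneq i j; first exact: bmeas_cst.
rewrite (_ : (fun v => _) = fun v => 1 + (-1) * far tau (i * d + k) (j * d + k) v).
  by apply: bmeasD; [exact: bmeas_cst|apply: bmeasZ; exact: bmeas_far].
by apply/funext => v; rewrite /far; case: leP; rewrite mulN1r ?subrr ?subr0.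
Qed.

Lemma depends_on_bad k e :
  depends_on [set l | exists2 i, i \in e & l = (i * d + k)%N]
    (fun v => (bad_edge k e v)%:R : R).
Proof.
move=> v w vw; rewrite /bad_edge; congr ((~~ _)%:R : R).
apply: eq_forallb => i; have [ie|//] := boolP (i \in e); congr (_ ==> _).
apply: eq_forallb => j; have [je|//] := boolP (j \in e); congr (_ ==> _).
by rewrite !vw//=; [exists j|exists i].
Qed.

Lemma bmeas_prod_bad k T : bmeas (fun v => \prod_(e in T) (bad_edge k e v)%:R : R).
Proof. by apply: bmeas_prod => e _; exact: bmeas_bad. Qed.

Lemma bmeas_prod_good k S : bmeas (fun v => \prod_(e in S) (1 - (bad_edge k e v)%:R) : R).
Proof.
apply: bmeas_prod => e _; under eq_fun do rewrite -mulN1r.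
by apply: bmeasD; [exact: bmeas_cst|apply: bmeasZ; exact: bmeas_bad].
Qed.

Lemma depends_on_prod_bad k T :
  depends_on [set l | exists2 i, i \in cover T & l = (i * d + k)%N]
    (fun v => \prod_(e in T) (bad_edge k e v)%:R : R).
Proof.
apply: depends_on_prod => e eT; apply: depends_onS (@depends_on_bad k e).
by move=> l [i ie ->]; exists i => //; apply/bigcupP; exists e.
Qed.

(** Inclusion-exclusion over the edges that are bad. *)
Lemma good_expectE k S :
  good_expect k S = \sum_(T : {set {set 'I_n}} | T \subset S) (-1) ^+ #|T| * bad_expect k T.
Proof.
rewrite /good_expect; under eq_fun do
  (under eq_bigr do rewrite addrC -mulN1r; rewrite prodrD_subset).
rewrite unif_expect_sum; last first.
  move=> T _; apply: bmeasM; apply: bmeas_prod => i _; last exact: bmeas_cst.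
  by apply: bmeasZ; exact: bmeas_bad.
apply: eq_bigr => T _; rewrite -unif_expectZ; last exact: bmeas_prod_bad.
congr unif_expect; apply/funext => v.
by rewrite big_split/= [X in _ * X]big1// mulr1 prodr_const.
Qed.

Lemma bad_expect0 k : bad_expect k finset.set0 = 1.
Proof. by rewrite /bad_expect; under eq_fun do rewrite big_set0; rewrite unif_expect_cst. Qed.

Lemma bad_expect_ge0 k T : 0 <= bad_expect k T.
Proof. by apply: unif_expect_ge0 => v _; apply: prodr_ge0 => e _; rewrite ler0n. Qed.

Lemma bad_expect_anti k S T : S \subset T -> bad_expect k T <= bad_expect k S.
Proof.
move=> ST; apply: le_unif_expect; [exact: bmeas_prod_bad..|] => v _.
rewrite (big_setID S)/= (finset.setIidPr ST) ler_piMr//.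
  by apply: prodr_ge0 => e _; rewrite ler0n.
by apply: prodr_ile1 => e _; rewrite ler0n lern1 leq_b1.
Qed.

Hypothesis d0 : (0 < d)%N.
Hypothesis tau01 : 0 <= tau <= 1.

Let crd_lt k (i : 'I_n) : (k < d)%N -> (i * d + k < n * d)%N.
Proof.
by move=> kd; rewrite (@leq_trans (i.+1 * d)) ?leq_mul// mulSn addnC ltn_add2r.
Qed.

Let crd_inj k (i j : 'I_n) : (i * d + k = j * d + k)%N -> i = j.
Proof.
by move=> /eqP; rewrite eqn_add2r eqn_pmul2r// => /eqP/val_inj.
Qed.

Let crd_neq k (i j : 'I_n) : i != j -> (i * d + k != j * d + k)%N.
Proof. by apply: contraNneq => /crd_inj ->. Qed.

(** The coordinate of the leaf z occurs in no edge of S, so averaging it first turns the new edge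
    into a factor 1 - tau. All independence along forests comes from here. *)
Lemma bad_expect_leaf k (e : {set 'I_n}) (z : 'I_n) S : (k < d)%N -> e \in pairs n -> z \in e ->
  z \notin cover S -> bad_expect k (e |: S)%SET = (1 - tau) * bad_expect k S.
Proof.
rewrite inE => kd /cards2P[a [b [ab ->]]] ze zS.
have [w zw ->] : exists2 w, z != w & [set a; b]%SET = [set z; w]%SET.
  move: ze; rewrite !inE => /orP[]/eqP->; first by exists b.
  by exists a; rewrite ?(eq_sym b)// finset.setUC.
rewrite /bad_expect.
have eS : [set z; w]%SET \notin S.
  by apply: contra zS => eS; apply/bigcupP; exists [set z; w]%SET; rewrite // !inE eqxx.
under eq_fun do rewrite big_setU1// bad_edge2//.
apply: unif_expect_far; rewrite ?crd_neq ?crd_lt//.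
- exact: bmeas_prod_bad.
- exact: depends_on_prod_bad.
- by case=> i iS /crd_inj zi; rewrite zi iS in zS.
Qed.

Lemma bad_expect_disjoint k S T : (k < d)%N -> S \subset pairs n ->
  (cover S :&: cover T = finset.set0)%SET ->
  bad_expect k (S :|: T)%SET = bad_expect k S * bad_expect k T.
Proof.
move=> kd Sp ST.
have notinT i : i \in cover S -> i \notin cover T.
  by move=> iS; apply/negP => iT; have := finset.in_set0 i; rewrite -ST inE iS iT.
rewrite /bad_expect -(unif_expectM _ (bmeas_prod_bad k S)
   (bmeas_prod_bad k T) (@depends_on_prod_bad k S) (@depends_on_prod_bad k T)).
  congr unif_expect; apply/funext => v; rewrite -bigU; first by apply: eq_bigl => e; rewrite !inE.
  rewrite disjoint_subset; apply/fintype.subsetP => e eS; rewrite inE.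
  apply/negP => eT; have := fintype.subsetP Sp _ eS; rewrite inE => /cards2P[a [b [_ eab]]].
  suff /notinT/negP[] : a \in cover S by apply/bigcupP; exists e => //; rewrite eab !inE eqxx.
  by apply/bigcupP; exists e => //; rewrite eab !inE eqxx.
apply/seteqP; split => // l [[i iS ->]] [j jT /crd_inj ij].
by have := notinT _ iS; rewrite ij jT.
Qed.

Lemma bad_expect_triangle k T (a b c : 'I_n) : 2%:R / 3%:R <= tau -> uniq [:: a; b; c] ->
  [set a; b]%SET \in T -> [set b; c]%SET \in T -> [set c; a]%SET \in T ->
  bad_expect k T = 0.
Proof.
move=> ht; rewrite /= !inE negb_or => /and3P[/andP[ab ac] bc _] abT bcT caT.
rewrite -(unif_expect_cst (n * d) 0); apply: eq_unif_expect => v bv.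
have /eqP := far_triangle (a * d + k) (b * d + k) (c * d + k) ht bv.
have ca : c != a by rewrite eq_sym.
rewrite -!bad_edge2// !mulf_eq0 -orbA => /or3P[] /eqP h.
- by rewrite (bigD1 [set a; b]%SET)//= h mul0r.
- by rewrite (bigD1 [set b; c]%SET)//= h mul0r.
- by rewrite (bigD1 [set c; a]%SET)//= h mul0r.
Qed.

Lemma bad_expect_4cycle k (a b c e : 'I_n) : (k < d)%N -> 2%:R / 3%:R <= tau ->
  uniq [:: a; b; c; e] ->
  (1 - tau) ^+ 3 / 2 <=
  bad_expect k [set [set a; b]; [set b; c]; [set c; e]; [set e; a]]%SET.
Proof.
move=> kd ht; rewrite /= !inE !negb_or => /and4P[/and3P[ab ac ae] /andP[bc be] ce _].
have uq : uniq [:: (a * d + k)%N; (b * d + k)%N; (c * d + k)%N; (e * d + k)%N].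
  by rewrite /= !inE !negb_or !crd_neq.
have ht1 : 2%:R / 3%:R <= tau <= 1 by rewrite ht; case/andP: tau01.
apply: le_trans (far_4cycle ht1 uq _ _ _ _) _; [exact: crd_lt..|].
apply: le_unif_expect.
- by do 2 apply: bmeasM; try (by apply: bmeasM; exact: bmeas_far); exact: bmeas_far.
- exact: bmeas_prod_bad.
have ea : e != a by rewrite eq_sym.
move=> v _; rewrite -!bad_edge2//.
(* If one of the four edges is good, the left side is 0; otherwise every factor on the right is
   1. *)
case E1 : (bad_edge k [set a; b]%SET v); last first.
  by rewrite !mul0r prodr_ge0// => ? _; rewrite ler0n.
case E2 : (bad_edge k [set b; c]%SET v); last first.
  by rewrite mulr0 !mul0r prodr_ge0// => ? _; rewrite ler0n.
case E3 : (bad_edge k [set c; e]%SET v); last first.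
  by rewrite mul0r !mulr0 prodr_ge0// => ? _; rewrite ler0n.
case E4 : (bad_edge k [set e; a]%SET v); last first.
  by rewrite !mulr0 prodr_ge0// => ? _; rewrite ler0n.
rewrite big1 ?mulr1// => f.
by rewrite !inE -!orbA => /or4P[]/eqP->; rewrite ?E1 ?E2 ?E3 ?E4.
Qed.

End slot.

(** * Calibration of tau *)

Section cdf.
Variables (R : realType) (d : nat).
Implicit Types (tau p : R).

Lemma linf_dist_le tau x (i j : nat) : 0 <= tau ->
  ((linf_dist d x i j <= tau)%R : bool) =
  [forall k : 'I_d, ((circ_dist (x (i * d + k)%N) (x (j * d + k)%N) <= tau)%R : bool)].
Proof.
move=> t0; apply/bigmax_leP/forallP => [[_ h] k|h]; first exact: h.
by split=> // k _; exact: h.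
Qed.

Lemma linf_cdfE tau : 0 <= tau <= 1 -> linf_cdf d tau = tau ^+ d.
Proof.
move=> t01; have t0 : 0 <= tau by case/andP: t01.
rewrite /linf_cdf.
rewrite (_ : (fun x => _) = fun x => \prod_(k : 'I_d) (1 + (-1) * (far tau k (d + k) x * 1))).
  rewrite (@unif_expect_prod _ _ _ _ _ (fun k : 'I_d => [set i : nat | i = k \/ i = (d + k)%N])).
  - rewrite -[in RHS](card_ord d) -prodr_const; apply: eq_bigr => k _.
    have bf : bmeas (fun x => far tau k (d + k) x * 1).
      by apply: bmeasM; [exact: bmeas_far|exact: bmeas_cst].
    rewrite unif_expectD; [|exact: bmeas_cst|exact: bmeasZ].
    rewrite unif_expectZ// unif_expect_cst (@unif_expect_far _ _ _ _ _ set0)//.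
    + by rewrite unif_expect_cst; ring.
    + by have := ltn_ord k; lia.
    + by have := ltn_ord k; lia.
    + exact: bmeas_cst.
  - by rewrite /index_enum; case: index_enum_key => /=; rewrite -enumT enum_uniq.
  - move=> k; apply: bmeasD; [exact: bmeas_cst|apply/bmeasZ/bmeasM].
      exact: bmeas_far.
    exact: bmeas_cst.
  - by move=> k v w vw; rewrite (@depends_on_far _ _ _ _ v w).
  - move=> i j ij; apply/seteqP; split=> // l [] [->|->] []; move: ij (ltn_ord i) (ltn_ord j);
    rewrite -val_eqE/=; lia.
apply/funext => x; rewrite linf_dist_le// natr_forall; apply: eq_bigr => k _.
by rewrite mul0n mul1n add0n mulr1 /far; case: leP; rewrite mulN1r ?subrr ?subr0.
Qed.

(** The equation for tau does not mention a range. Outside [0, 1] the distribution function is 0 or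
    1, which 0 < p < 1 excludes. *)
Lemma linf_cdf_inv tau p : (0 < d)%N -> 0 < p < 1 -> linf_cdf d tau = p ->
  0 <= tau <= 1 /\ tau ^+ d = p.
Proof.
move=> d0 p01 cdf.
have t0 : 0 <= tau.
  rewrite leNgt; apply/negP => tn; move: p01; rewrite -cdf /linf_cdf.
  rewrite (_ : (fun x => _) = fun=> 0) ?unif_expect_cst ?ltxx//.
  apply/funext => x; rewrite (_ : _ <= _ = false)//; apply/negbTE; rewrite -ltNge.
  by apply: lt_le_trans tn _; exact: bigmax_ge_id.
have t1 : tau <= 1.
  rewrite leNgt; apply/negP => tn; move: p01; rewrite -cdf /linf_cdf.
  rewrite (_ : (fun x => _) = fun=> 1) ?unif_expect_cst ?ltxx ?andbF//.
  apply/funext => x; rewrite linf_dist_le// (_ : [forall k, _])//; apply/forallP => k.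
  by rewrite /circ_dist ge_min; case: (lerP `|_| tau) => //= h; lra.
have t01 : 0 <= tau <= 1 by rewrite t0.
by split=> //; rewrite -linf_cdfE.
Qed.

End cdf.

(** * Expectations over the geometric graph *)

Section rgg.
Variables (R : realType) (n d : nat) (tau : R).
Implicit Types (F G : {set {set 'I_n}} -> R) (S T : {set {set 'I_n}}) (e : {set 'I_n}).
Hypothesis tau01 : 0 <= tau <= 1.

Lemma in_rgg_graph e x : e \in pairs n -> (e \in rgg_graph n d tau x)%:R =
  \prod_(k < d) (1 - (bad_edge d tau k e x)%:R) :> R.
Proof.
have t0 : 0 <= tau by case/andP: tau01.
move=> ep; rewrite inE ep/=.
transitivity (\prod_(k < d) (~~ bad_edge d tau k e x)%:R : R); last first.
  by apply: eq_bigr => k _; case: bad_edge; rewrite ?subrr ?subr0.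
rewrite -natr_forall; congr ((nat_of_bool _)%:R); apply/idP/idP.
  move=> h; apply/forallP => k; rewrite negbK; apply/forallP => i; apply/implyP => ie.
  apply/forallP => j; apply/implyP => je.
  move: h => /forallP/(_ i)/implyP/(_ ie)/forallP/(_ j)/implyP/(_ je).
  by rewrite linf_dist_le// => /orP[->//|/forallP/(_ k) ->]; rewrite orbT.
move=> h; apply/forallP => i; apply/implyP => ie; apply/forallP => j; apply/implyP => je.
rewrite linf_dist_le//; have [//|ij] /= := boolP (i == j); apply/forallP => k.
move: h => /forallP/(_ k); rewrite negbK.
move=> /forallP/(_ i)/implyP/(_ ie)/forallP/(_ j)/implyP/(_ je).
by rewrite (negbTE ij).
Qed.

Lemma bmeas_in_rgg e : bmeas (fun x => (e \in rgg_graph n d tau x)%:R : R).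
Proof.
have [ep|ep] := boolP (e \in pairs n); last first.
  rewrite (_ : (fun x => _) = fun=> 0); first exact: bmeas_cst.
  by apply/funext => x; rewrite inE (negbTE ep).
rewrite (_ : (fun x => _) = fun x => \prod_(k < d) (1 + (-1) * (bad_edge d tau k e x)%:R)).
  apply: bmeas_prod => k _; apply: bmeasD; [exact: bmeas_cst|].
  by apply: bmeasZ; exact: bmeas_bad.
by apply/funext => x; rewrite in_rgg_graph//; apply: eq_bigr => k _; rewrite mulN1r.
Qed.

Lemma bmeas_rgg F : bmeas (fun x => F (rgg_graph n d tau x)).
Proof.
(* The graph takes finitely many values h; the product over e is the indicator that the graph equals
   h. *)
rewrite (_ : (fun x => _) = fun x => \sum_(h : {set {set 'I_n}}) F h *
  \prod_e (if e \in h then (e \in rgg_graph n d tau x)%:R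
           else 1 + (-1) * (e \in rgg_graph n d tau x)%:R)).
  apply: bmeas_sum => h _; apply: bmeasZ; apply: bmeas_prod => e _.
  case: (e \in h); first exact: bmeas_in_rgg.
  by apply: bmeasD; [exact: bmeas_cst|apply: bmeasZ; exact: bmeas_in_rgg].
apply/funext => x; rewrite (bigD1 (rgg_graph n d tau x))//= big1 ?mulr1 => [|e _]; last first.
  by case: (e \in _); rewrite // mulr0 addr0.
rewrite big1 ?addr0// => h hx.
have [e he] : exists e, (e \in h) != (e \in rgg_graph n d tau x).
  apply/existsP; rewrite -negb_forall; apply: contra hx => /forallP hx.
  by apply/eqP/finset.setP => e; exact/eqP.
rewrite (bigD1 e)//=; move: he; case: (e \in h); case: (e \in rgg_graph _ _ _ _) => //= _.
  by rewrite mul0r mulr0.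
by rewrite mulr1 subrr mul0r mulr0.
Qed.

Lemma RGG_expectD F G :
  RGG_expect d tau (fun g => F g + G g) = RGG_expect d tau F + RGG_expect d tau G.
Proof. by apply: unif_expectD; exact: bmeas_rgg. Qed.

Lemma RGG_expectZ c F : RGG_expect d tau (fun g => c * F g) = c * RGG_expect d tau F.
Proof. by apply: unif_expectZ; exact: bmeas_rgg. Qed.

Lemma RGG_expect_sum (I : Type) (r : seq I) (P : pred I) (F : I -> {set {set 'I_n}} -> R) :
  RGG_expect d tau (fun g => \sum_(i <- r | P i) F i g) =
  \sum_(i <- r | P i) RGG_expect d tau (F i).
Proof. by apply: unif_expect_sum => i _; exact: bmeas_rgg. Qed.

Lemma RGG_var_ge0 F : 0 <= RGG_var d tau F.
Proof.
rewrite /RGG_var; set m := RGG_expect d tau F.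
have : 0 <= RGG_expect d tau (fun g => (F g - m) ^+ 2).
  by apply: unif_expect_ge0 => x _; exact: sqr_ge0.
rewrite (_ : (fun g => _) = fun g => F g ^+ 2 + ((- (2 * m)) * F g + m ^+ 2 * 1)); last first.
  by apply/funext => g; ring.
rewrite !RGG_expectD !RGG_expectZ -/m (_ : RGG_expect _ _ (fun=> 1) = 1); last first.
  exact: unif_expect_cst.
lra.
Qed.

(** All edges of S are present iff they are good in every slot, and slots are independent because
    their coordinates differ modulo d. *)
Lemma RGG_expect_edges S : (0 < d)%N -> S \subset pairs n ->
  RGG_expect d tau (fun g => \prod_(e in S) (e \in g)%:R) = \prod_(k < d) good_expect d tau k S.
Proof.
move=> d0 Sp; rewrite /RGG_expect /good_expect.
rewrite (_ : (fun x => _) = fun x => \prod_(k < d) \prod_(e in S) (1 - (bad_edge d tau k e x)%:R)).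
  apply: (@unif_expect_prod _ _ _ _ _ (fun k : 'I_d => [set l | exists i, l = (i * d + k)%N])).
  - by rewrite /index_enum; case: index_enum_key => /=; rewrite -enumT enum_uniq.
  - by move=> k; exact: bmeas_prod_good.
  - move=> k v w vw; apply: eq_bigr => e _; congr (1 - _).
    by apply: depends_on_bad => l [i _ ->]; apply: vw; exists i.
  - move=> k k' kk'; apply/seteqP; split=> // l [[i ->] [j ijk]].
    move: kk'; apply/negP; rewrite negbK -val_eqE/=.
    have := congr1 (modn^~ d) ijk; rewrite /= !modnMDl !modn_small// => ->.
    exact: eqxx.
apply/funext => x; rewrite exchange_big/=; apply: eq_bigr => e eS.
by rewrite in_rgg_graph//; exact: (fintype.subsetP Sp).
Qed.

End rgg.

Lemma pairs_other n (e : {set 'I_n}) z : e \in pairs n -> z \in e ->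
  exists2 w, z != w & e = [set z; w]%SET.
Proof.
rewrite inE => /cards2P[a [b [ab ->]]]; rewrite !inE => /orP[]/eqP->; first by exists b.
by exists a; rewrite ?(eq_sym b)// finset.setUC.
Qed.

Lemma pairs_diff n (e f : {set 'I_n}) : e \in pairs n -> f \in pairs n -> e != f ->
  exists2 z, z \in e & z \notin f.
Proof.
rewrite !inE => /eqP e2 /eqP f2 ef; apply/subsetPn; apply: contra ef => ef.
by rewrite finset.eqEcard ef e2 f2.
Qed.

Lemma cover_setU (I : finType) (S T : {set {set I}}) :
  (cover (S :|: T) = cover S :|: cover T)%SET.
Proof. by rewrite /cover finset.bigcup_setU. Qed.

Lemma cover_set1 (I : finType) (e : {set I}) : cover [set e]%SET = e.
Proof. by rewrite /cover big_set1. Qed.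

Lemma cover_setS (I : finType) (S T : {set {set I}}) : S \subset T -> cover S \subset cover T.
Proof.
move=> ST; apply/bigcupsP => e eS; apply: finset.bigcup_sup; exact: (fintype.subsetP ST).
Qed.

Lemma ler_dist_itv (R : realDomainType) (x y z : R) :
  0 <= x -> x <= z -> 0 <= y -> y <= z -> `|x - y| <= z.
Proof. by move=> *; rewrite ler_norml; lra. Qed.

(** * Estimates of bad probabilities *)

Section bad_bounds.
Variables (R : realType) (n d : nat) (tau : R).
Hypothesis d0 : (0 < d)%N.
Hypothesis tau34 : 3%:R / 4%:R <= tau <= 1.
Implicit Types (k : nat) (e f g : {set 'I_n}) (S T H : {set {set 'I_n}}).

Local Notation l := (1 - tau).
Local Notation Psi := (bad_expect d tau).
Local Notation Phi := (good_expect d tau).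

Let tau01 : 0 <= tau <= 1. Proof. by move: tau34; lra. Qed.
Let l0 : 0 <= l. Proof. by move: tau34; lra. Qed.
Let l1 : l <= 1. Proof. by move: tau34; lra. Qed.

Lemma bad_expect1 k e : (k < d)%N -> e \in pairs n -> Psi k [set e]%SET = l.
Proof.
move=> kd ep; have := ep; rewrite inE => /cards2P[a [b [ab E]]].
have ae : a \in e by rewrite E !inE eqxx.
have := @bad_expect_leaf R n d tau d0 tau01 k e a finset.set0 kd ep ae.
by rewrite finset.setU0 bad_expect0 mulr1; apply; rewrite /cover big_set0 inE.
Qed.

Lemma bad_expect2 k e f : (k < d)%N -> e \in pairs n -> f \in pairs n -> e != f ->
  Psi k [set e; f]%SET = l ^+ 2.
Proof.
move=> kd ep fp ef; have [z ze zf] := pairs_diff ep fp ef.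
by rewrite (bad_expect_leaf d0 tau01 kd ep ze) ?cover_set1// bad_expect1.
Qed.

(* Three distinct edges either have a vertex of degree one or form a triangle. *)
Lemma bad_expect3 k e f g : (k < d)%N -> e \in pairs n -> f \in pairs n -> g \in pairs n ->
  e != f -> e != g -> f != g -> Psi k [set e; f; g]%SET <= l ^+ 3.
Proof.
move=> kd.
have leaf e1 f1 g1 z : e1 \in pairs n -> f1 \in pairs n -> g1 \in pairs n -> f1 != g1 ->
    z \in e1 -> z \notin f1 -> z \notin g1 -> Psi k [set e1; f1; g1]%SET <= l ^+ 3.
  move=> ep fp gp fg ze zf zg; rewrite -finset.setUA.
  rewrite (bad_expect_leaf d0 tau01 kd ep ze).
    by rewrite bad_expect2// -exprS.
  by rewrite cover_setU !cover_set1 inE negb_or zf.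
have r2 e1 f1 g1 : [set e1; f1; g1]%SET = [set g1; e1; f1]%SET.
  by rewrite finset.setUC finset.setUA.
move=> ep fp gp ef eg fg; have [z ze zf] := pairs_diff ep fp ef.
have [zg|zg] := boolP (z \in g); last exact: (leaf _ _ _ z).
(* Here e and g meet in z. Their other ends w and u are either leaves or both in f, and in the
   latter case f closes a triangle. *)
have [w zw E] := pairs_other ep ze; have [u zu G] := pairs_other gp zg.
have uw : u != w by apply: contraNneq eg => uw; rewrite E G uw.
have ue : u \notin e by rewrite E !inE negb_or eq_sym zu.
have [uf|uf] := boolP (u \in f); last first.
  by rewrite r2; apply: (leaf _ _ _ u) => //; rewrite G !inE eqxx orbT.
have wg : w \notin g by rewrite G !inE negb_or eq_sym zw eq_sym.
have [wf|wf] := boolP (w \in f); last first.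
  by apply: (leaf _ _ _ w) => //; rewrite E !inE eqxx orbT.
have [y wy F] := pairs_other fp wf.
have Fu : f = [set w; u]%SET.
  by move: uf; rewrite F !inE (negbTE uw)/= => /eqP ->.
rewrite (@bad_expect_triangle R n d tau k _ z w u); first exact: exprn_ge0.
- by move: tau34; lra.
- by rewrite /= !inE negb_or zw zu eq_sym uw.
- by rewrite -E !inE eqxx.
- by rewrite -Fu !inE eqxx orbT.
- by rewrite finset.setUC -G !inE eqxx orbT.
Qed.

(** Up to two edges the value is exact; from three edges on, both numbers lie between 0 and l^3. *)
Lemma bad_expect_approx k T : (k < d)%N -> T \subset pairs n ->
  `|Psi k T - l ^+ #|T| | <= l ^+ 3.
Proof.
move=> kd Tp; have l30 : 0 <= l ^+ 3 by exact: exprn_ge0.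
have [T3|T3] := leqP 3 #|T|.
  have [e eT] : exists e, e \in T by apply/card_gt0P; exact: leq_trans T3.
  have T2 : (1 < #|(T :\ e)%SET|)%N by move: T3; rewrite (cardsD1 e T) eT.
  have [f fTe] : exists f, f \in (T :\ e)%SET.
    by apply/finset.set0Pn; rewrite -finset.card_gt0; exact: leq_trans T2.
  have [g] : exists g, g \in (T :\ e :\ f)%SET.
    apply/finset.set0Pn; rewrite -finset.card_gt0.
    by move: T2; rewrite (cardsD1 f (T :\ e)%SET) fTe.
  move: fTe; rewrite !inE => /andP[fe fT].
  move=> /and3P[gf ge gT].
  have h : Psi k T <= l ^+ 3.
    apply: le_trans (@bad_expect3 k e f g kd _ _ _ _ _ _).
    - apply: bad_expect_anti; apply/fintype.subsetP => x.
      by rewrite !inE -orbA => /or3P[]/eqP->.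
    - exact: (fintype.subsetP Tp).
    - exact: (fintype.subsetP Tp).
    - exact: (fintype.subsetP Tp).
    - by rewrite eq_sym.
    - by rewrite eq_sym.
    - by rewrite eq_sym.
  have h2 : l ^+ #|T| <= l ^+ 3 by apply: ler_wiXn2l.
  apply: ler_dist_itv => //; [exact: bad_expect_ge0|exact: exprn_ge0].
suff -> : Psi k T = l ^+ #|T| by rewrite subrr normr0.
have [T0|T0] := eqVneq #|T| 0%N.
  by rewrite T0 (finset.cards0_eq T0) bad_expect0 expr0.
have [/eqP|T1] := eqVneq #|T| 1%N.
  by move=> /cards1P[e E]; rewrite E cards1 expr1 bad_expect1// (fintype.subsetP Tp)// E inE eqxx.
have /eqP/cards2P[e [f [ef E]]] : #|T| = 2%N by lia.
by rewrite E cards2 ef bad_expect2// (fintype.subsetP Tp)// E !inE eqxx ?orbT.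
Qed.

Lemma sum_subset_exp (x : R) S :
  \sum_(T : {set {set 'I_n}} | T \subset S) (-1) ^+ #|T| * x ^+ #|T| = (1 - x) ^+ #|S|.
Proof.
rewrite -prodr_const; under [RHS]eq_bigr do rewrite addrC.
rewrite prodrD_subset; apply: eq_bigr => T _.
by rewrite prodr_const big1_eq mulr1 -exprMn mulN1r.
Qed.

(** Inclusion-exclusion on both sides: 2^#|S| terms, each off by at most l^3. *)
Lemma good_expect_approx k S : (k < d)%N -> S \subset pairs n ->
  `|Phi k S - tau ^+ #|S| | <= 2 ^+ #|S| * l ^+ 3.
Proof.
move=> kd Sp; rewrite good_expectE.
have -> : tau ^+ #|S| = (1 - l) ^+ #|S| by congr (_ ^+ _); ring.
rewrite -sum_subset_exp -sumrB (le_trans (ler_norm_sum _ _ _))//.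
rewrite -natrX -card_powerset mulr_natl -sumr_const.
rewrite [leRHS](eq_bigl (fun T => T \subset S)) => [|T]; last by rewrite powersetE.
apply: ler_sum => T TS; rewrite -mulrBr normrM normrX normrN1 expr1n mul1r.
by apply: bad_expect_approx => //; exact: fintype.subset_trans Sp.
Qed.

(** H minus any edge behaves as a forest, even beside a set S that touches H in at most one vertex.
    The presence of S is what the covariance estimates need. *)
Definition treelike k H := forall S T, T \subset H -> T != H ->
  (#|(cover H :&: cover S)%SET| <= 1)%N ->
  Psi k (T :|: S)%SET = l ^+ #|T| * Psi k S.

(* An order of removal in which each edge comes up with a leaf outside [A]. *)
Fixpoint peelable (A : {set 'I_n}) (L : seq ('I_n * {set 'I_n})) : bool :=
  if L is (z, e) :: L' then
    [&& e \in pairs n, z \in e, z \notin A,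
        all (fun q : 'I_n * {set 'I_n} => z \notin q.2) L' & peelable A L']
  else true.

(** The edges of T come off in the order of L by [bad_expect_leaf]; entries outside T are skipped,
    so a single order serves all subsets. *)
Lemma bad_expect_peel k S L T : (k < d)%N -> peelable (cover S) L ->
  T \subset [set:: map snd L]%SET -> Psi k (T :|: S)%SET = l ^+ #|T| * Psi k S.
Proof.
move=> kd; elim: L T => [|[z e] L IH] T /=.
  move=> _; rewrite finset.set_nil finset.subset0 => /eqP ->.
  by rewrite finset.set0U finset.cards0 mul1r.
move=> /and5P[ep ze zS zL pL]; rewrite finset.set_cons => TL.
have TL' : (T :\ e)%SET \subset [set:: map snd L]%SET.
  apply/fintype.subsetP => x; rewrite !inE => /andP[xe xT].
  by have := fintype.subsetP TL _ xT; rewrite !inE (negbTE xe).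
have [eT|eT] := boolP (e \in T); last first.
  rewrite (_ : T = (T :\ e)%SET) ?IH//.
  by apply/finset.setP => x; rewrite !inE; have [->|] := eqVneq x e; rewrite ?(negbTE eT).
rewrite -{1}(finset.setD1K eT) -finset.setUA (bad_expect_leaf d0 tau01 kd ep ze).
  by rewrite IH// (cardsD1 e T) eT mulrA -exprS.
rewrite cover_setU inE negb_or zS andbT; apply/bigcupP => -[f fT zf].
have := fintype.subsetP TL' _ fT; rewrite inE => /mapP[q qL fq].
by have /allP/(_ _ qL) := zL; rewrite -fq zf.
Qed.

End bad_bounds.

(** * Copies of the triangle and of the 4-cycle *)

Definition cycle3 n (a b c : 'I_n) := [set [set a; b]; [set b; c]; [set c; a]]%SET.
Definition cycle4 n (a b c e : 'I_n) :=
  [set [set a; b]; [set b; c]; [set c; e]; [set e; a]]%SET.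

Lemma iso_copyE m n (H1 : {set {set 'I_n}}) : iso_copy (cycle_graph m) H1 <->
  exists2 f : 'I_m -> 'I_n, injective f & H1 = [set [set f i; f (ordS i)] | i : 'I_m]%SET.
Proof.
have E (f : 'I_m -> 'I_n) : [set f @: e | e : {set 'I_m} in cycle_graph m]%SET =
    [set [set f i; f (ordS i)] | i : 'I_m]%SET.
  rewrite -imset_comp; apply: eq_imset => i /=.
  by rewrite finset.imsetU !finset.imset_set1.
by split=> [[f [fi ->]]|[f fi ->]]; [exists f; rewrite ?E|exists f; rewrite -?E].
Qed.

Lemma iso_copy3 n (H : {set {set 'I_n}}) : iso_copy (cycle_graph 3) H <->
  exists a b c, uniq [:: a; b; c] /\ H = cycle3 a b c.
Proof.
pose o0 : 'I_3 := @Ordinal 3 0 isT; pose o1 : 'I_3 := @Ordinal 3 1 isT.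
pose o2 : 'I_3 := @Ordinal 3 2 isT.
have E (f : 'I_3 -> 'I_n) : [set [set f i; f (ordS i)] | i : 'I_3]%SET =
    cycle3 (f o0) (f o1) (f o2).
  have s0 : ordS o0 = o1 by exact/val_inj.
  have s1 : ordS o1 = o2 by exact/val_inj.
  have s2 : ordS o2 = o0 by exact/val_inj.
  apply/finset.setP => x; rewrite !inE; apply/imsetP/idP => [[i _ ->]|].
    have : [|| i == o0, i == o1 | i == o2] by case: i => -[|[|[|]]].
    by move=> /or3P[]/eqP->; rewrite ?s0 ?s1 ?s2 eqxx ?orbT.
  by rewrite -orbA => /or3P[]/eqP->; [exists o0|exists o1|exists o2]; rewrite ?s0 ?s1 ?s2.
split.
  move=> /iso_copyE[f fi ->]; exists (f o0), (f o1), (f o2); split; last exact: E.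
  by rewrite /= !inE !(inj_eq fi).
move=> [a [b [c [u ->]]]]; apply/iso_copyE; exists (fun i : 'I_3 => nth a [:: a; b; c] i).
  by move=> i j /eqP; rewrite nth_uniq// => /eqP/val_inj.
by rewrite E.
Qed.

Lemma iso_copy4 n (H : {set {set 'I_n}}) : iso_copy (cycle_graph 4) H <->
  exists a b c e, uniq [:: a; b; c; e] /\ H = cycle4 a b c e.
Proof.
pose o0 : 'I_4 := @Ordinal 4 0 isT; pose o1 : 'I_4 := @Ordinal 4 1 isT.
pose o2 : 'I_4 := @Ordinal 4 2 isT; pose o3 : 'I_4 := @Ordinal 4 3 isT.
have E (f : 'I_4 -> 'I_n) : [set [set f i; f (ordS i)] | i : 'I_4]%SET =
    cycle4 (f o0) (f o1) (f o2) (f o3).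
  have s0 : ordS o0 = o1 by exact/val_inj.
  have s1 : ordS o1 = o2 by exact/val_inj.
  have s2 : ordS o2 = o3 by exact/val_inj.
  have s3 : ordS o3 = o0 by exact/val_inj.
  apply/finset.setP => x; rewrite !inE; apply/imsetP/idP => [[i _ ->]|].
    have : [|| i == o0, i == o1, i == o2 | i == o3] by case: i => -[|[|[|[|]]]].
    by move=> /or4P[]/eqP->; rewrite ?s0 ?s1 ?s2 ?s3 eqxx ?orbT.
  by rewrite -!orbA => /or4P[]/eqP->; [exists o0|exists o1|exists o2|exists o3];
    rewrite ?s0 ?s1 ?s2 ?s3.
split.
  move=> /iso_copyE[f fi ->]; exists (f o0), (f o1), (f o2), (f o3); split; last exact: E.
  by rewrite /= !inE !(inj_eq fi).
move=> [a [b [c [e [u ->]]]]]; apply/iso_copyE; exists (fun i : 'I_4 => nth a [:: a; b; c; e] i).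
  by move=> i j /eqP; rewrite nth_uniq// => /eqP/val_inj.
by rewrite E.
Qed.

Lemma cycle3_rot n (a b c : 'I_n) : cycle3 a b c = cycle3 b c a.
Proof. by rewrite /cycle3 -finset.setUA finset.setUC. Qed.

Lemma cycle4_rot n (a b c e : 'I_n) : cycle4 a b c e = cycle4 b c e a.
Proof. by rewrite /cycle4 -!finset.setUA finset.setUC !finset.setUA. Qed.

Lemma cover_cycle3 n (a b c : 'I_n) : cover (cycle3 a b c) = [set a; b; c]%SET.
Proof.
apply/finset.setP => x; rewrite /cycle3 !cover_setU !cover_set1 !inE.
by case: (x == a); case: (x == b); case: (x == c).
Qed.

Lemma cover_cycle4 n (a b c e : 'I_n) : cover (cycle4 a b c e) = [set a; b; c; e]%SET.
Proof.
apply/finset.setP => x; rewrite /cycle4 !cover_setU !cover_set1 !inE.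
by case: (x == a); case: (x == b); case: (x == c); case: (x == e).
Qed.

Lemma set2_neq n (a b x y : 'I_n) : a != x -> a != y -> [set a; b]%SET != [set x; y]%SET.
Proof.
move=> ax ay; apply/eqP => /finset.setP/(_ a).
by rewrite !inE eqxx (negbTE ax) (negbTE ay).
Qed.

Lemma card_le1_notin (I : finType) (V A : {set I}) x y : (#|(V :&: A)%SET| <= 1)%N ->
  x \in V -> y \in V -> x != y -> x \in A -> y \notin A.
Proof.
move=> VA xV yV xy xA; apply/negP => yA; move: VA; rewrite leqNgt => /negP; apply.
have : [set x; y]%SET \subset (V :&: A)%SET.
  by apply/fintype.subsetP => z; rewrite !inE => /orP[]/eqP->; rewrite ?xV ?yV ?xA ?yA.
by move=> /subset_leq_card; rewrite cards2 xy.
Qed.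

Lemma subset_neq_missing (I : finType) (T H : {set I}) : T \subset H -> T != H ->
  exists2 f, f \in H & f \notin T.
Proof.
move=> TH nTH; apply/subsetPn; apply: contra nTH => HT.
by rewrite finset.eqEsubset TH.
Qed.

(** * What the two cycles have in common *)

Section cycles.
Variables (R : realType) (n d : nat) (tau : R).
Hypothesis d0 : (0 < d)%N.
Hypothesis tau34 : 3%:R / 4%:R <= tau <= 1.
Implicit Types (j k : nat) (S T H : {set {set 'I_n}}).
Local Notation l := (1 - tau).
Local Notation Psi := (bad_expect d tau).

(** All that the moment estimates use about the cycles. The sign is that of the full edge set in
    inclusion-exclusion: a triangle is bad less often than l^3, a 4-cycle more often than l^4, and
    both raise the probability that all edges are good. *)
Definition cycle_like k H := [/\ H \subset pairs n, #|H| = k, #|cover H| = k,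
  forall j, (j < d)%N -> treelike d tau j H &
  forall j, (j < d)%N -> l ^+ 3 / 4 <= (-1) ^+ k * (Psi j H - l ^+ k)].

Let neqs3 (a b c : 'I_n) : uniq [:: a; b; c] ->
  [/\ a != b, b != a, a != c & [/\ c != a, b != c & c != b]].
Proof.
rewrite /= !inE negb_or => /and3P[/andP[ab ac] bc _].
by rewrite ab ac bc ![_ == a]eq_sym ab ac eq_sym bc.
Qed.

(** Rotate so that S can touch the triangle only in a. Once an edge f is missing, the others form a
    forest that can be peeled from its ends towards a. *)
Let treelike_cycle3 j (a b c : 'I_n) : (j < d)%N -> uniq [:: a; b; c] ->
  treelike d tau j (cycle3 a b c).
Proof.
move=> jd u S T TH nTH VA.
wlog [bA cA] : a b c u TH nTH VA / b \notin cover S /\ c \notin cover S.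
  move=> wh; have [ab ba ac [ca bc cb]] := neqs3 u.
  have Va : a \in cover (cycle3 a b c) by rewrite cover_cycle3 !inE eqxx.
  have Vb : b \in cover (cycle3 a b c) by rewrite cover_cycle3 !inE eqxx orbT.
  have Vc : c \in cover (cycle3 a b c) by rewrite cover_cycle3 !inE eqxx !orbT.
  have out x y := @card_le1_notin _ _ _ x y VA.
  have [aA|aA] := boolP (a \in cover S).
    by apply: (wh a b c) => //; split; apply: (out a).
  have [bA|bA] := boolP (b \in cover S); last first.
    have [cA|cA] := boolP (c \in cover S); last exact: (wh a b c).
    apply: (wh c a b); rewrite ?(cycle3_rot c)//.
    by rewrite /= !inE negb_or ca cb ab.
  apply: (wh b c a); rewrite -?(cycle3_rot a)//.
    by rewrite /= !inE negb_or bc ba ca.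
  by split=> //; apply: (out b).
have [ab ba ac [ca bc cb]] := neqs3 u.
have pp x y : x != y -> [set x; y]%SET \in pairs n by move=> xy; rewrite inE cards2 xy.
have [f fH fT] := subset_neq_missing TH nTH.
have TL L : (forall x, x \in cycle3 a b c -> x != f -> x \in [seq q.2 | q <- L]) ->
    peelable (cover S) L -> Psi j (T :|: S)%SET = l ^+ #|T| * Psi j S.
  move=> hL pL; apply: (bad_expect_peel d0 tau34 jd pL).
  apply/fintype.subsetP => x xT; rewrite inE; apply: hL.
    exact: (fintype.subsetP TH).
  by apply: contraNneq fT => <-.
have hx x : x \in cycle3 a b c -> [|| x == [set a; b], x == [set b; c] | x == [set c; a]]%SET.
  by rewrite !inE -orbA.
move: fH => /hx/or3P[]/eqP Ef; subst f.
- apply: (TL [:: (b, [set b; c]%SET); (c, [set c; a]%SET)]).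
    by move=> x /hx/or3P[]/eqP->; rewrite /= ?inE ?eqxx ?orbT.
  by rewrite /= !pp// !inE !eqxx ?orbT ?negb_or ?bA ?cA ?bc ?ba.
- apply: (TL [:: (b, [set a; b]%SET); (c, [set c; a]%SET)]).
    by move=> x /hx/or3P[]/eqP->; rewrite /= ?inE ?eqxx ?orbT.
  by rewrite /= !pp// !inE !eqxx ?orbT ?negb_or ?bA ?cA ?bc ?ba.
- apply: (TL [:: (c, [set b; c]%SET); (b, [set a; b]%SET)]).
    by move=> x /hx/or3P[]/eqP->; rewrite /= ?inE ?eqxx ?orbT.
  by rewrite /= !pp// !inE !eqxx ?orbT ?negb_or ?bA ?cA ?ca ?cb.
Qed.

Lemma cycle_like3 H : iso_copy (cycle_graph 3) H -> cycle_like 3 H.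
Proof.
move=> /iso_copy3[a [b [c [u ->]]]]; have [ab ba ac [ca bc cb]] := neqs3 u.
split.
- by apply/fintype.subsetP => x; rewrite !inE -orbA => /or3P[]/eqP->; rewrite cards2 ?ab ?bc ?ca.
- have e1 : [set c; a]%SET != [set b; c]%SET by rewrite (finset.setUC [set c]%SET) set2_neq.
  rewrite /cycle3 finset.setUC cardsU1 cards2 !inE negb_or e1.
  by rewrite (set2_neq a ca cb) (set2_neq b ab ac).
- by rewrite cover_cycle3 finset.setUC cardsU1 cards2 !inE negb_or ca cb ab.
- by move=> j jd; exact: treelike_cycle3.
- move=> j jd; rewrite (@bad_expect_triangle R n d tau j _ a b c)//.
  + have : 0 <= l ^+ 3 by apply: exprn_ge0; move: tau34; lra.
    by rewrite !exprS; lra.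
  + by move: tau34; lra.
  + by rewrite !inE eqxx.
  + by rewrite !inE eqxx orbT.
  + by rewrite !inE eqxx !orbT.
Qed.

Let neqs4 (a b c e : 'I_n) : uniq [:: a; b; c; e] ->
  [/\ [/\ a != b, b != a, a != c & c != a], [/\ a != e, e != a, b != c & c != b] &
      [/\ b != e, e != b, c != e & e != c]].
Proof.
rewrite /= !inE !negb_or => /and4P[/and3P[ab ac ae] /andP[bc be] ce _].
by rewrite ab ac ae bc be ce ![_ == a]eq_sym ab ac ae ![_ == b]eq_sym bc be eq_sym ce.
Qed.

(** Same rotation as for the triangle; one peeling order is given for each possible missing edge. *)
Let treelike_cycle4 j (a b c e : 'I_n) : (j < d)%N -> uniq [:: a; b; c; e] ->
  treelike d tau j (cycle4 a b c e).
Proof.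
move=> jd u S T TH nTH VA.
wlog [bA cA eA] : a b c e u TH nTH VA /
    [/\ b \notin cover S, c \notin cover S & e \notin cover S].
  move=> wh; have [[ab ba ac ca] [ae ea bc cb] [be eb ce ec]] := neqs4 u.
  have Va : a \in cover (cycle4 a b c e) by rewrite cover_cycle4 !inE eqxx.
  have Vb : b \in cover (cycle4 a b c e) by rewrite cover_cycle4 !inE eqxx !orbT.
  have Vc : c \in cover (cycle4 a b c e) by rewrite cover_cycle4 !inE eqxx !orbT.
  have Ve : e \in cover (cycle4 a b c e) by rewrite cover_cycle4 !inE eqxx !orbT.
  have out x y := @card_le1_notin _ _ _ x y VA.
  have [bA|bA] := boolP (b \in cover S).
    apply: (wh b c e a); rewrite -?(cycle4_rot a)//.
      by rewrite /= !inE !negb_or bc be ba ce ca ea.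
    by split; apply: (out b).
  have [cA|cA] := boolP (c \in cover S).
    apply: (wh c e a b); rewrite ?(cycle4_rot c) ?(cycle4_rot e)//.
      by rewrite /= !inE !negb_or ce ca cb ea eb ab.
    by split; apply: (out c).
  have [eA|eA] := boolP (e \in cover S); last exact: (wh a b c e).
  apply: (wh e a b c); rewrite ?(cycle4_rot e)//.
    by rewrite /= !inE !negb_or ea eb ec ab ac bc.
  by split; apply: (out e).
have [[ab ba ac ca] [ae ea bc cb] [be eb ce ec]] := neqs4 u.
have pp x y : x != y -> [set x; y]%SET \in pairs n by move=> xy; rewrite inE cards2 xy.
have [f fH fT] := subset_neq_missing TH nTH.
have TL L : (forall x, x \in cycle4 a b c e -> x != f -> x \in [seq q.2 | q <- L]) ->
    peelable (cover S) L -> Psi j (T :|: S)%SET = l ^+ #|T| * Psi j S.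
  move=> hL pL; apply: (bad_expect_peel d0 tau34 jd pL).
  apply/fintype.subsetP => x xT; rewrite inE; apply: hL.
    exact: (fintype.subsetP TH).
  by apply: contraNneq fT => <-.
have hx x : x \in cycle4 a b c e ->
    [|| x == [set a; b], x == [set b; c], x == [set c; e] | x == [set e; a]]%SET.
  by rewrite !inE -!orbA.
move: fH => /hx/or4P[]/eqP Ef; subst f.
- apply: (TL [:: (b, [set b; c]%SET); (c, [set c; e]%SET); (e, [set e; a]%SET)]).
    by move=> x /hx/or4P[]/eqP->; rewrite /= ?inE ?eqxx ?orbT.
  by rewrite /= !pp// !inE !eqxx ?orbT ?negb_or ?bA ?cA ?eA ?bc ?be ?ba ?ce ?ca ?ea.
- apply: (TL [:: (b, [set a; b]%SET); (c, [set c; e]%SET); (e, [set e; a]%SET)]).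
    by move=> x /hx/or4P[]/eqP->; rewrite /= ?inE ?eqxx ?orbT.
  by rewrite /= !pp// !inE !eqxx ?orbT ?negb_or ?bA ?cA ?eA ?bc ?be ?ba ?ce ?ca ?ea.
- apply: (TL [:: (c, [set b; c]%SET); (b, [set a; b]%SET); (e, [set e; a]%SET)]).
    by move=> x /hx/or4P[]/eqP->; rewrite /= ?inE ?eqxx ?orbT.
  by rewrite /= !pp// !inE !eqxx ?orbT ?negb_or ?bA ?cA ?eA ?cb ?be ?ba ?ce ?ca ?ea.
- apply: (TL [:: (e, [set c; e]%SET); (c, [set b; c]%SET); (b, [set a; b]%SET)]).
    by move=> x /hx/or4P[]/eqP->; rewrite /= ?inE ?eqxx ?orbT.
  by rewrite /= !pp// !inE !eqxx ?orbT ?negb_or ?bA ?cA ?eA ?cb ?eb ?ba ?ec ?ca ?ea.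
Qed.

Lemma cycle_like4 H : iso_copy (cycle_graph 4) H -> cycle_like 4 H.
Proof.
move=> /iso_copy4[a [b [c [e [u ->]]]]].
have [[ab ba ac ca] [ae ea bc cb] [be eb ce ec]] := neqs4 u.
split.
- apply/fintype.subsetP => x; rewrite !inE -!orbA => /or4P[]/eqP->;
  by rewrite cards2 ?ab ?bc ?ce ?ea.
- have e1 : [set e; a]%SET != [set c; e]%SET by rewrite (finset.setUC [set e]%SET) set2_neq.
  have e2 : [set c; e]%SET != [set b; c]%SET by rewrite (finset.setUC [set c]%SET) set2_neq.
  rewrite /cycle4 finset.setUC cardsU1 (finset.setUC _ [set [set c; e]]%SET) cardsU1 cards2.
  rewrite !inE !negb_or e1 e2.
  by rewrite (set2_neq a ea eb) (set2_neq a eb ec) (set2_neq e ca cb) (set2_neq b ab ac).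
- rewrite cover_cycle4 finset.setUC cardsU1 (finset.setUC _ [set c]%SET) cardsU1 cards2.
  rewrite !inE !negb_or.
  by rewrite ea eb ec ca cb ab.
- by move=> j jd; exact: treelike_cycle4.
- move=> j jd.
  have t01 : 0 <= tau <= 1 by move: tau34; lra.
  have t23 : 2%:R / 3%:R <= tau by move: tau34; lra.
  have := bad_expect_4cycle d0 t01 jd t23 u; rewrite -/(cycle4 a b c e).
  rewrite -signr_odd expr0 mul1r; move: (bad_expect _ _ _ _) => x.
  have : 0 <= l ^+ 3 by apply: exprn_ge0; move: tau34; lra.
  rewrite [l ^+ 4]exprS; move: (l ^+ 3) => y y0 h.
  (* As l <= 1/4, the bound l^3/2 for the bad probability exceeds l^4 by at least l^3/4. *)
  have : (1 - tau) * y <= 1 / 4%:R * y by apply: ler_wpM2r => //; move: tau34; lra.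
  by lra.
Qed.

End cycles.

(** * Perturbation of products *)

Section products.
Variable R : realFieldType.

(** Telescoping: exchanging one factor at a time costs q times a product of factors bounded by M. *)
Lemma ler_dist_prod (I : Type) (r : seq I) (x y : I -> R) (M q : R) : 1 <= M ->
  (forall i, `|x i| <= M) -> (forall i, `|y i| <= M) -> (forall i, `|x i - y i| <= q) ->
  `|\prod_(i <- r) x i - \prod_(i <- r) y i| <= (size r)%:R * q * M ^+ size r.
Proof.
move=> M1 xM yM xyq; have M0 : 0 <= M by apply: le_trans M1.
elim: r => [|i r IH]; first by rewrite !big_nil subrr normr0 !mul0r.
have q0 : 0 <= q by apply: le_trans (xyq i).
have Pm : `|\prod_(i <- r) y i| <= M ^+ size r.
  elim: r {IH} => [|k r IH]; first by rewrite big_nil normr1.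
  by rewrite big_cons normrM exprS ler_pM.
rewrite !big_cons /=; move: (\prod_(j <- r) x j) (\prod_(j <- r) y j) Pm IH => X Y YM IH.
have -> : x i * X - y i * Y = x i * (X - Y) + (x i - y i) * Y by ring.
apply: le_trans (ler_normD _ _) _; rewrite !normrM.
have h1 : `|x i| * `|X - Y| <= M * ((size r)%:R * q * M ^+ size r) by exact: ler_pM.
have h2 : `|x i - y i| * `|Y| <= q * M ^+ (size r).+1.
  by rewrite ler_pM// (le_trans YM)// ler_weXn2l.
apply: le_trans (lerD h1 h2) _; rewrite -natr1 exprS.
by rewrite le_eqVlt; apply/orP; left; apply/eqP; ring.
Qed.

Lemma bernoulli_ge (x : R) m : -1 <= x -> 1 + m%:R * x <= (1 + x) ^+ m.
Proof.
move=> x1; elim: m => [|m IH]; first by rewrite mul0r addr0.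
rewrite exprS; apply: (@le_trans _ _ ((1 + x) * (1 + m%:R * x))); last first.
  by apply: ler_wpM2l => //; lra.
rewrite -natr1 -subr_ge0.
have -> : (1 + x) * (1 + m%:R * x) - (1 + (m%:R + 1) * x) = m%:R * x ^+ 2 by ring.
by rewrite mulr_ge0// sqr_ge0.
Qed.

(** Bernoulli's inequality gives (1 - x)^m >= 1/2, while (1 + x)^m (1 - x)^m <= 1. *)
Lemma expr_1D_le2 (x : R) m : 0 <= x -> m%:R * x <= 2^-1 -> (1 + x) ^+ m <= 2.
Proof.
case: m => [|m] x0 mx; first by rewrite expr0 ler1n.
have x1 : x <= 2^-1.
  by apply: le_trans mx; rewrite ler_peMl// ler1n.
have h1 : 2^-1 <= (1 - x) ^+ m.+1.
  by apply: le_trans (bernoulli_ge m.+1 _); rewrite ?mulrN; lra.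
have h2 : (1 + x) ^+ m.+1 * (1 - x) ^+ m.+1 <= 1.
  rewrite -exprMn exprn_ile1//.
    by rewrite mulr_ge0//; lra.
  by have := sqr_ge0 x; rewrite expr2; nra.
have h3 : 0 <= (1 + x) ^+ m.+1 by apply: exprn_ge0; lra.
move: h1 h2 h3; move: (_ ^+ _) (_ ^+ _) => a b; nra.
Qed.

Lemma ler_dist_scale (a b x y t : R) : `|x - y| <= t * y ->
  `|a * b * x - a * y * b| <= t * (`|a| * y * `|b|).
Proof.
have -> : a * b * x - a * y * b = a * b * (x - y) by ring.
have -> : t * (`|a| * y * `|b|) = `|a| * `|b| * (t * y) by ring.
by move=> h; rewrite !normrM; apply: ler_wpM2l => //; exact: mulr_ge0.
Qed.

End products.

(** * Comparing the geometric graph with independent edges *)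

Section rgg_moments.
Variables (R : realType) (n d : nat) (tau : R).
Hypothesis d0 : (0 < d)%N.
Hypothesis tau34 : 3%:R / 4%:R <= tau <= 1.
Local Notation l := (1 - tau).
Local Notation Psi := (bad_expect d tau).
Local Notation Phi := (good_expect d tau).
Let tau01 : 0 <= tau <= 1. Proof. by move: tau34; lra. Qed.
Let tau0 : 0 < tau. Proof. by move: tau34; lra. Qed.
Let tau4 : 2 / tau <= 4%:R. Proof. by rewrite ler_pdivrMr//; move: tau34; lra. Qed.
Let l30 : 0 <= l ^+ 3.
Proof. by apply: exprn_ge0; move: tau34; lra. Qed.
Variable A : R.
Hypothesis A_ge : 4%:R ^+ 8 <= A.
Local Notation theta := (A * l ^+ 3).
Hypothesis dtheta : d%:R * theta <= 2^-1.
Local Notation p := (tau ^+ d).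
Implicit Types (j k : nat) (S T U H : {set {set 'I_n}}) (g : {set {set 'I_n}}).

Let A0 : 0 <= A.
Proof. by apply: le_trans A_ge; exact: exprn_ge0. Qed.
Let theta0 : 0 <= theta.
Proof. exact: mulr_ge0. Qed.
Let p0 : 0 < p. Proof. exact: exprn_gt0. Qed.

Definition edges_expect S : R := RGG_expect d tau (fun g => \prod_(e in S) (e \in g)%:R).

Lemma edges_expectE S : S \subset pairs n -> edges_expect S = \prod_(k < d) Phi k S.
Proof. exact: RGG_expect_edges. Qed.

(** Dividing by tau^#|S| turns the error 2^#|S| l^3 into at most 4^8 l^3; eight is the number of
    edges of two disjoint 4-cycles. *)
Lemma good_expect_ratio k S : (k < d)%N -> S \subset pairs n -> (#|S| <= 8)%N ->
  `|Phi k S / tau ^+ #|S| - 1| <= theta.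
Proof.
move=> kd Sp S8; have h := good_expect_approx d0 tau34 kd Sp.
have t0 : 0 < tau ^+ #|S| by exact: exprn_gt0.
have -> : Phi k S / tau ^+ #|S| - 1 = (Phi k S - tau ^+ #|S|) / tau ^+ #|S|.
  by rewrite mulrBl divff// gt_eqF.
rewrite normrM normfV (gtr0_norm t0) ler_pdivrMr//; apply: le_trans h _.
rewrite mulrAC (@ler_wpM2r _ (l ^+ 3))//.
rewrite -ler_pdivrMr// -expr_div_n.
have h20 : 0 <= 2 / tau by rewrite divr_ge0// ltW.
apply: (@le_trans _ _ (4%:R ^+ #|S|)).
  by apply: lerXn2r; rewrite ?nnegrE.
by apply: le_trans A_ge; apply: ler_weXn2l; rewrite // ler1n.
Qed.

Let prod_ratio S (F : nat -> R) : \prod_(k < d) (F k / tau ^+ #|S|) =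
  (\prod_(k < d) F k) / p ^+ #|S|.
Proof.
by rewrite big_split/= prodr_const card_ord exprVn -!exprM mulnC.
Qed.

(** The relative errors theta of the d slots add up to d theta, and the factor (1 + theta)^d is at
    most 2. *)
Lemma edges_expect_approx S : S \subset pairs n -> (#|S| <= 8)%N ->
  `|edges_expect S - p ^+ #|S| | <= 2 * (d%:R * theta) * p ^+ #|S|.
Proof.
move=> Sp S8; have pS : 0 < p ^+ #|S| by exact: exprn_gt0.
rewrite -ler_pdivrMr// -{2}(gtr0_norm pS) -normfV -normrM mulrBl divff ?gt_eqF//.
rewrite edges_expectE// -(prod_ratio S (fun k => Phi k S)).
have th1 : 1 <= 1 + theta by rewrite lerDl.
have rt (k : 'I_d) := good_expect_ratio (ltn_ord k) Sp S8.
have rM (k : 'I_d) : `|Phi k S / tau ^+ #|S| | <= 1 + theta.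
  rewrite -[X in `|X|](subrK 1) addrC (le_trans (ler_normD _ _))//.
  by rewrite normr1 lerD2l.
have uM (k : 'I_d) : `|1 : R| <= 1 + theta by rewrite normr1.
have := ler_dist_prod (index_enum 'I_d) th1 rM uM rt.
rewrite big1_eq => /le_trans; apply.
rewrite (_ : size _ = d); last by rewrite -[RHS](card_ord d) cardE enumT.
by rewrite mulrC; apply: ler_wpM2r; [exact: mulr_ge0|exact: expr_1D_le2].
Qed.

(** Products of two signed weights have this form. Expanding over subsets, each term gets the same
    relative error, and the absolute values reassemble into a product. *)
Lemma RGG_expect_mix U (al be : {set 'I_n} -> R) : U \subset pairs n -> (#|U| <= 8)%N ->
  `|RGG_expect d tau (fun g => \prod_(e in U) (al e * (e \in g)%:R + be e)) -
    \prod_(e in U) (al e * p + be e)| <=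
  2 * (d%:R * theta) * \prod_(e in U) (`|al e| * p + `|be e|).
Proof.
move=> Up U8.
rewrite (_ : (fun g => _) = fun g => \sum_(S : {set {set 'I_n}} | S \subset U)
   ((\prod_(e in S) al e) * (\prod_(e in U :\: S) be e)) * \prod_(e in S) (e \in g)%:R);
    last first.
  by apply/funext => g; rewrite prodrD_subset; apply: eq_bigr => S _; rewrite big_split/= mulrAC.
rewrite RGG_expect_sum//.
rewrite (eq_bigr (fun S => (\prod_(e in S) al e) * (\prod_(e in (U :\: S)%SET) be e) *
   edges_expect S)); last first.
  by move=> S _; exact: (RGG_expectZ d tau01 _ (fun g => \prod_(e in S) (e \in g)%:R)).
rewrite [X in _ - X]prodrD_subset [X in _ <= _ * X]prodrD_subset -sumrB mulr_sumr.
apply: le_trans (ler_norm_sum _ _ _) _; apply: ler_sum => S SU.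
have Sp := fintype.subset_trans SU Up.
have S8 : (#|S| <= 8)%N by apply: leq_trans U8; exact: subset_leq_card.
rewrite !big_split/= !prodr_const -/(edges_expect S) -!normr_prod.
move: (\prod_(e in S) al e) (\prod_(e in (U :\: S)%SET) be e) => a b.
exact/ler_dist_scale/edges_expect_approx.
Qed.

End rgg_moments.

(** * Algebra of signed weights *)

Section signed_weights.
Variables (R : realType) (n : nat) (p : R).
Implicit Types (S T H g : {set {set 'I_n}}).

Lemma SW_subset H g : SW p H g = \sum_(S : {set {set 'I_n}} | S \subset H)
  (- p) ^+ #|(H :\: S)%SET| * \prod_(e in S) (e \in g)%:R.
Proof.
by rewrite /SW prodrD_subset; apply: eq_bigr => S _; rewrite prodr_const mulrC.
Qed.

(* On common edges, (1_e - p)^2 = (1 - 2p) 1_e + p^2. *)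
Definition mix_lin (H1 H2 : {set {set 'I_n}}) e : R :=
  if e \in (H1 :&: H2)%SET then 1 - 2 * p else 1.
Definition mix_cst (H1 H2 : {set {set 'I_n}}) e : R :=
  if e \in (H1 :&: H2)%SET then p ^+ 2 else - p.

Lemma SWM H1 H2 g : SW p H1 g * SW p H2 g =
  \prod_(e in (H1 :|: H2)%SET) (mix_lin H1 H2 e * (e \in g)%:R + mix_cst H1 H2 e).
Proof.
rewrite /SW big_mkcond [X in _ * X]big_mkcond -big_split/= [RHS]big_mkcond/=.
apply: eq_bigr => e _; rewrite /mix_lin /mix_cst !inE.
by case: (e \in H1); case: (e \in H2); case: (e \in g) => /=; ring.
Qed.

(** An edge that lies in just one of the two graphs contributes p - p; this is the orthogonality of
    signed weights under G(n, p). *)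
Lemma mix_prod0 H1 H2 : H1 != H2 ->
  \prod_(e in (H1 :|: H2)%SET) (mix_lin H1 H2 e * p + mix_cst H1 H2 e) = 0.
Proof.
move=> H12.
have [e /andP[eU eI]] : exists e, (e \in (H1 :|: H2)%SET) && (e \notin (H1 :&: H2)%SET).
  apply/existsP; apply: contraNT H12; rewrite negb_exists => /forallP h.
  apply/eqP/finset.setP => e; have := h e; rewrite !inE.
  by case: (e \in H1); case: (e \in H2).
by rewrite (bigD1 e)//= /mix_lin /mix_cst (negbTE eI) mul1r subrr mul0r.
Qed.

Lemma mix_prod_id H : \prod_(e in (H :|: H)%SET) (mix_lin H H e * p + mix_cst H H e) =
  (p * (1 - p)) ^+ #|H|.
Proof.
rewrite finset.setUid -prodr_const; apply: eq_bigr => e eH.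
by rewrite /mix_lin /mix_cst inE eH/=; ring.
Qed.

Lemma mix_prod_le H1 H2 : 0 <= p <= 2^-1 ->
  \prod_(e in (H1 :|: H2)%SET) (`|mix_lin H1 H2 e| * p + `|mix_cst H1 H2 e|) <=
  (2 * p) ^+ #|(H1 :|: H2)%SET|.
Proof.
move=> hp; have p0 : 0 <= p by lra.
rewrite -prodr_const; apply: ler_prod => e _; apply/andP; split.
  by rewrite addr_ge0// mulr_ge0.
rewrite /mix_lin /mix_cst; case: ifP => _.
  rewrite ger0_norm; last by lra.
  by rewrite ger0_norm ?sqr_ge0//; nra.
by rewrite normr1 normrN ger0_norm//; lra.
Qed.

End signed_weights.

(** * Expected signed weight of a cycle *)

Section cycle_moments.
Variables (R : realType) (n d : nat) (tau : R).
Hypothesis d0 : (0 < d)%N.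
Hypothesis tau34 : 3%:R / 4%:R <= tau <= 1.
Local Notation l := (1 - tau).
Local Notation Psi := (bad_expect d tau).
Local Notation Phi := (good_expect d tau).
Let tau01 : 0 <= tau <= 1. Proof. by move: tau34; lra. Qed.
Let tau0 : 0 < tau. Proof. by move: tau34; lra. Qed.
Let l0 : 0 <= l. Proof. by move: tau34; lra. Qed.
Let l1 : l <= 1. Proof. by move: tau34; lra. Qed.
Let tau1 : tau <= 1. Proof. by case/andP: tau34. Qed.
Variables A p : R.
Hypothesis A_ge : 4%:R ^+ 8 <= A.
Local Notation theta := (A * l ^+ 3).
Hypothesis dtheta : d%:R * theta <= 2^-1.
Hypothesis pE : p = tau ^+ d.
Hypothesis p_half : p <= 2^-1.
Local Notation E := (RGG_expect d tau).
Local Notation EG := (@edges_expect R n d tau).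
Implicit Types (j k : nat) (S T U H : {set {set 'I_n}}) (g : {set {set 'I_n}}).

Let p0 : 0 < p. Proof. by rewrite pE exprn_gt0. Qed.
Let theta0 : 0 <= theta.
Proof. by apply: mulr_ge0; [apply: le_trans A_ge|]; exact: exprn_ge0. Qed.

Lemma treelike_bad j H T : treelike d tau j H -> T \subset H -> T != H ->
  Psi j T = l ^+ #|T|.
Proof.
move=> tH TH nTH; have := tH finset.set0 T TH nTH.
by rewrite finset.setU0 bad_expect0 mulr1 /cover big_set0 finset.setI0 finset.cards0; apply.
Qed.

Lemma treelike_good j H S : treelike d tau j H -> S \subset H -> S != H ->
  Phi j S = tau ^+ #|S|.
Proof.
move=> tH SH nSH; rewrite good_expectE.
have -> : tau ^+ #|S| = (1 - l) ^+ #|S| by congr (_ ^+ _); ring.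
rewrite -sum_subset_exp; apply: eq_bigr => T TS; congr (_ * _).
apply: (treelike_bad tH); first exact: fintype.subset_trans SH.
apply: contraNneq nSH => TH; rewrite finset.eqEsubset SH -TH; exact: TS.
Qed.

Lemma edges_expect_treelike H S : H \subset pairs n ->
  (forall j, (j < d)%N -> treelike d tau j H) -> S \subset H -> S != H ->
  EG S = p ^+ #|S|.
Proof.
move=> Hp tH SH nSH; rewrite edges_expectE//; last exact: fintype.subset_trans Hp.
rewrite (eq_bigr (fun=> tau ^+ #|S|)) => [|j _]; last first.
  by apply: treelike_good (tH j _) SH nSH.
by rewrite prodr_const card_ord -exprM mulnC exprM pE.
Qed.

Lemma SW_expect H : E (SW p H) = \sum_(S : {set {set 'I_n}} | S \subset H)
  (- p) ^+ #|(H :\: S)%SET| * EG S.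
Proof.
rewrite (_ : SW p H = fun g => \sum_(S : {set {set 'I_n}} | S \subset H)
  (- p) ^+ #|(H :\: S)%SET| * \prod_(e in S) (e \in g)%:R); last first.
  by apply/funext => g; exact: SW_subset.
rewrite RGG_expect_sum//; apply: eq_bigr => S _.
exact: (RGG_expectZ d tau01 _ (fun g => \prod_(e in S) (e \in g)%:R)).
Qed.

(** Proper subsets have the same expectation as under G(n, p), where the signed weight has mean 0;
    only the full edge set makes a difference. *)
Lemma SW_expect_cycle k H : (0 < k)%N -> cycle_like d tau k H -> E (SW p H) = EG H - p ^+ k.
Proof.
move=> k0 [Hp Hk _ tH _]; rewrite SW_expect (bigD1 H)//=.
rewrite finset.setDv finset.cards0 mul1r; congr (_ + _).
rewrite (eq_bigr (fun S : {set {set 'I_n}} =>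
    (\prod_(e in S) p) * (\prod_(e in (H :\: S)%SET) (- p)))); last first.
  move=> S /andP[SH nSH]; rewrite (edges_expect_treelike Hp tH SH nSH).
  by rewrite !prodr_const mulrC.
have : \prod_(e in H) (p + (- p)) = 0.
  by rewrite subrr prodr_const Hk expr0n; case: (k) k0.
rewrite prodrD_subset (bigD1 H)//= finset.setDv big_set0 mulr1 prodr_const Hk.
by move/eqP; rewrite addrC addr_eq0 => /eqP ->.
Qed.

(** Each slot gains a factor 1 + l^3/4 over tau^k by the last clause of [cycle_like], and
    Bernoulli's inequality adds up these gains over d slots. *)
Lemma SW_expect_ge k H : (0 < k)%N -> cycle_like d tau k H ->
  p ^+ k * (d%:R * (l ^+ 3 / 4)) <= E (SW p H).
Proof.
move=> k0 cH; rewrite (SW_expect_cycle k0 cH); case: cH => Hp Hk _ tH lo.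
have l3 : 0 <= l ^+ 3 / 4 by apply: divr_ge0; [exact: exprn_ge0|].
rewrite lerBrDl edges_expectE//.
have Pk j : (j < d)%N -> tau ^+ k * (1 + l ^+ 3 / 4) <= Phi j H.
  move=> jd; apply: (@le_trans _ _ (tau ^+ k + l ^+ 3 / 4)).
    rewrite mulrDr mulr1 lerD2l ler_piMl//; apply: exprn_ile1 => //.
    exact: ltW.
  apply: (@le_trans _ _ (tau ^+ k + (-1) ^+ k * (Psi j H - l ^+ k))).
    by rewrite lerD2l; exact: lo.
  have -> : tau ^+ k = (1 - l) ^+ #|H| by rewrite Hk; congr (_ ^+ _); ring.
  rewrite -sum_subset_exp good_expectE (bigD1 H)//= [X in _ <= X](bigD1 H)//= Hk.
  rewrite addrAC -mulrDr [l ^+ k + _]addrC subrK lerD2l le_eqVlt; apply/orP; left; apply/eqP.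
  apply: eq_bigr => T /andP[TH nTH]; congr (_ * _).
  by rewrite (treelike_bad (tH j jd) TH nTH).
apply: (@le_trans _ _ ((tau ^+ k * (1 + l ^+ 3 / 4)) ^+ d)); last first.
  rewrite -[X in _ ^+ X](card_ord d) -prodr_const; apply: ler_prod => j _.
  rewrite Pk// andbT mulr_ge0//; first by apply: exprn_ge0; exact: ltW.
  exact: addr_ge0.
rewrite exprMn -exprM mulnC exprM -pE -[X in X + _]mulr1 -mulrDr.
apply: ler_wpM2l; first by apply: exprn_ge0; exact: ltW.
by apply: bernoulli_ge; apply: le_trans l3.
Qed.

Lemma SW_expect_le k H : (0 < k <= 8)%N -> cycle_like d tau k H ->
  E (SW p H) <= 2 * (d%:R * theta) * p ^+ k.
Proof.
move=> /andP[k0 k8] cH; rewrite (SW_expect_cycle k0 cH); case: cH => Hp Hk _ _ _.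
have H8 : (#|H| <= 8)%N by rewrite Hk.
have := edges_expect_approx d0 tau34 A_ge dtheta Hp H8; rewrite -pE Hk.
exact: le_trans (ler_norm _).
Qed.

Lemma SWM_expect_mix H1 H2 : H1 \subset pairs n -> H2 \subset pairs n ->
  (#|(H1 :|: H2)%SET| <= 8)%N ->
  `|E (fun g => SW p H1 g * SW p H2 g) -
    \prod_(e in (H1 :|: H2)%SET) (mix_lin p H1 H2 e * p + mix_cst p H1 H2 e)| <=
  2 * (d%:R * theta) * (2 * p) ^+ #|(H1 :|: H2)%SET|.
Proof.
move=> H1p H2p U8.
have Up : (H1 :|: H2)%SET \subset pairs n by rewrite finset.subUset H1p.
rewrite (_ : (fun g => _) = fun g => \prod_(e in (H1 :|: H2)%SET)
   (mix_lin p H1 H2 e * (e \in g)%:R + mix_cst p H1 H2 e)); last first.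
  by apply/funext => g; exact: SWM.
have := RGG_expect_mix d0 tau34 A_ge dtheta (mix_lin p H1 H2) (mix_cst p H1 H2) Up U8.
rewrite -pE => /le_trans; apply; apply: ler_wpM2l.
  by rewrite mulr_ge0// mulr_ge0.
by apply: mix_prod_le; rewrite (ltW p0).
Qed.

End cycle_moments.

Lemma prodr_setU_disjoint (R : comNzRingType) (I : finType) (S T : {set I}) (f : I -> R) :
  (S :&: T = finset.set0)%SET ->
  \prod_(i in (S :|: T)%SET) f i = (\prod_(i in S) f i) * (\prod_(i in T) f i).
Proof.
move=> ST; rewrite -bigU; first by apply: eq_bigl => e; rewrite !inE.
by rewrite -finset.setI_eq0 ST.
Qed.

Lemma big_subset_pair (R : nmodType) (I : finType) (H1 H2 : {set I})
    (D : {set I} -> {set I} -> R) :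
  (forall S1 S2 : {set I}, S1 \subset H1 -> S2 \subset H2 -> S1 != H1 \/ S2 != H2 -> D S1 S2 = 0) ->
  \sum_(S1 : {set I} | S1 \subset H1) \sum_(S2 : {set I} | S2 \subset H2) D S1 S2 = D H1 H2.
Proof.
move=> D0; rewrite (bigD1 H1)//= [X in X + _](bigD1 H2)//=.
rewrite [X in D H1 H2 + X + _]big1 => [|S /andP[SH nSH]]; last by apply: D0 => //; right.
rewrite addr0 [X in _ + X]big1 ?addr0// => S /andP[SH nSH].
by apply: big1 => T TH; apply: D0 => //; left.
Qed.

Lemma subset_proper_neq (I : finType) (T S H : {set I}) :
  T \subset S -> S \subset H -> S != H -> T != H.
Proof.
move=> TS SH; apply: contraNneq => TH; rewrite finset.eqEsubset SH -TH; exact: TS.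
Qed.

(** * Covariance of two cycles with at most one common vertex *)

Section covariance.
Variables (R : realType) (n d : nat) (tau : R).
Hypothesis d0 : (0 < d)%N.
Hypothesis tau34 : 3%:R / 4%:R <= tau <= 1.
Local Notation l := (1 - tau).
Local Notation Psi := (bad_expect d tau).
Local Notation Phi := (good_expect d tau).
Let tau01 : 0 <= tau <= 1. Proof. by move: tau34; lra. Qed.
Let tau0 : 0 < tau. Proof. by move: tau34; lra. Qed.
Let l0 : 0 <= l. Proof. by move: tau34; lra. Qed.
Let l1 : l <= 1. Proof. by move: tau34; lra. Qed.
Let tau_inv : tau^-1 <= 2.
Proof. by rewrite invf_ple ?posrE//; move: tau34; lra. Qed.
Variables A p : R.
Hypothesis A_ge : 4%:R ^+ 8 <= A.
Local Notation theta := (A * l ^+ 3).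
Hypothesis dtheta : d%:R * theta <= 2^-1.
Hypothesis pE : p = tau ^+ d.
Local Notation E := (RGG_expect d tau).
Local Notation EG := (@edges_expect R n d tau).
Implicit Types (j k : nat) (S T U H : {set {set 'I_n}}) (g : {set {set 'I_n}}).

Let p0 : 0 < p. Proof. by rewrite pE exprn_gt0. Qed.
Let theta0 : 0 <= theta.
Proof. by apply: mulr_ge0; [apply: le_trans A_ge|]; exact: exprn_ge0. Qed.

Lemma good_expectU j S1 S2 : (S1 :&: S2 = finset.set0)%SET ->
  Phi j (S1 :|: S2)%SET =
  \sum_(T1 : {set {set 'I_n}} | T1 \subset S1) \sum_(T2 : {set {set 'I_n}} | T2 \subset S2)
    ((-1) ^+ #|T1| * (-1) ^+ #|T2|) * Psi j (T1 :|: T2)%SET.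
Proof.
move=> S12; rewrite /good_expect.
rewrite (_ : (fun v => _) = fun v =>
  \sum_(T1 : {set {set 'I_n}} | T1 \subset S1) \sum_(T2 : {set {set 'I_n}} | T2 \subset S2)
    ((-1) ^+ #|T1| * (-1) ^+ #|T2|) *
    \prod_(e in (T1 :|: T2)%SET) (bad_edge d tau j e v)%:R).
  rewrite unif_expect_sum => [|T1 _]; last first.
    by apply: bmeas_sum => T2 _; apply: bmeasZ; exact: bmeas_prod_bad.
  apply: eq_bigr => T1 _; rewrite unif_expect_sum => [|T2 _]; last first.
    by apply: bmeasZ; exact: bmeas_prod_bad.
  by apply: eq_bigr => T2 _; apply: unif_expectZ; exact: bmeas_prod_bad.
apply/funext => v; rewrite prodr_setU_disjoint//.
have ex S : \prod_(e in S) (1 - (bad_edge d tau j e v)%:R) =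
    \sum_(T : {set {set 'I_n}} | T \subset S)
      (-1) ^+ #|T| * \prod_(e in T) (bad_edge d tau j e v)%:R :> R.
  under eq_bigr do rewrite addrC -mulN1r; rewrite prodrD_subset.
  by apply: eq_bigr => T _; rewrite big1_eq mulr1 big_split/= prodr_const.
rewrite !ex big_distrlr/=; apply: eq_bigr => T1 T1S; apply: eq_bigr => T2 T2S.
rewrite prodr_setU_disjoint; first by rewrite mulrACA.
by apply/eqP; rewrite -finset.subset0 -S12; exact: finset.setISS.
Qed.

Section pair.
Variables (k : nat) (H1 H2 : {set {set 'I_n}}) (delta : R).
Hypothesis k4 : (0 < k <= 4)%N.
Hypothesis cH1 : cycle_like d tau k H1.
Hypothesis cH2 : cycle_like d tau k H2.
Hypothesis share1 : (#|(cover H1 :&: cover H2)%SET| <= 1)%N.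
Hypothesis hdelta : forall j, (j < d)%N ->
  `|Psi j (H1 :|: H2)%SET - Psi j H1 * Psi j H2| <= delta.

Lemma disjoint_edges : (H1 :&: H2 = finset.set0)%SET.
Proof.
case: cH1 => H1p _ _ _ _.
apply/eqP/finset.set0Pn => -[e]; rewrite inE => /andP[e1 e2].
move: share1; rewrite leqNgt => /negP; apply.
have := fintype.subsetP H1p _ e1; rewrite inE => /eqP e2c.
have : e \subset (cover H1 :&: cover H2)%SET by rewrite finset.subsetI !finset.bigcup_sup.
by move=> /subset_leq_card; rewrite e2c.
Qed.

(** A proper part of either cycle peels off as a forest, so within a slot only the two full cycles
    can be dependent. *)
Let bad_split j T1 T2 : (j < d)%N -> T1 \subset H1 -> T2 \subset H2 ->
  T1 != H1 \/ T2 != H2 -> Psi j (T1 :|: T2)%SET = Psi j T1 * Psi j T2.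
Proof.
case: cH1 => H1p H1k _ tH1 _; case: cH2 => H2p H2k _ tH2 _.
move=> jd T1H T2H [] nT.
  rewrite (tH1 j jd T2 T1 T1H nT) ?(treelike_bad (tH1 j jd) T1H nT)//.
  by apply: leq_trans share1; apply/subset_leq_card/finset.setIS/cover_setS.
rewrite finset.setUC (tH2 j jd T1 T2 T2H nT) ?(treelike_bad (tH2 j jd) T2H nT) 1?mulrC//.
by rewrite finset.setIC; apply: leq_trans share1; apply/subset_leq_card/finset.setSI/cover_setS.
Qed.

Let good_diff j S1 S2 : S1 \subset H1 -> S2 \subset H2 ->
  Phi j (S1 :|: S2)%SET - Phi j S1 * Phi j S2 =
  \sum_(T1 : {set {set 'I_n}} | T1 \subset S1) \sum_(T2 : {set {set 'I_n}} | T2 \subset S2)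
    ((-1) ^+ #|T1| * (-1) ^+ #|T2|) * (Psi j (T1 :|: T2)%SET - Psi j T1 * Psi j T2).
Proof.
move=> S1H S2H; rewrite good_expectU; last first.
  by apply/eqP; rewrite -finset.subset0 -disjoint_edges; exact: finset.setISS.
rewrite !good_expectE big_distrlr -sumrB; apply: eq_bigr => T1 _.
by rewrite -sumrB; apply: eq_bigr => T2 _; rewrite mulrBr; congr (_ - _); rewrite mulrACA.
Qed.

Let good_split j S1 S2 : (j < d)%N -> S1 \subset H1 -> S2 \subset H2 ->
  S1 != H1 \/ S2 != H2 -> Phi j (S1 :|: S2)%SET = Phi j S1 * Phi j S2.
Proof.
move=> jd S1H S2H nS; apply/eqP; rewrite -subr_eq0 good_diff//; apply/eqP.
apply: big1 => T1 T1S; apply: big1 => T2 T2S; rewrite bad_split ?subrr ?mulr0//.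
- exact: fintype.subset_trans S1H.
- exact: fintype.subset_trans S2H.
- by case: nS => nS; [left|right]; exact: subset_proper_neq nS.
Qed.

Let good_full j : (j < d)%N -> `|Phi j (H1 :|: H2)%SET - Phi j H1 * Phi j H2| <= delta.
Proof.
move=> jd; rewrite good_diff// big_subset_pair => [|T1 T2 T1H T2H nT]; last first.
  by rewrite bad_split// subrr mulr0.
by rewrite !normrM !normrX !normrN1 !expr1n !mul1r; exact: hdelta.
Qed.

(** Every other pair of subsets factorizes in each slot, so its term in the signed expansion
    vanishes. *)
Lemma SW_cov_edges :
  E (fun g => SW p H1 g * SW p H2 g) - E (SW p H1) * E (SW p H2) =
  EG (H1 :|: H2)%SET - EG H1 * EG H2.
Proof.
case: cH1 => H1p H1k _ tH1 _; case: cH2 => H2p H2k _ tH2 _.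
rewrite (_ : (fun g => _) = fun g =>
  \sum_(S1 : {set {set 'I_n}} | S1 \subset H1) \sum_(S2 : {set {set 'I_n}} | S2 \subset H2)
    ((- p) ^+ #|(H1 :\: S1)%SET| * (- p) ^+ #|(H2 :\: S2)%SET|) *
    \prod_(e in (S1 :|: S2)%SET) (e \in g)%:R); last first.
  apply/funext => g; rewrite !SW_subset big_distrlr.
  apply: eq_bigr => S1 S1H; apply: eq_bigr => S2 S2H.
  rewrite prodr_setU_disjoint; first by rewrite mulrACA.
  by apply/eqP; rewrite -finset.subset0 -disjoint_edges; exact: finset.setISS.
rewrite RGG_expect_sum// !SW_expect// big_distrlr -sumrB.
rewrite (eq_bigr (fun S1 : {set {set 'I_n}} => \sum_(S2 : {set {set 'I_n}} | S2 \subset H2)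
  ((- p) ^+ #|(H1 :\: S1)%SET| * (- p) ^+ #|(H2 :\: S2)%SET|) *
  (EG (S1 :|: S2)%SET - EG S1 * EG S2))); last first.
  move=> S1 S1H; rewrite RGG_expect_sum// -sumrB; apply: eq_bigr => S2 S2H.
  rewrite mulrBr; congr (_ - _); last by rewrite mulrACA.
  exact: (RGG_expectZ d tau01 _ (fun g => \prod_(e in (S1 :|: S2)%SET) (e \in g)%:R)).
rewrite big_subset_pair => [|S1 S2 S1H S2H nS].
  by rewrite !finset.setDv finset.cards0 !mul1r.
have S1p := fintype.subset_trans S1H H1p; have S2p := fintype.subset_trans S2H H2p.
rewrite !edges_expectE ?finset.subUset ?S1p// -big_split/= (_ : _ - _ = 0) ?mulr0//.
by apply/eqP; rewrite subr_eq0; apply/eqP; apply: eq_bigr => j _; exact: good_split.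
Qed.

(** Slotwise comparison after division by tau^(2k): 2^8 bounds tau^(-2k), and 4 bounds the d-th
    power of (1 + theta)^2. *)
Lemma edges_expect_dist :
  `|EG (H1 :|: H2)%SET - EG H1 * EG H2| <= d%:R * (2 ^+ 8 * delta) * 4%:R * p ^+ (k + k).
Proof.
case: cH1 => H1p H1k _ tH1 _; case: cH2 => H2p H2k _ tH2 _.
have [k0 kk] := andP k4.
have U8 : #|(H1 :|: H2)%SET| = (k + k)%N.
  by rewrite finset.cardsU disjoint_edges finset.cards0 subn0 H1k H2k.
have Up : (H1 :|: H2)%SET \subset pairs n by rewrite finset.subUset H1p.
have kk8 : (k + k <= 8)%N by exact: (leq_add kk kk).
have pk : 0 < p ^+ (k + k) by exact: exprn_gt0.
have tk : 0 < tau ^+ (k + k) by exact: exprn_gt0.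
have dl0 : 0 <= delta by apply: le_trans (hdelta d0).
have ratio S (j : 'I_d) : S \subset pairs n -> (#|S| <= 8)%N ->
    `|Phi j S / tau ^+ #|S| | <= 1 + theta.
  move=> Sp S8; have := good_expect_ratio d0 tau34 A_ge (ltn_ord j) Sp S8.
  move: (Phi j S / _) => x h.
  by rewrite -[x](subrK 1) addrC (le_trans (ler_normD _ _))// normr1 lerD2l.
have xM (j : 'I_d) : `|Phi j (H1 :|: H2)%SET / tau ^+ (k + k)| <= (1 + theta) ^+ 2.
  rewrite -U8; apply: le_trans (ratio _ j Up _) _; first by rewrite U8.
  by rewrite expr2 ler_peMl// ?lerDl// addr_ge0.
have yM (j : 'I_d) : `|Phi j H1 * Phi j H2 / tau ^+ (k + k)| <= (1 + theta) ^+ 2.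
  rewrite exprD invfM mulrACA normrM expr2; apply: ler_pM => //.
    by rewrite -H1k; apply: ratio => //; rewrite H1k (leq_trans kk).
  by rewrite -H2k; apply: ratio => //; rewrite H2k (leq_trans kk).
have xy (j : 'I_d) : `|Phi j (H1 :|: H2)%SET / tau ^+ (k + k) -
    Phi j H1 * Phi j H2 / tau ^+ (k + k)| <= 2 ^+ 8 * delta.
  rewrite -mulrBl normrM mulrC; apply: ler_pM => //; last exact: good_full.
  rewrite normfV gtr0_norm// -exprVn.
  apply: (@le_trans _ _ (2 ^+ (k + k))).
    by apply: lerXn2r; rewrite ?nnegrE// invr_ge0 ltW.
  by apply: ler_weXn2l; rewrite // ler1n.
have M1 : 1 <= (1 + theta) ^+ 2 by rewrite exprn_ege1// lerDl.
have := ler_dist_prod (index_enum 'I_d) M1 xM yM xy.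
have -> : size (index_enum 'I_d) = d by rewrite -[RHS](card_ord d) cardE enumT.
rewrite !big_split/= -!edges_expectE// prodr_const card_ord exprVn -exprM mulnC exprM -pE.
rewrite -mulrBl normrM normfV (gtr0_norm pk) ler_pdivrMr// => /le_trans; apply.
apply: ler_wpM2r; first exact: ltW.
apply: ler_wpM2l; first by rewrite !mulr_ge0// exprn_ge0.
have h2 : (1 + theta) ^+ d <= 2 by exact: expr_1D_le2.
rewrite exprAC expr2 (_ : 4%:R = 2 * 2 :> R); last by ring.
by apply: ler_pM => //; apply: exprn_ge0; rewrite addr_ge0.
Qed.

Lemma SW_cov_le :
  E (fun g => SW p H1 g * SW p H2 g) - E (SW p H1) * E (SW p H2) <=
  d%:R * (2 ^+ 8 * delta) * 4%:R * p ^+ (k + k).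
Proof. by rewrite SW_cov_edges (le_trans (ler_norm _))// edges_expect_dist. Qed.

End pair.

Lemma SW_cov_disjoint k H1 H2 : (0 < k <= 4)%N ->
  cycle_like d tau k H1 -> cycle_like d tau k H2 ->
  (cover H1 :&: cover H2 = finset.set0)%SET ->
  E (fun g => SW p H1 g * SW p H2 g) - E (SW p H1) * E (SW p H2) <= 0.
Proof.
move=> k4 c1 c2 c0; have s1 : (#|(cover H1 :&: cover H2)%SET| <= 1)%N by rewrite c0 finset.cards0.
apply: le_trans (@SW_cov_le k H1 H2 0 k4 c1 c2 s1 _) _; last by rewrite !mulr0 !mul0r.
move=> j jd; rewrite bad_expect_disjoint//; first by rewrite subrr normr0.
by case: c1.
Qed.

(** Removing an edge from each cycle leaves forests with at least two edges apiece, so the joint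
    probability and the product are both at most l^4. *)
Lemma SW_cov_share1 k H1 H2 : (2 < k <= 4)%N ->
  cycle_like d tau k H1 -> cycle_like d tau k H2 ->
  (#|(cover H1 :&: cover H2)%SET| <= 1)%N ->
  E (fun g => SW p H1 g * SW p H2 g) - E (SW p H1) * E (SW p H2) <=
  d%:R * (2 ^+ 8 * l ^+ 4) * 4%:R * p ^+ (k + k).
Proof.
move=> /andP[k2 kk4] c1 c2 s1.
have k4 : (0 < k <= 4)%N by rewrite kk4 (leq_trans _ k2).
apply: (@SW_cov_le k H1 H2 (l ^+ 4)) => // j jd.
have drop1 H : cycle_like d tau k H -> forall S, (#|(cover H :&: cover S)%SET| <= 1)%N ->
    Psi j (H :|: S)%SET <= l ^+ 2 * Psi j S.
  move=> [Hp Hk _ tH _] S HS.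
  have [e eH] : exists e, e \in H.
    by apply/finset.set0Pn; rewrite -finset.card_gt0 Hk; exact: leq_trans k2.
  apply: (@le_trans _ _ (Psi j ((H :\ e) :|: S)%SET)).
    by apply: bad_expect_anti; apply: finset.setSU; exact: finset.subD1set.
  rewrite (tH j jd S (H :\ e)%SET)//; last 2 first.
  - exact: finset.subD1set.
  - by apply/eqP => /finset.setP/(_ e); rewrite !inE eqxx eH.
  rewrite ler_wpM2r ?bad_expect_ge0// ler_wiXn2l//.
  by move: k2; rewrite -Hk (cardsD1 e H) eH.
have e0 H : cycle_like d tau k H -> Psi j H <= l ^+ 2.
  move=> cH; have := drop1 H cH finset.set0; rewrite finset.setU0 bad_expect0 mulr1.
  by apply; rewrite /cover big_set0 finset.setI0 finset.cards0.
have -> : l ^+ 4 = l ^+ 2 * l ^+ 2 by rewrite -exprD.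
have l20 : 0 <= l ^+ 2 by exact: exprn_ge0.
apply: ler_dist_itv.
- exact: bad_expect_ge0.
- by apply: le_trans (drop1 _ c1 _ s1) _; apply: ler_wpM2l => //; exact: e0.
- by rewrite mulr_ge0// bad_expect_ge0.
- by apply: ler_pM; rewrite ?bad_expect_ge0// e0.
Qed.

End covariance.

(** * Counting copies and pairs of copies *)

Section counting.
Local Open Scope nat_scope.

Lemma bin_le_expn n k : 'C(n, k) <= n ^ k.
Proof.
apply: (@leq_trans (n ^_ k)); first by rewrite -bin_ffact leq_pmulr// fact_gt0.
rewrite ffact_prod -[X in _ <= n ^ X](card_ord k) -prod_nat_const.
by apply: leq_prod => i _; exact: leq_subr.
Qed.

Lemma expn_le_bin n k : 2 * k <= n -> n ^ k <= 2 ^ k * k`! * 'C(n, k).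
Proof.
move=> kn; rewrite -mulnA [k`! * _]mulnC bin_ffact.
have : forall j, j <= k -> n ^ j <= 2 ^ j * n ^_ j.
  elim=> [//|j IH] jk; rewrite ffactnSr !expnS.
  have h : n <= 2 * (n - j) by lia.
  rewrite (_ : 2 * 2 ^ j * (n ^_ j * (n - j)) = (2 * (n - j)) * (2 ^ j * n ^_ j)); last by lia.
  by apply: leq_mul => //; apply: IH; exact: ltnW.
exact.
Qed.

Variables (n k : nat).
Implicit Types (V : {set 'I_n}) (H : {set {set 'I_n}}) (P : pred {set {set 'I_n}}).

(** W is encoded by its trace on V, with at most 2^k choices, and its k - v further points. *)
Lemma card_sets_meeting V v : #|V| = k ->
  #|[set W : {set 'I_n} | (#|W| == k) && (#|(V :&: W)%SET| == v)]%SET| <= 2 ^ k * n ^ (k - v).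
Proof.
move=> Vk; pose h (W : {set 'I_n}) := (V :&: W, W :\: V)%SET.
have hinj : injective h.
  move=> W1 W2 [h1 h2]; rewrite -(finset.setID W1 V) -(finset.setID W2 V) h2.
  by rewrite ![(_ :&: V)%SET]finset.setIC h1.
rewrite -(card_imset _ hinj).
apply: (@leq_trans #|finset.setX (powerset V)
    [set Z : {set 'I_n} | #|Z| == k - v]%SET|).
  apply/subset_leq_card/fintype.subsetP => x /imsetP[W]; rewrite inE => /andP[/eqP Wk /eqP Wv] ->.
  rewrite !inE /= finset.subsetIl/= cardsD finset.setIC Wk Wv //.
rewrite cardsX card_powerset Vk card_draws card_ord leq_mul2l bin_le_expn orbT.
by [].
Qed.

(** A crude count suffices as k is fixed: every edge belongs to the powerset of W. *)
Lemma card_cover_eq P (W : {set 'I_n}) : #|W| = k ->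
  \sum_(H | P H && (cover H == W)) 1 <= 2 ^ (2 ^ k).
Proof.
move=> Wk; rewrite -{1}Wk -(card_powerset W) -card_powerset sum1_card.
apply/subset_leq_card/fintype.subsetP => H; rewrite !inE => /andP[_ /eqP <-].
by apply/fintype.subsetP => e eH; rewrite inE finset.bigcup_sup.
Qed.

Lemma count_meeting P V v : (forall H, P H -> #|cover H| = k) -> #|V| = k ->
  \sum_(H | P H && (#|(V :&: cover H)%SET| == v)) 1 <= 2 ^ k * n ^ (k - v) * 2 ^ (2 ^ k).
Proof.
move=> cP Vk.
rewrite (partition_big (@cover _)
    (fun W : {set 'I_n} => (#|W| == k) && (#|(V :&: W)%SET| == v))) /=;
  last by move=> H /andP[/cP -> ->]; rewrite eqxx.
apply: (@leq_trans (\sum_(W : {set 'I_n} | (#|W| == k) && (#|(V :&: W)%SET| == v)) 2 ^ (2 ^ k))).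
  apply: leq_sum => W /andP[/eqP Wk _].
  exact: (card_cover_eq (fun H => P H && (#|(V :&: cover H)%SET| == v))).
rewrite sum_nat_const leq_mul2r; apply/orP; right.
rewrite -cardsE; exact: card_sets_meeting.
Qed.

Lemma count_copies P : (forall H, P H -> #|cover H| = k) ->
  \sum_(H | P H) 1 <= n ^ k * 2 ^ (2 ^ k).
Proof.
move=> cP; rewrite (partition_big (@cover _) (fun W : {set 'I_n} => #|W| == k)) /=;
  last by move=> H /cP ->.
apply: (@leq_trans (\sum_(W : {set 'I_n} | #|W| == k) 2 ^ (2 ^ k))).
  by apply: leq_sum => W /eqP Wk; exact: card_cover_eq.
rewrite sum_nat_const leq_mul2r; apply/orP; right.
by rewrite -cardsE card_draws card_ord bin_le_expn.
Qed.

(** Any k-set of vertices, enumerated cyclically, is the cover of a copy; hence [cover] maps the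
    copies onto the k-sets. *)
Lemma card_copies_ge : 'C(n, k) <=
  #|[set H : {set {set 'I_n}} | `[< iso_copy (cycle_graph k) H >]]%SET|.
Proof.
rewrite -[n in 'C(n, _)]card_ord -card_draws.
apply: leq_trans (leq_imset_card (@cover _) _); apply/subset_leq_card/fintype.subsetP => W.
rewrite inE => /eqP Wk; pose f (i : 'I_k) := enum_val (cast_ord (esym Wk) i).
have fi : injective f by move=> i j /enum_val_inj/cast_ord_inj.
apply/imsetP; exists [set [set f i; f (ordS i)] | i : 'I_k]%SET.
  by rewrite inE; apply/asboolP/iso_copyE; exists f.
apply/finset.setP => x; apply/idP/bigcupP.
  move=> xW; pose i := cast_ord Wk (enum_rank_in xW x).
  have fx : f i = x by rewrite /f /i cast_ordK enum_rankK_in.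
  by exists [set f i; f (ordS i)]%SET; [exact: imset_f|rewrite !inE fx eqxx].
by move=> [_ /imsetP[i _ ->]]; rewrite !inE => /orP[]/eqP->; exact: enum_valP.
Qed.

End counting.

(** With v common vertices there are at most v(v-1)/2 common edges, which is at most v for v = 2, 3;
    from v = 4 on, k <= 4 is enough. The union then keeps at least 2k - v edges. *)
Lemma card_edges_cap_le n (H1 H2 : {set {set 'I_n}}) (k : nat) : H1 \subset pairs n ->
  #|H1| = k -> (k <= 4)%N -> (2 <= #|(cover H1 :&: cover H2)%SET|)%N ->
  (#|(H1 :&: H2)%SET| <= #|(cover H1 :&: cover H2)%SET|)%N.
Proof.
move=> H1p H1k k4; set W := (cover H1 :&: cover H2)%SET => W2.
have h1 : (#|(H1 :&: H2)%SET| <= 'C(#|W|, 2))%N.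
  rewrite -cards_draws; apply/subset_leq_card/fintype.subsetP => e; rewrite !inE => /andP[e1 e2].
  rewrite finset.subsetI !finset.bigcup_sup//=.
  by have := fintype.subsetP H1p _ e1; rewrite inE.
have h2 : (#|(H1 :&: H2)%SET| <= 4)%N.
  by apply: leq_trans k4; rewrite -H1k; apply: subset_leq_card; exact: finset.subsetIl.
move: #|(H1 :&: H2)%SET| #|W| h1 h2 W2 => i w.
case: w => [|[|[|[|w]]]]// h1 h2 _; [exact: leq_trans h1 _..|].
exact: leq_trans h2 _.
Qed.

(** First the edge sets on the vertices of one copy, then the traces and edge sets of a second copy
    meeting it. *)
Definition pair_const (k : nat) : nat := 2 ^ (2 ^ k) * (2 ^ k * 2 ^ (2 ^ k)).

Lemma count_pairs n k (P : pred {set {set 'I_n}}) v : (forall H, P H -> #|cover H| = k) ->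
  (\sum_(H1 | P H1) \sum_(H2 | P H2) (#|(cover H1 :&: cover H2)%SET| == v) <=
   pair_const k * n ^ (k + (k - v)))%N.
Proof.
move=> cP.
apply: (@leq_trans (\sum_(H1 | P H1) 2 ^ k * n ^ (k - v) * 2 ^ (2 ^ k))%N).
  apply: leq_sum => H1 P1; apply: leq_trans (count_meeting v cP (cP _ P1)).
  by rewrite big_mkcondr/=; apply: leq_sum => H2 _; case: eqP.
rewrite -[X in (\sum_(H1 | _) X)%N]mul1n -big_distrl/=.
apply: (leq_trans (leq_mul (count_copies cP) (leqnn _))).
by rewrite /pair_const expnD leq_eqVlt; apply/orP; left; apply/eqP; ring.
Qed.

Lemma count_diag n k (P : pred {set {set 'I_n}}) : (forall H, P H -> #|cover H| = k) ->
  (\sum_(H1 | P H1) \sum_(H2 | P H2) (H1 == H2) <= pair_const k * n ^ k)%N.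
Proof.
move=> cP; apply: (@leq_trans (\sum_(H1 | P H1) 1)%N).
  apply: leq_sum => H1 P1; rewrite (bigD1 H1)//= eqxx big1// => H2 /andP[_].
  by rewrite eq_sym => /negbTE ->.
apply: (leq_trans (count_copies cP)).
rewrite /pair_const mulnC leq_mul2r; apply/orP; right.
by rewrite leq_pmulr// muln_gt0 !expn_gt0.
Qed.

(** * Variance of the signed count under the geometric graph *)

Section rgg_variance.
Variables (R : realType) (n d : nat) (tau : R).
Hypothesis d0 : (0 < d)%N.
Hypothesis tau34 : 3%:R / 4%:R <= tau <= 1.
Local Notation l := (1 - tau).
Let tau01 : 0 <= tau <= 1. Proof. by move: tau34; lra. Qed.
Let tau0 : 0 < tau. Proof. by move: tau34; lra. Qed.
Let l0 : 0 <= l. Proof. by move: tau34; lra. Qed.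
Variables A p : R.
Hypothesis A_ge : 4%:R ^+ 8 <= A.
Local Notation theta := (A * l ^+ 3).
Hypothesis dtheta : d%:R * theta <= 2^-1.
Hypothesis pE : p = tau ^+ d.
Hypothesis p_half : p <= 2^-1.
Local Notation E := (RGG_expect d tau).
Implicit Types (H : {set {set 'I_n}}) (P : pred {set {set 'I_n}}).
Variables (k : nat) (P : pred {set {set 'I_n}}).
Hypothesis k4 : (2 < k <= 4)%N.
Hypothesis cP : forall H, P H -> cycle_like d tau k H.

Let p0 : 0 < p. Proof. by rewrite pE exprn_gt0. Qed.
Let theta0 : 0 <= theta.
Proof. by apply: mulr_ge0; [apply: le_trans A_ge|]; exact: exprn_ge0. Qed.
Let dtheta0 : 0 <= d%:R * theta. Proof. exact: mulr_ge0. Qed.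
Let p1 : p <= 1. Proof. by apply: (le_trans p_half); rewrite invf_ple ?posrE// invr1 ler1n. Qed.
Let k0 : (0 < k)%N. Proof. by case/andP: k4 => k2 _; exact: leq_trans k2. Qed.

Let share1_bound : R := d%:R * (2 ^+ 8 * l ^+ 4) * 4%:R * p ^+ (k + k).
Let same_bound : R := 17%:R * p ^+ k.
Let share_bound v : R := 2 * (d%:R * theta) * (2 ^+ 8 * p ^+ (k + (k - v))).

Let share1_bound0 : 0 <= share1_bound.
Proof.
rewrite /share1_bound; apply: mulr_ge0; last by apply: exprn_ge0; exact: ltW.
by do 2 apply: mulr_ge0 => //; apply: mulr_ge0; exact: exprn_ge0.
Qed.
Let same_bound0 : 0 <= same_bound.
Proof. by apply: mulr_ge0 => //; apply: exprn_ge0; exact: ltW. Qed.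
Let share_bound0 v : 0 <= share_bound v.
Proof.
apply: mulr_ge0; first exact: mulr_ge0.
by apply: mulr_ge0; apply: exprn_ge0 => //; exact: ltW.
Qed.

(** It allows the product of means to be dropped when a covariance is bounded from above. *)
Lemma SW_expect_ge0 H : P H -> 0 <= E (SW p H).
Proof.
move=> /cP cH; apply: le_trans (SW_expect_ge d0 tau34 pE k0 cH).
apply: mulr_ge0; first by apply: exprn_ge0; exact: ltW.
by apply: mulr_ge0 => //; apply: divr_ge0 => //; exact: exprn_ge0.
Qed.

Let cov H1 H2 := E (fun g => SW p H1 g * SW p H2 g) - E (SW p H1) * E (SW p H2).

(** 17 = 1 + 2^4: the main term (p (1 - p))^k is at most p^k, and the error is at most (2p)^k
    because 2 d theta <= 1. *)
Let cov_same H : P H -> cov H H <= same_bound.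
Proof.
move=> PH; case: (cP PH) => Hp Hk _ _ _; have [_ kk] := andP k4.
apply: (@le_trans _ _ (E (fun g => SW p H g * SW p H g))).
  by rewrite gerBl mulr_ge0// SW_expect_ge0.
have H8 : (#|(H :|: H)%SET| <= 8)%N by rewrite finset.setUid Hk (leq_trans kk).
have := SWM_expect_mix d0 tau34 A_ge dtheta pE p_half Hp Hp H8.
rewrite mix_prod_id finset.setUid Hk => /(le_trans (ler_norm _)).
rewrite lerBlDr => /le_trans; apply.
have pk0 : 0 <= p ^+ k by apply: exprn_ge0; exact: ltW.
have h1 : (p * (1 - p)) ^+ k <= p ^+ k.
  rewrite exprMn ler_piMr//; apply: exprn_ile1; first by rewrite subr_ge0.
  by rewrite gerBl ltW.
have h2 : (2 * p) ^+ k <= 16%:R * p ^+ k.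
  rewrite exprMn ler_wpM2r// -natrX ler_nat.
  by apply: (@leq_trans (2 ^ 4)) => //; rewrite leq_exp2l.
have h3 : 2 * (d%:R * theta) * (2 * p) ^+ k <= 16%:R * p ^+ k.
  apply: le_trans h2; rewrite ler_piMl//.
    by apply: exprn_ge0; rewrite mulr_ge0// ltW.
  by rewrite mulrC -ler_pdivlMr// mul1r.
apply: le_trans (lerD h3 h1) _.
by rewrite -[X in _ + X <= _]mul1r -mulrDl natr1.
Qed.

(** The main term vanishes by orthogonality, and the error carries p to the number of edges of the
    union, at least 2k - v. *)
Let cov_share H1 H2 : P H1 -> P H2 -> H1 != H2 ->
  (2 <= #|(cover H1 :&: cover H2)%SET|)%N ->
  cov H1 H2 <= share_bound #|(cover H1 :&: cover H2)%SET|.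
Proof.
move=> P1 P2 H12 v2; case: (cP P1) => H1p H1k _ _ _; case: (cP P2) => H2p H2k _ _ _.
have [_ kk] := andP k4.
have I_le := card_edges_cap_le H1p H1k kk v2.
have Uc : #|(H1 :|: H2)%SET| = (k + k - #|(H1 :&: H2)%SET|)%N by rewrite finset.cardsU H1k H2k.
have U8 : (#|(H1 :|: H2)%SET| <= 8)%N by rewrite Uc (leq_trans (leq_subr _ _))// (leq_add kk kk).
apply: (@le_trans _ _ (E (fun g => SW p H1 g * SW p H2 g))).
  by rewrite gerBl mulr_ge0// SW_expect_ge0.
have := SWM_expect_mix d0 tau34 A_ge dtheta pE p_half H1p H2p U8.
rewrite mix_prod0// subr0 => /(le_trans (ler_norm _)) /le_trans; apply.
rewrite /share_bound; apply: ler_wpM2l; first exact: mulr_ge0.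
rewrite exprMn; apply: ler_pM; rewrite ?exprn_ge0 ?(ltW p0)//.
  by apply: ler_weXn2l; rewrite // ler1n.
apply: ler_wiXn2l => //; first exact: ltW.
have Ik : (#|(H1 :&: H2)%SET| <= k)%N.
  by rewrite -H1k; apply: subset_leq_card; exact: finset.subsetIl.
rewrite Uc; move: I_le Ik.
move: #|(H1 :&: H2)%SET| #|(cover H1 :&: cover H2)%SET| => i v; clear; lia.
Qed.

(** The cases are merged by indicators, so that summation over all pairs turns into counting. *)
Let cov_bound H1 H2 : P H1 -> P H2 -> cov H1 H2 <=
  share1_bound * (#|(cover H1 :&: cover H2)%SET| == 1%N)%:R + same_bound * (H1 == H2)%:R +
  \sum_(2 <= v < k.+1) share_bound v * (#|(cover H1 :&: cover H2)%SET| == v)%:R.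
Proof.
move=> P1 P2.
have s0 : 0 <= \sum_(2 <= v < k.+1) share_bound v * (#|(cover H1 :&: cover H2)%SET| == v)%:R.
  by apply: sumr_ge0 => v _; exact: mulr_ge0.
have t0 : 0 <= share1_bound * (#|(cover H1 :&: cover H2)%SET| == 1%N)%:R by exact: mulr_ge0.
have u0 : 0 <= same_bound * (H1 == H2)%:R by exact: mulr_ge0.
have [H12|H12] := eqVneq H1 H2.
  rewrite -H12 in s0 t0 *; rewrite mulr1 (le_trans (cov_same P1))//.
  by rewrite addrAC lerDr addr_ge0.
rewrite mulr0 addr0.
have [v2|] := leqP 2 #|(cover H1 :&: cover H2)%SET|.
  apply: (le_trans (cov_share P1 P2 H12 v2)).
  apply: (@le_trans _ _ (\sum_(2 <= v < k.+1)
    share_bound v * (#|(cover H1 :&: cover H2)%SET| == v)%:R)); last by rewrite lerDr.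
  have vk : (#|(cover H1 :&: cover H2)%SET| < k.+1)%N.
    case: (cP P1) => _ _ <- _ _; rewrite ltnS; apply: subset_leq_card; exact: finset.subsetIl.
  rewrite (big_cat_nat v2 (ltnW vk))/= addrC big_ltn//= eqxx mulr1 -addrA lerDl.
  by apply: addr_ge0; apply: sumr_ge0 => v _; exact: mulr_ge0.
rewrite ltnS leq_eqVlt => /predU1P[v1|].
  rewrite v1 in s0 *; rewrite eqxx mulr1; apply: (@le_trans _ _ share1_bound); last first.
    by rewrite lerDl.
  by apply: (SW_cov_share1 d0 tau34 A_ge dtheta pE k4 (cP P1) (cP P2)); rewrite v1.
rewrite ltnS leqn0 finset.cards_eq0 => /eqP v0.
apply: (@le_trans _ _ 0); last exact: addr_ge0.
apply: (SW_cov_disjoint d0 tau34 A_ge dtheta pE _ (cP P1) (cP P2) v0).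
by rewrite k0; case/andP: k4.
Qed.

Lemma RGG_varE : RGG_var d tau (fun g => \sum_(H | P H) SW p H g) =
  \sum_(H1 | P H1) \sum_(H2 | P H2) cov H1 H2.
Proof.
rewrite /RGG_var /cov.
rewrite (_ : (fun g => _) = fun g => \sum_(H1 | P H1) \sum_(H2 | P H2) SW p H1 g * SW p H2 g);
  last by apply/funext => g; rewrite expr2 big_distrlr.
rewrite !RGG_expect_sum// expr2 big_distrlr -sumrB; apply: eq_bigr => H1 _.
by rewrite RGG_expect_sum// -sumrB.
Qed.

Lemma RGG_var_le : RGG_var d tau (fun g => \sum_(H | P H) SW p H g) <=
  (pair_const k)%:R * (n%:R ^+ (k + (k - 1)) * (d%:R * (2 ^+ 8 * l ^+ 4) * 4%:R * p ^+ (k + k))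
    + n%:R ^+ k * (17%:R * p ^+ k)
    + \sum_(2 <= v < k.+1) n%:R ^+ (k + (k - v)) *
        (2 * (d%:R * theta) * (2 ^+ 8 * p ^+ (k + (k - v))))).
Proof.
have cover_k H : P H -> #|cover H| = k by move=> /cP[].
rewrite RGG_varE.
apply: (@le_trans _ _ (\sum_(H1 | P H1) \sum_(H2 | P H2)
  (share1_bound * (#|(cover H1 :&: cover H2)%SET| == 1%N)%:R + same_bound * (H1 == H2)%:R +
  \sum_(2 <= v < k.+1) share_bound v * (#|(cover H1 :&: cover H2)%SET| == v)%:R))).
  by apply: ler_sum => H1 P1; apply: ler_sum => H2 P2; exact: cov_bound.
under eq_bigr do rewrite !big_split -!mulr_sumr/=.
rewrite !big_split -!mulr_sumr/= 2!(mulrDr (pair_const k)%:R).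
have cnt v : \sum_(H1 | P H1) \sum_(H2 | P H2) (#|(cover H1 :&: cover H2)%SET| == v)%:R <=
    (pair_const k)%:R * n%:R ^+ (k + (k - v)) :> R.
  rewrite -natrX -natrM; under eq_bigr do rewrite -natr_sum.
  by rewrite -natr_sum ler_nat; exact: count_pairs.
apply: lerD; [apply: lerD|].
- by rewrite [leRHS](mulrA (pair_const k)%:R) [leRHS]mulrC; apply: ler_wpM2l => //; exact: cnt.
- rewrite [leRHS](mulrA (pair_const k)%:R) [leRHS]mulrC; apply: ler_wpM2l => //.
  rewrite -natrX -natrM; under eq_bigr do rewrite -natr_sum.
  by rewrite -natr_sum ler_nat; exact: count_diag.
- under eq_bigr do rewrite exchange_big/=.
  rewrite exchange_big/= mulr_sumr; apply: ler_sum => v _.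
  under eq_bigr do rewrite -mulr_sumr.
  by rewrite -mulr_sumr [leRHS](mulrA (pair_const k)%:R) [leRHS]mulrC;
    apply: ler_wpM2l => //; exact: cnt.
Qed.

End rgg_variance.

(** * Variance of the signed count under G(n, p) *)

Section erdos_renyi.
Variables (R : realType) (n : nat) (p : R).
Implicit Types (H U g : {set {set 'I_n}}) (F : {set {set 'I_n}} -> R).

Lemma ER_expect_sum (I : Type) (r : seq I) (P : pred I) (F : I -> {set {set 'I_n}} -> R) :
  ER_expect p (fun g => \sum_(i <- r | P i) F i g) = \sum_(i <- r | P i) ER_expect p (F i).
Proof.
rewrite /ER_expect exchange_big/=; apply: eq_bigr => g _.
by rewrite mulr_sumr.
Qed.

Lemma ER_expect_mix U (al be : {set 'I_n} -> R) : U \subset pairs n ->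
  ER_expect p (fun g => \prod_(e in U) (al e * (e \in g)%:R + be e)) =
  \prod_(e in U) (al e * p + be e).
Proof.
move=> Up; rewrite /ER_expect.
(* a and b are the contributions of an edge when present and when absent; expanding the product of a
   + b over subsets of [pairs n] gives the sum over graphs. *)
pose a e := p * (if e \in U then al e + be e else 1).
pose b e := (1 - p) * (if e \in U then be e else 1).
transitivity (\prod_(e in pairs n) (a e + b e)); last first.
  rewrite (big_setID U)/= (finset.setIidPr Up) [X in _ * X]big1 ?mulr1.
    by apply: eq_bigr => e eU; rewrite /a /b eU; ring.
  by move=> e; rewrite inE /a /b => /andP[/negbTE -> _]; ring.
rewrite prodrD_subset; apply: eq_big => [g|g]; first by rewrite powersetE.
rewrite powersetE => gp.
rewrite [X in _ * X](_ : _ = \prod_(e in pairs n)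
   (if e \in U then al e * (e \in g)%:R + be e else 1)); last first.
  rewrite [RHS](big_setID U)/= (finset.setIidPr Up) [X in _ = _ * X]big1 ?mulr1.
    by apply: eq_bigr => e ->.
  by move=> e; rewrite inE => /andP[/negbTE -> _].
rewrite -big_split/= (big_setID g)/= (finset.setIidPr gp); congr (_ * _).
  by apply: eq_bigr => e eg; rewrite /a eg mulr1.
apply: eq_bigr => e; rewrite inE => /andP[/negbTE -> _].
by rewrite /b mulr0 add0r.
Qed.

Variables (k : nat) (P : pred {set {set 'I_n}}).
Hypothesis k0 : (0 < k)%N.
Hypothesis Pp : forall H, P H -> H \subset pairs n.
Hypothesis Pk : forall H, P H -> #|H| = k.

Lemma ER_SW H : P H -> ER_expect p (SW p H) = 0.
Proof.
move=> PH; rewrite (_ : SW p H = fun g => \prod_(e in H) (1 * (e \in g)%:R + (- p))); last first.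
  by apply/funext => g; apply: eq_bigr => e _; rewrite mul1r.
rewrite (ER_expect_mix (fun=> 1) (fun=> - p)) ?Pp// mul1r subrr prodr_const Pk// expr0n.
by case: (k) k0.
Qed.

Lemma ER_SWM H1 H2 : P H1 -> P H2 ->
  ER_expect p (fun g => SW p H1 g * SW p H2 g) = (p * (1 - p)) ^+ k * (H1 == H2)%:R.
Proof.
move=> P1 P2; rewrite (_ : (fun g => _) = fun g => \prod_(e in (H1 :|: H2)%SET)
   (mix_lin p H1 H2 e * (e \in g)%:R + mix_cst p H1 H2 e)); last first.
  by apply/funext => g; exact: SWM.
rewrite ER_expect_mix; last by rewrite finset.subUset !Pp.
have [->|H12] := eqVneq H1 H2; first by rewrite mix_prod_id Pk// mulr1.
by rewrite mix_prod0// mulr0.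
Qed.

Lemma ER_varE : ER_var p (fun g => \sum_(H | P H) SW p H g) =
  (\sum_(H | P H) 1)%N%:R * (p * (1 - p)) ^+ k.
Proof.
rewrite /ER_var (ER_expect_sum _ _ (fun H g => SW p H g)).
rewrite [X in X ^+ 2]big1 => [|H PH]; last exact: ER_SW.
rewrite expr0n subr0.
rewrite (_ : (fun g => _) = fun g => \sum_(H1 | P H1) \sum_(H2 | P H2) SW p H1 g * SW p H2 g);
  last by apply/funext => g; rewrite expr2 big_distrlr.
rewrite ER_expect_sum natr_sum mulr_suml; apply: eq_bigr => H1 P1.
rewrite ER_expect_sum mul1r (bigD1 H1)//= ER_SWM// eqxx mulr1 big1 ?addr0// => H2 /andP[P2].
by rewrite eq_sym ER_SWM// => /negbTE ->; rewrite mulr0.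
Qed.

End erdos_renyi.

(** * Signal against noise *)

Section real_inequalities.
Variable R : rcfType.
Implicit Types (x y z : R).

(* In the application X = (np)^k, q = d l^3, w = d l^4 / n and y = (np)^2. *)
Lemma success_real (M D c X q w y C1 C2 C3 e V EX : R) :
  0 <= M -> 0 <= D -> 0 < c -> 0 <= X -> 0 <= q -> 0 < y -> 0 <= e ->
  3%:R * (M ^+ 2 * D * c ^+ 2 * e) <= 1 ->
  C1 <= e * (X * q ^+ 2) -> C2 * w <= e * q ^+ 2 -> C3 <= e * (y * q) ->
  V <= D * (C1 * X + C2 * w * X ^+ 2 + C3 * q * (X ^+ 2 / y)) ->
  X * q / c <= EX -> M * Num.sqrt V <= EX.
Proof.
move=> M0 D0 c0 X0 q0 y0 e0 he h1 h2 h3 hV hE.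
have E0 : 0 <= EX by apply: le_trans hE; rewrite divr_ge0 ?mulr_ge0// ltW.
have -> : M * Num.sqrt V = Num.sqrt (M ^+ 2 * V).
  by rewrite sqrtrM ?sqr_ge0// sqrtr_sqr ger0_norm.
rewrite -[leRHS](ger0_norm E0) -sqrtr_sqr ler_wsqrtr//.
apply: (@le_trans _ _ ((X * q / c) ^+ 2)); last first.
  by apply: lerXn2r => //; rewrite nnegrE// divr_ge0 ?mulr_ge0// ltW.
(* Each of the three variance terms is at most e X^2 q^2, and e is small enough for three of them
   against the squared mean (X q / c)^2. *)
have t1 : C1 * X <= e * (X ^+ 2 * q ^+ 2).
  apply: le_trans (ler_wpM2r X0 h1) _; by rewrite le_eqVlt; apply/orP; left; apply/eqP; ring.
have t2 : C2 * w * X ^+ 2 <= e * (X ^+ 2 * q ^+ 2).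
  apply: le_trans (ler_wpM2r (sqr_ge0 X) h2) _.
  by rewrite le_eqVlt; apply/orP; left; apply/eqP; ring.
have t3 : C3 * q * (X ^+ 2 / y) <= e * (X ^+ 2 * q ^+ 2).
  rewrite -mulrA; have : 0 <= q * (X ^+ 2 / y) by rewrite mulr_ge0// divr_ge0 ?sqr_ge0// ltW.
  move=> /ler_wpM2r /(_ _ _ h3) /le_trans; apply.
  by rewrite le_eqVlt; apply/orP; left; apply/eqP; field; rewrite gt_eqF.
have hS : V <= D * (3%:R * (e * (X ^+ 2 * q ^+ 2))).
  apply: le_trans hV _; apply: ler_wpM2l => //.
  by move: t1 t2 t3; move: (C1 * X) (C2 * _ * _) (C3 * _ * _) (e * _) => a b f g; lra.
apply: le_trans (ler_wpM2l (sqr_ge0 M) hS) _.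
rewrite expr_div_n exprMn ler_pdivlMr ?exprn_gt0//.
have -> : M ^+ 2 * (D * (3%:R * (e * (X ^+ 2 * q ^+ 2)))) * c ^+ 2 =
  3%:R * (M ^+ 2 * D * c ^+ 2 * e) * (X ^+ 2 * q ^+ 2) by ring.
by rewrite ler_piMl// mulr_ge0 ?sqr_ge0.
Qed.

(** In the application N is the number of copies, P = p^k and B = 2 A d l^3; 16 comes from (1 - p)^k
    >= 2^-4. *)
Lemma failure_real (eta N P B V EX : R) : 0 <= eta -> 0 <= N -> 0 <= P -> 0 <= EX ->
  EX <= N * B * P -> N * P / 16%:R <= V -> 16%:R * (N * P) * B ^+ 2 <= eta ^+ 2 ->
  EX <= eta * Num.sqrt V.
Proof.
move=> e0 N0 P0 E0 hE hV hB.
have NP : 0 <= N * P by exact: mulr_ge0.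
have V0 : 0 <= V by apply: le_trans hV; exact: divr_ge0.
have -> : eta * Num.sqrt V = Num.sqrt (eta ^+ 2 * V).
  by rewrite sqrtrM ?sqr_ge0// sqrtr_sqr ger0_norm.
rewrite -[leLHS](ger0_norm E0) -sqrtr_sqr ler_wsqrtr//.
apply: (@le_trans _ _ ((N * B * P) ^+ 2)).
  by apply: lerXn2r => //; rewrite nnegrE// (le_trans E0).
apply: (@le_trans _ _ (eta ^+ 2 * (N * P / 16%:R))); last first.
  by apply: ler_wpM2l => //; exact: sqr_ge0.
have -> : (N * B * P) ^+ 2 = 16%:R * (N * P) * B ^+ 2 * (N * P / 16%:R) by field.
by apply: ler_wpM2r => //; exact: divr_ge0.
Qed.

Lemma ler_add_split (y f a b : R) : a <= b -> y + (f + 17%:R * y + a) <= 18%:R * y + f + b.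
Proof. by lra. Qed.

End real_inequalities.

(** * Signed counts for a fixed number of vertices *)

Section fixed_size.
Variables (R : realType) (n d : nat) (tau : R).
Hypothesis d0 : (0 < d)%N.
Hypothesis tau34 : 3%:R / 4%:R <= tau <= 1.
Local Notation l := (1 - tau).
Let tau01 : 0 <= tau <= 1. Proof. by move: tau34; lra. Qed.
Let tau0 : 0 < tau. Proof. by move: tau34; lra. Qed.
Let l0 : 0 <= l. Proof. by move: tau34; lra. Qed.
Variables A p : R.
Hypothesis A_ge : 4%:R ^+ 8 <= A.
Local Notation theta := (A * l ^+ 3).
Hypothesis dtheta : d%:R * theta <= 2^-1.
Hypothesis pE : p = tau ^+ d.
Hypothesis p_half : p <= 2^-1.
Variable k : nat.
Hypothesis k34 : k \in [:: 3; 4].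
Local Notation E := (RGG_expect d tau).
Local Notation SCk := (SC p (cycle_graph k) : {set {set 'I_n}} -> R).
Local Notation copy := (fun H : {set {set 'I_n}} => `[< iso_copy (cycle_graph k) H >]).
Local Notation x := (n%:R * p).

Let p0 : 0 < p. Proof. by rewrite pE exprn_gt0. Qed.
Let A0 : 0 <= A. Proof. by apply: le_trans A_ge; exact: exprn_ge0. Qed.
Let theta0 : 0 <= theta. Proof. by apply: mulr_ge0 => //; exact: exprn_ge0. Qed.
Let k4 : (2 < k <= 4)%N. Proof. by move: k34; rewrite !inE => /orP[]/eqP->. Qed.
Let k0 : (0 < k)%N. Proof. by move: k34; rewrite !inE => /orP[]/eqP->. Qed.
Let k8 : (0 < k <= 8)%N. Proof. by move: k34; rewrite !inE => /orP[]/eqP->. Qed.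

Lemma copy_cycle_like H : copy H -> cycle_like d tau k H.
Proof.
move=> /asboolP; move: k34; rewrite !inE => /orP[]/eqP->.
  exact: cycle_like3.
exact: cycle_like4.
Qed.

Let ncopies : nat := \sum_(H | copy H) 1.

Lemma ncopies_le : (ncopies%:R : R) <= (pair_const k)%:R * n%:R ^+ k.
Proof.
rewrite -natrX -natrM ler_nat; apply: leq_trans (count_copies (k := k) _) _.
  by move=> H /copy_cycle_like[].
rewrite /pair_const mulnC leq_mul2r; apply/orP; right.
by rewrite leq_pmulr// muln_gt0 !expn_gt0.
Qed.

Lemma ncopies_ge : (2 * k <= n)%N -> n%:R ^+ k <= (2 ^ k * k`!)%:R * (ncopies%:R : R).
Proof.
move=> kn; rewrite -natrX -natrM ler_nat; apply: (leq_trans (expn_le_bin kn)).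
rewrite leq_mul2l; apply/orP; right; apply: leq_trans (card_copies_ge n k) _.
by rewrite -sum1_card /ncopies leq_eqVlt;
  apply/orP; left; apply/eqP; apply: eq_bigl => H; rewrite inE.
Qed.

Lemma SC_expectE : E SCk = \sum_(H | copy H) E (SW p H).
Proof. exact: (RGG_expect_sum d tau01 _ _ (fun H g => SW p H g)). Qed.

Lemma SC_expect_ge : (2 * k <= n)%N ->
  x ^+ k * (d%:R * l ^+ 3) / (4%:R * (2 ^ k * k`!)%:R) <= E SCk.
Proof.
move=> kn; have F0 : 0 < (2 ^ k * k`!)%:R :> R by rewrite ltr0n muln_gt0 expn_gt0 fact_gt0.
apply: (@le_trans _ _ (ncopies%:R * (p ^+ k * (d%:R * (l ^+ 3 / 4%:R))))); last first.
  rewrite SC_expectE /ncopies natr_sum mulr_suml; apply: ler_sum => H /copy_cycle_like cH.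
  by rewrite mul1r; exact: (SW_expect_ge d0 tau34 pE k0 cH).
rewrite ler_pdivrMr; last exact: mulr_gt0.
have q0 : 0 <= p ^+ k * (d%:R * l ^+ 3).
  by apply: mulr_ge0; [apply: exprn_ge0; exact: ltW|apply: mulr_ge0 => //; exact: exprn_ge0].
have := ler_wpM2r q0 (ncopies_ge kn); rewrite exprMn.
move: (n%:R ^+ k) (p ^+ k) (l ^+ 3) (2 ^ k * k`!)%:R (ncopies%:R) (d%:R) => a b f g h i.
have -> : h * (b * (i * (f / 4%:R))) * (4%:R * g) = g * h * (b * (i * f)).
  by field; rewrite ?pnatr_eq0.
by rewrite !mulrA.
Qed.

Lemma SC_expect_ge0 : 0 <= E SCk.
Proof.
rewrite SC_expectE; apply: sumr_ge0 => H cH.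
exact: (SW_expect_ge0 d0 tau34 pE k4 copy_cycle_like cH).
Qed.

Lemma SC_expect_le : E SCk <= ncopies%:R * (2 * (A * (d%:R * l ^+ 3))) * p ^+ k.
Proof.
rewrite SC_expectE /ncopies natr_sum -mulrA mulr_suml; apply: ler_sum => H /copy_cycle_like cH.
rewrite mul1r; apply: le_trans (SW_expect_le d0 tau34 A_ge dtheta pE k8 cH) _.
by rewrite (mulrCA d%:R).
Qed.

Lemma SC_ER_var : ER_var p SCk = ncopies%:R * (p * (1 - p)) ^+ k.
Proof.
apply: (ER_varE p k0) => H /copy_cycle_like[] //.
Qed.

Lemma SC_ER_var_ge : ncopies%:R * p ^+ k / 16%:R <= ER_var p SCk.
Proof.
rewrite SC_ER_var exprMn -mulrA; apply: ler_wpM2l => //; apply: ler_wpM2l.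
  by apply: exprn_ge0; exact: ltW.
apply: (@le_trans _ _ ((2^-1) ^+ k)).
  rewrite exprVn lef_pV2 ?posrE ?exprn_gt0// -natrX ler_nat.
  by move: k34; rewrite !inE => /orP[]/eqP->.
apply: lerXn2r; rewrite ?nnegrE//.
  by rewrite subr_ge0 (le_trans p_half)// invf_ple ?posrE// invr1 ler1n.
by move: p_half; lra.
Qed.

(** The 18 adds the Erdos-Renyi variance to the diagonal 17. For pairs with v >= 2 common vertices,
    np >= 1 lets v = 2 dominate. *)
Lemma SC_total_var_le : (0 < n)%N -> 1 <= x -> ER_var p SCk + RGG_var d tau SCk <=
  (pair_const k)%:R * (18%:R * x ^+ k + 2 ^+ 8 * 4%:R * (d%:R * l ^+ 4 / n%:R) * (x ^+ k) ^+ 2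
    + k%:R * (2 * 2 ^+ 8 * A) * (d%:R * l ^+ 3) * ((x ^+ k) ^+ 2 / x ^+ 2)).
Proof.
move=> n0 x1; have nn0 : n%:R != 0 :> R by rewrite pnatr_eq0 -lt0n.
have x0 : x != 0 by rewrite gt_eqF// (lt_le_trans _ x1).
have hE : ER_var p SCk <= (pair_const k)%:R * x ^+ k.
  rewrite SC_ER_var (exprMn _ n%:R) mulrA; apply: ler_pM => //.
  - apply: exprn_ge0; apply: mulr_ge0; first exact: ltW.
    by rewrite subr_ge0 (le_trans p_half)// invf_ple ?posrE// invr1 ler1n.
  - exact: ncopies_le.
  apply: lerXn2r; rewrite ?nnegrE ?(ltW p0)//.
    apply: mulr_ge0; first exact: ltW.
    by rewrite subr_ge0 (le_trans p_half)// invf_ple ?posrE// invr1 ler1n.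
  by rewrite ler_piMr ?(ltW p0)// gerBl ltW.
have hR := RGG_var_le d0 tau34 A_ge dtheta pE p_half k4 copy_cycle_like.
apply: le_trans (lerD hE hR) _; rewrite -mulrDr; apply: ler_wpM2l => //.
have t1 : n%:R ^+ (k + (k - 1)) * (d%:R * (2 ^+ 8 * l ^+ 4) * 4%:R * p ^+ (k + k)) =
   2 ^+ 8 * 4%:R * (d%:R * l ^+ 4 / n%:R) * (x ^+ k) ^+ 2.
  have -> : (x ^+ k) ^+ 2 = n%:R * n%:R ^+ (k + (k - 1)) * p ^+ (k + k).
    by rewrite -exprS -addnS subn1 prednK// -exprM muln2 -addnn exprMn.
  move: (2 ^+ 8) (l ^+ 4) (p ^+ _) (n%:R ^+ _) (d%:R) => a b f g h.
  by field; rewrite nn0.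
have t2 : n%:R ^+ k * (17%:R * p ^+ k) = 17%:R * x ^+ k by rewrite mulrCA exprMn.
have t3 : \sum_(2 <= v < k.+1) n%:R ^+ (k + (k - v)) *
        (2 * (d%:R * theta) * (2 ^+ 8 * p ^+ (k + (k - v)))) <=
   k%:R * (2 * 2 ^+ 8 * A) * (d%:R * l ^+ 3) * ((x ^+ k) ^+ 2 / x ^+ 2).
  have -> : (x ^+ k) ^+ 2 / x ^+ 2 = x ^+ (k + (k - 2)).
    have k2 : (2 <= k)%N by case/andP: k4 => /ltnW.
    rewrite -exprM muln2 -addnn -expfB_cond; last by rewrite (negbTE x0) (leq_trans k2)// leq_addr.
    by rewrite -addnBA.
  pose y : R := \sum_(2 <= v < k.+1) (2 * 2 ^+ 8 * A) * (d%:R * l ^+ 3) * x ^+ (k + (k - 2)).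
  apply: (@le_trans _ _ y).
    rewrite /y !big_nat; apply: ler_sum => v /andP[v2 _].
    apply: (@le_trans _ _ ((2 * 2 ^+ 8 * A) * (d%:R * l ^+ 3) * x ^+ (k + (k - v)))).
      rewrite exprMn; move: (2 ^+ 8) (l ^+ 3) (p ^+ _) (n%:R ^+ _) (d%:R) => a b f g h.
      by rewrite le_eqVlt; apply/orP; left; apply/eqP; ring.
    apply: ler_wpM2l.
      apply: mulr_ge0; last by apply: mulr_ge0 => //; exact: exprn_ge0.
      by apply: mulr_ge0 => //; apply: mulr_ge0 => //; exact: exprn_ge0.
    by apply: ler_weXn2l => //; rewrite leq_add2l leq_sub2l.
  rewrite /y sumr_const_nat -[leLHS]mulr_natl.
  rewrite [leRHS](_ : _ = k%:R * (2 * 2 ^+ 8 * A * (d%:R * l ^+ 3) * x ^+ (k + (k - 2))));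
    last by rewrite !mulrA.
  apply: ler_wpM2r; last by rewrite ler_nat subSS leq_subr.
  have X0 : 0 <= x ^+ (k + (k - 2)) by apply: exprn_ge0; apply: le_trans x1.
  apply: mulr_ge0 => //; apply: mulr_ge0; last by apply: mulr_ge0 => //; exact: exprn_ge0.
  by apply: mulr_ge0 => //; apply: mulr_ge0 => //; exact: exprn_ge0.
rewrite t1 t2; apply: (@ler_add_split _ (x ^+ k)); exact: t3.
Qed.

End fixed_size.

(** * Elementary asymptotics *)

Definition for_large (Q : nat -> Prop) := exists N, forall n, (N <= n)%N -> Q n.

Lemma for_large_and Q1 Q2 : for_large Q1 -> for_large Q2 -> for_large (fun n => Q1 n /\ Q2 n).
Proof.
move=> [N1 h1] [N2 h2]; exists (maxn N1 N2) => n; rewrite geq_max => /andP[n1 n2].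
by split; [exact: h1|exact: h2].
Qed.

Lemma for_large_imp (Q1 Q2 : nat -> Prop) :
  (forall n, Q1 n -> Q2 n) -> for_large Q1 -> for_large Q2.
Proof. by move=> h [N hN]; exists N => n /hN/h. Qed.

Section elementary.
Variable R : realType.
Implicit Types (x y z : R).

Lemma for_large_nat_ge (B : R) : for_large (fun n => B <= n%:R).
Proof.
exists (Num.bound `|B|) => n hn; apply: (le_trans (ler_norm B)).
apply: (le_trans (ltW (archi_boundP (normr_ge0 B)))); by rewrite ler_nat.
Qed.

Lemma for_large_powR_ge (a B : R) : 0 < a -> for_large (fun n => B <= n%:R `^ a).
Proof.
move=> a0; apply: for_large_imp (for_large_nat_ge (`|B| `^ a^-1)) => n hn.
apply: (le_trans (ler_norm B)).
have -> : `|B| = (`|B| `^ a^-1) `^ a by rewrite -powRrM mulVf ?gt_eqF// powRr1.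
by apply: ge0_ler_powR; rewrite ?nnegrE ?powR_ge0// ltW.
Qed.

Lemma for_large_ln_ge1 : for_large (fun n => 1 <= ln (n%:R : R)).
Proof.
apply: for_large_imp (for_large_nat_ge (expR 1)) => n hn.
have n0 : 0 < n%:R :> R by apply: lt_le_trans hn; exact: expR_gt0.
by rewrite -ler_expR lnK ?posrE.
Qed.

(** The inequality ln y <= y - 1 at y = x^a. *)
Lemma ln_le_powR (a x : R) : 0 < a -> 0 < x -> ln x <= a^-1 * x `^ a.
Proof.
move=> a0 x0; rewrite mulrC ler_pdivlMr// mulrC -ln_powR.
have s0 : 0 < x `^ a by exact: powR_gt0.
have := @le_ln1Dx R (x `^ a - 1); rewrite ltrBDl subrr subrKC => /(_ s0) /le_trans; apply.
by rewrite gerBl.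
Qed.

(* The conditions of [success_real], from d l >= 1/2 and K d <= np, where y = (np)^2. *)
Lemma success_conditions (dd l nn X y K e C1 C2 C3 : R) :
  0 < dd -> 0 <= l -> 0 < nn -> 0 <= e -> 2^-1 <= dd * l ->
  64%:R * C1 <= e * K -> 4%:R * C2 <= e * K -> 8%:R * C3 <= e * K -> 0 <= K ->
  K * dd ^+ 4 <= X -> K * dd <= nn -> K * dd ^+ 2 <= y ->
  [/\ C1 <= e * (X * (dd * l ^+ 3) ^+ 2),
      C2 * (dd * l ^+ 4 / nn) <= e * (dd * l ^+ 3) ^+ 2 &
      C3 <= e * (y * (dd * l ^+ 3))].
Proof.
move=> d0 l0 n0 e0; set t := dd * l => t2 h1 h2 h3 K0 hX hn hy.
have t0 : 0 <= t by apply: le_trans t2; rewrite invr_ge0.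
have eK : 0 <= e * K by exact: mulr_ge0.
have tp m : (2^-1) ^+ m <= t ^+ m by apply: lerXn2r; rewrite ?nnegrE.
(* Since t >= 1/2, a power t^m costs 2^m; m = 6, 2, 3 account for the factors 64, 4, 8. *)
have pw m C : 2 ^+ m * C <= e * K -> C <= e * K * t ^+ m.
  move=> h; apply: (@le_trans _ _ (e * K * (2^-1) ^+ m)); last exact: ler_wpM2l.
  by rewrite exprVn ler_pdivlMr ?exprn_gt0// mulrC.
split.
- apply: (@le_trans _ _ (e * K * t ^+ 6)); first by apply: pw; rewrite (_ : 2 ^+ 6 = 64%:R)//; ring.
  have -> : e * K * t ^+ 6 = e * (K * dd ^+ 4 * (dd * l ^+ 3) ^+ 2) by rewrite /t; ring.
  by apply: ler_wpM2l => //; apply: ler_wpM2r => //; exact: sqr_ge0.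
- have w0 : 0 <= dd * l ^+ 4 / nn by rewrite divr_ge0 ?mulr_ge0 ?exprn_ge0// ltW.
  apply: (@le_trans _ _ (e * K * t ^+ 2 * (dd * l ^+ 4 / nn))).
    by apply: ler_wpM2r => //; apply: pw; rewrite (_ : 2 ^+ 2 = 4%:R)//; ring.
  have -> : e * K * t ^+ 2 * (dd * l ^+ 4 / nn) = (K * dd / nn) * (e * (dd * l ^+ 3) ^+ 2).
    by rewrite /t; ring.
  apply: ler_piMl; first by apply: mulr_ge0 => //; exact: sqr_ge0.
  by rewrite ler_pdivrMr// mul1r.
- apply: (@le_trans _ _ (e * K * t ^+ 3)); first by apply: pw; rewrite (_ : 2 ^+ 3 = 8%:R)//; ring.
  have -> : e * K * t ^+ 3 = e * (K * dd ^+ 2 * (dd * l ^+ 3)) by rewrite /t; ring.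
  apply: ler_wpM2l => //; apply: ler_wpM2r => //.
  by apply: mulr_ge0; [exact: ltW|exact: exprn_ge0].
Qed.

Lemma half_le_of_sub (u : R) : 1 - u <= 2^-1 -> 2^-1 <= u.
Proof. by lra. Qed.

Lemma itv34_of_sub (u : R) : 1 - u <= 4%:R^-1 -> 0 <= 1 - u -> 3%:R / 4%:R <= u <= 1.
Proof. by lra. Qed.

Lemma cancel_scale (a c s : R) : 0 < s -> a * (c * s * (c / s * (c / s))) = a * c ^+ 3 / s.
Proof. by move=> s0; field; rewrite gt_eqF. Qed.

End elementary.

(** * Thresholds for the two tests *)

Section asymptotics.
Variables (R : realType) (delta eps : R).
Hypothesis delta0 : 0 < delta.
Hypothesis eps0 : 0 < eps.
Variables (p : nat -> R) (d : nat -> nat) (tau : nat -> R).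
Hypothesis hA : assumption_A delta eps p d tau.
Variable A : R.
Hypothesis A_ge : 4%:R ^+ 8 <= A.
Local Notation l n := (1 - tau n).
Local Notation x n := (n%:R * p n).

Definition regular_at n := [/\ [/\ (0 < d n)%N, 3%:R / 4%:R <= tau n <= 1,
   (d n)%:R * (A * (l n) ^+ 3) <= 2^-1, p n = tau n ^+ d n & p n <= 2^-1],
   [/\ 2^-1 <= (d n)%:R * l n, (d n)%:R * l n <= ln (n%:R : R), 1 <= ln (n%:R : R) & 1 <= x n] &
   (8 <= n)%N].

Let A0 : 0 < A. Proof. by apply: lt_le_trans A_ge; exact: exprn_gt0. Qed.

(** From tau^d = p: Bernoulli's inequality and p <= 1/2 give d l >= 1/2, while 1 - l <= exp(-l) and
    p >= 1/n give d l <= ln n. *)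
Lemma regular_large : for_large regular_at.
Proof.
have dl2 : 0 < delta / 2 by exact: divr_gt0.
(* With s = n^(delta/2) one has ln n <= c s and s^2 <= d, so l <= c/s and d l^3 <= c^3/s. The
   thresholds on s below then give l <= 1/4 and d theta <= 1/2. *)
pose c := (delta / 2)^-1; have c0 : 0 < c by rewrite invr_gt0.
have h1 := for_large_powR_ge (4%:R * c) dl2.
have h2 := for_large_powR_ge (2 * (A * c ^+ 3)) dl2.
have h3 := for_large_nat_ge (8%:R : R).
have := for_large_and (for_large_and h1 h2) (for_large_and (for_large_ln_ge1 R)
  (for_large_and h3 hA)).
apply: for_large_imp => n [[s1 s2] [ln1 [n8 [hp p2 hd hcdf]]]].
have n0 : 0 < n%:R :> R by apply: lt_le_trans n8; rewrite ltr0n.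
have n1 : 1 <= n%:R :> R by apply: le_trans n8; rewrite ler1n.
have hpn : n%:R^-1 <= p n.
  apply: le_trans hp; rewrite -powR_inv1; last exact: ltW.
  by apply: ler_powR => //; rewrite lerDl ltW.
have p0 : 0 < p n by apply: lt_le_trans hpn; rewrite invr_gt0.
have p1 : p n < 1 by apply: (le_lt_trans p2); rewrite invf_plt ?posrE// invr1 ltr1n.
have d0 : (0 < d n)%N.
  by rewrite -(ltr0n R); apply: lt_le_trans hd; exact: powR_gt0.
have [t01 tp] : 0 <= tau n <= 1 /\ tau n ^+ d n = p n.
  by apply: linf_cdf_inv => //; rewrite p0.
have d0R : 0 < (d n)%:R :> R by rewrite ltr0n.
have l0 : 0 <= l n by rewrite subr_ge0; case/andP: t01.
have dl_ge : 2^-1 <= (d n)%:R * l n.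
  have ln1' : -1 <= - l n by rewrite lerN2 gerBl; case/andP: t01.
  have := bernoulli_ge (d n) ln1'; rewrite mulrN subKr tp => /le_trans /(_ p2).
  exact: half_le_of_sub.
have dl_le : (d n)%:R * l n <= ln n%:R.
  have : p n <= expR (- ((d n)%:R * l n)).
    rewrite -mulrN expRM_natl -tp; apply: lerXn2r; rewrite ?nnegrE ?expR_ge0//.
      by case/andP: t01.
    by apply: le_trans (expR_ge1Dx _); rewrite subKr.
  move=> /(le_trans hpn); rewrite -[leLHS]lnK ?posrE ?invr_gt0// ler_expR lnV ?posrE//.
  by rewrite lerN2.
pose s := n%:R `^ (delta / 2) : R; have s0 : 0 < s by exact: powR_gt0.
have sd : s ^+ 2 <= (d n)%:R.
  apply: le_trans hd; rewrite -powR_mulrn; last exact: ltW.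
  by rewrite -powRrM divfK ?pnatr_eq0.
have lns : ln n%:R <= c * s by exact: ln_le_powR.
have ls : l n <= c / s.
  have : s ^+ 2 * l n <= c * s.
    by apply: le_trans lns; apply: le_trans dl_le; exact: ler_wpM2r.
  by rewrite expr2 -mulrA mulrC ler_pM2r// mulrC -ler_pdivlMr.
have l4 : l n <= 4%:R^-1.
  apply: (le_trans ls); rewrite ler_pdivrMr// mulrC ler_pdivlMr// mulrC; exact: s1.
split=> //.
- split=> //.
  + exact: itv34_of_sub.
  + have -> : (d n)%:R * (A * l n ^+ 3) = A * ((d n)%:R * l n * (l n * l n)).
      by move: ((d n)%:R) (l n) => u v; ring.
    apply: (@le_trans _ _ (A * (c * s * (c / s * (c / s))))).
      apply: ler_wpM2l; first exact: ltW.
      apply: ler_pM => //; rewrite ?mulr_ge0//.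
        exact: le_trans lns.
      exact: ler_pM.
    have -> : A * (c * s * (c / s * (c / s))) = A * c ^+ 3 / s.
      exact: cancel_scale.
    by rewrite ler_pdivrMr// -ler_pdivrMl ?invr_gt0// invrK; exact: s2.
- by split=> //; rewrite -ler_pdivrMl// mulr1.
- by rewrite -(ler_nat R).
Qed.

Variable k : nat.
Hypothesis k34 : k \in [:: 3; 4].

Let k4 : (k <= 4)%N. Proof. by move: k34; rewrite !inE => /orP[]/eqP->. Qed.
Let pc0 : 0 < (pair_const k)%:R :> R.
Proof. by rewrite ltr0n !muln_gt0 !expn_gt0. Qed.

Lemma cycle_test_succeeds :
  (forall K, 0 < K -> for_large (fun n => K * (d n)%:R ^+ 4 <= x n ^+ k)) ->
  SC_test_succeeds (cycle_graph k) p d tau.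
Proof.
move=> hK M M0.
pose c : R := 4%:R * (2 ^ k * k`!)%:R.
have c0 : 0 < c by rewrite mulr_gt0// ltr0n muln_gt0 expn_gt0 fact_gt0.
pose D : R := (pair_const k)%:R.
pose e := (3%:R * (M ^+ 2 * D * c ^+ 2))^-1.
have m0 : 0 < M ^+ 2 * D * c ^+ 2 by rewrite !mulr_gt0// exprn_gt0.
have e0 : 0 < e by rewrite invr_gt0 mulr_gt0.
pose C2 : R := 2 ^+ 8 * 4%:R; pose C3 : R := k%:R * (2 * 2 ^+ 8 * A).
have C20 : 0 <= C2 by rewrite mulr_ge0// exprn_ge0.
have C30 : 0 <= C3 by rewrite !mulr_ge0 ?exprn_ge0// ltW.
(* K makes e K dominate the three requirements of [success_conditions]; the summand 1 ensures K >=
   1. *)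
pose K := (64%:R * 18%:R + 4%:R * C2 + 8%:R * C3) / e + 1.
have P1 : 0 <= 64%:R * 18%:R :> R by exact: mulr_ge0.
have P2 : 0 <= 4%:R * C2 by exact: mulr_ge0.
have P3 : 0 <= 8%:R * C3 by exact: mulr_ge0.
have B0 : 0 <= 64%:R * 18%:R + 4%:R * C2 + 8%:R * C3.
  by apply: addr_ge0 => //; exact: addr_ge0.
have K1 : 1 <= K by rewrite lerDr divr_ge0// ltW.
have K0 : 0 < K by apply: lt_le_trans K1.
have eK : 64%:R * 18%:R + 4%:R * C2 + 8%:R * C3 <= e * K.
  rewrite /K; set B := (_ + 8%:R * C3).
  by rewrite (mulrDr e) mulr1 mulrCA mulfV ?gt_eqF// mulr1 lerDl ltW.
(* With K^4, the hypothesis reads (K d)^4 <= (np)^k <= (np)^4, so it also yields K d <= np. *)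
have := for_large_and regular_large (hK (K ^+ 4) (exprn_gt0 4 K0)).
apply: for_large_imp => n [[[d0 t34 dth pE p2] [dl1 dl2 ln1 x1] n8] hX].
have n0 : (0 < n)%N by apply: leq_trans n8.
have nR : 0 < n%:R :> R by rewrite ltr0n.
have d0R : 0 < (d n)%:R :> R by rewrite ltr0n.
have l0 : 0 <= l n by rewrite subr_ge0; case/andP: t34.
have t0 : 0 < tau n by case/andP: t34 => + _; apply: lt_le_trans; rewrite divr_gt0.
have p0 : 0 < p n by rewrite pE exprn_gt0.
have x0 : 0 < x n by apply: lt_le_trans x1.
have KX : K * (d n)%:R ^+ 4 <= x n ^+ k.
  apply: le_trans hX; apply: ler_wpM2r; first by apply: exprn_ge0; exact: ltW.
  by rewrite -[leLHS]expr1; exact: ler_weXn2l.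
have Kd0 : 0 <= K * (d n)%:R by apply: mulr_ge0 => //; exact: ltW.
have Kx : K * (d n)%:R <= x n.
  rewrite -(@ler_pXn2r _ 4 isT) ?nnegrE ?Kd0 ?(ltW x0)//.
  by rewrite exprMn (le_trans hX)// ler_weXn2l.
have Kn : K * (d n)%:R <= n%:R.
  apply: (le_trans Kx); rewrite ler_piMr//.
  by apply: (le_trans p2); rewrite invf_ple ?posrE// invr1 ler1n.
have Ky : K * (d n)%:R ^+ 2 <= x n ^+ 2.
  apply: (@le_trans _ _ ((K * (d n)%:R) ^+ 2)).
    rewrite exprMn; apply: ler_wpM2r; first exact: sqr_ge0.
    by rewrite -[leLHS]expr1; exact: ler_weXn2l.
  by apply: lerXn2r; rewrite ?nnegrE ?Kd0 ?(ltW x0).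
have k2n : (2 * k <= n)%N by apply: leq_trans n8; rewrite (leq_mul2l 2 k 4) k4.
have b1 : 64%:R * 18%:R <= e * K by apply: le_trans eK; rewrite -addrA lerDl; exact: addr_ge0.
have b2 : 4%:R * C2 <= e * K.
  by apply: le_trans eK; rewrite addrAC lerDr; exact: addr_ge0.
have b3 : 8%:R * C3 <= e * K by apply: le_trans eK; rewrite lerDr; exact: addr_ge0.
have [c1 c2 c3] := success_conditions d0R l0 nR (ltW e0) dl1 b1 b2 b3 (ltW K0) KX Kn Ky.
have hE0 := SC_expect_ge0 n d0 t34 pE k34.
rewrite (ger0_norm hE0).
apply: (@success_real _ M D c (x n ^+ k) ((d n)%:R * l n ^+ 3) ((d n)%:R * l n ^+ 4 / n%:R)
   (x n ^+ 2) 18%:R C2 C3 e) => //.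
- exact: ltW.
- by apply: exprn_ge0; exact: ltW.
- by apply: mulr_ge0; [exact: ltW|exact: exprn_ge0].
- exact: exprn_gt0.
- exact: ltW.
- by rewrite mulrA mulfV// gt_eqF// mulr_gt0.
- exact: SC_total_var_le.
- exact: SC_expect_ge.
Qed.

Lemma cycle_test_fails :
  (forall K, 0 < K -> for_large (fun n => K * x n ^+ k * ln (n%:R) ^+ 6 <= (d n)%:R ^+ 4)) ->
  SC_test_fails (cycle_graph k) p d tau.
Proof.
move=> hK eta eta0.
pose D : R := (pair_const k)%:R.
(* 64 = 16 * 2^2, from the 16 of [failure_real] and the square of B = 2 A d l^3; D bounds the number
   of copies relative to n^k. *)
pose K := 64%:R * D * A ^+ 2 / eta ^+ 2.
have K0 : 0 < K by rewrite divr_gt0 ?exprn_gt0// !mulr_gt0// exprn_gt0.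
have := for_large_and regular_large (hK K K0).
apply: for_large_imp => n [[[d0 t34 dth pE p2] [dl1 dl2 ln1 x1] n8] hX].
have t01 : 0 <= tau n <= 1.
  by case/andP: t34 => + ->; rewrite andbT; apply: le_trans; rewrite divr_ge0.
have d0R : 0 < (d n)%:R :> R by rewrite ltr0n.
have l0 : 0 <= l n by rewrite subr_ge0; case/andP: t34.
have t0 : 0 < tau n by case/andP: t34 => + _; apply: lt_le_trans; rewrite divr_gt0.
have p0 : 0 < p n by rewrite pE exprn_gt0.
have pk0 : 0 <= p n ^+ k by apply: exprn_ge0; exact: ltW.
have hE0 := SC_expect_ge0 n d0 t34 pE k34.
rewrite (ger0_norm hE0).
have hE := SC_expect_le n d0 t34 A_ge dth pE k34.
have hV := SC_ER_var_ge n d0 t34 pE p2 k34.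
have hN := ncopies_le n d0 t34 k34.
move: hE hV hN; set N := (\sum_(H | _) 1)%N%:R => hE hV hN.
apply: (failure_real _ _ _ hE0 hE) => //.
- exact: ltW.
- apply: (le_trans hV); rewrite lerDl; exact: RGG_var_ge0.
have hNP : N * p n ^+ k <= D * x n ^+ k.
  by rewrite exprMn mulrA; apply: ler_wpM2r.
have q0 : 0 <= (d n)%:R * l n ^+ 3 by apply: mulr_ge0; [exact: ltW|exact: exprn_ge0].
(* The sixth power of the logarithm arises here, from d l <= ln n. *)
have hq : ((d n)%:R * l n ^+ 3) ^+ 2 * (d n)%:R ^+ 4 <= ln n%:R ^+ 6.
  have -> : ((d n)%:R * l n ^+ 3) ^+ 2 * (d n)%:R ^+ 4 = ((d n)%:R * l n) ^+ 6.
    by move: ((d n)%:R) (l n) => u v; ring.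
  apply: lerXn2r; rewrite ?nnegrE//.
    by apply: mulr_ge0 => //; exact: ltW.
  exact: le_trans ln1.
have d4 : 0 < (d n)%:R ^+ 4 :> R by exact: exprn_gt0.
apply: (@le_trans _ _ (16%:R * (D * x n ^+ k) * (2 * (A * ((d n)%:R * l n ^+ 3))) ^+ 2)).
  by apply: ler_wpM2r; [exact: sqr_ge0|apply: ler_wpM2l].
have e2 : 0 < eta ^+ 2 by exact: exprn_gt0.
rewrite -(ler_pM2r d4).
have -> : 16%:R * (D * x n ^+ k) * (2 * (A * ((d n)%:R * l n ^+ 3))) ^+ 2 * (d n)%:R ^+ 4 =
  (eta ^+ 2 * K * x n ^+ k) * (((d n)%:R * l n ^+ 3) ^+ 2 * (d n)%:R ^+ 4).
  rewrite /K [eta ^+ 2 * _]mulrC divfK ?gt_eqF//.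
  by move: (x n ^+ k) ((d n)%:R * l n ^+ 3) ((d n)%:R ^+ 4) (D) (A) => u v w D' A'; ring.
have xk0 : 0 <= x n ^+ k by apply: exprn_ge0; apply: le_trans x1.
apply: (@le_trans _ _ (eta ^+ 2 * K * x n ^+ k * ln n%:R ^+ 6)).
  apply: ler_wpM2l => //; apply: mulr_ge0 => //.
  by apply: mulr_ge0; exact: ltW.
have -> : eta ^+ 2 * K * x n ^+ k * ln n%:R ^+ 6 = eta ^+ 2 * (K * x n ^+ k * ln n%:R ^+ 6).
  by rewrite !mulrA.
by apply: ler_wpM2l => //; exact: ltW.
Qed.

Variable g : nat -> R.
Hypothesis g_pow : forall n, 0 <= x n -> 0 <= g n /\ g n ^+ 4 = x n ^+ k.

(** [g] is the threshold (np)^(k/4), compared with d through fourth powers. Taking m = max(K, 1)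
    ensures m^4 >= K. *)
Lemma succeeds_of_tilde_o : tilde_o 2 (fun n => (d n)%:R) g ->
  SC_test_succeeds (cycle_graph k) p d tau.
Proof.
move=> ho; apply: cycle_test_succeeds => K K0.
pose m := Num.max K 1; have m1 : 1 <= m by rewrite le_max lexx orbT.
have m0 : 0 < m by apply: lt_le_trans m1.
have mi : 0 < m^-1 by rewrite invr_gt0.
have := for_large_and regular_large (ho _ mi).
apply: for_large_imp => n [[_ [_ _ ln1 x1] _] h].
have [g0 gk] := g_pow (le_trans ler01 x1).
have d0 : 0 <= (d n)%:R :> R by [].
have hd : m * (d n)%:R <= g n.
  have : (d n)%:R <= m^-1 * g n.
    apply: le_trans h; rewrite ler_peMr// (powR_mulrn 2) ?(le_trans ler01 ln1)//.
    exact: exprn_ege1.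
  by rewrite mulrC ler_pdivlMr// mulrC.
rewrite -gk; apply: (@le_trans _ _ ((m * (d n)%:R) ^+ 4)).
  rewrite exprMn; apply: ler_wpM2r; first exact: exprn_ge0.
  apply: (@le_trans _ _ m); first by rewrite le_max lexx.
  by rewrite -[leLHS]expr1; exact: ler_weXn2l.
by apply: lerXn2r => //; rewrite nnegrE// mulr_ge0// ltW.
Qed.

(** The fourth power of (ln n)^2 is (ln n)^8, which covers the required (ln n)^6 as ln n >= 1. *)
Lemma fails_of_tilde_omega : tilde_omega 2 (fun n => (d n)%:R) g ->
  SC_test_fails (cycle_graph k) p d tau.
Proof.
move=> ho; apply: cycle_test_fails => K K0.
pose m := Num.max K 1; have m1 : 1 <= m by rewrite le_max lexx orbT.
have m0 : 0 < m by apply: lt_le_trans m1.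
have := for_large_and regular_large (ho _ m0).
apply: for_large_imp => n [[_ [_ _ ln1 x1] _] h].
have [g0 gk] := g_pow (le_trans ler01 x1).
have L0 : 0 <= ln (n%:R : R) by apply: le_trans ln1.
move: h; rewrite (powR_mulrn 2)// => h.
rewrite -gk; apply: (@le_trans _ _ ((m * g n * ln n%:R ^+ 2) ^+ 4)); last first.
  by apply: lerXn2r => //; rewrite nnegrE// !mulr_ge0 ?exprn_ge0// ltW.
rewrite (exprMn _ (m * g n)) (exprMn _ m) -exprM.
apply: ler_pM; rewrite ?mulr_ge0 ?exprn_ge0 ?(ltW K0)//.
  apply: ler_wpM2r; first exact: exprn_ge0.
  apply: (@le_trans _ _ m); first by rewrite le_max lexx.
  by rewrite -[leLHS]expr1; exact: ler_weXn2l.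
exact: ler_weXn2l.
Qed.

End asymptotics.

Theorem theorem1p3 (R : realType) (delta eps : R) :
  0 < delta -> 0 < eps ->
  exists C : R, 0 < C /\
  forall (p : nat -> R) (d : nat -> nat) (tau : nat -> R),
    assumption_A delta eps p d tau ->
    (* (1) signed 4-cycle *)
    (tilde_o C (fun n => (d n)%:R) (fun n => n%:R * p n) ->
       SC_test_succeeds (cycle_graph 4) p d tau) /\
    (tilde_omega C (fun n => (d n)%:R) (fun n => n%:R * p n) ->
       SC_test_fails (cycle_graph 4) p d tau) /\
    (* (2) signed triangle *)
    (tilde_o C (fun n => (d n)%:R) (fun n => (n%:R * p n) `^ (3 / 4)) ->
       SC_test_succeeds (cycle_graph 3) p d tau) /\
    (tilde_omega C (fun n => (d n)%:R) (fun n => (n%:R * p n) `^ (3 / 4)) ->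
       SC_test_fails (cycle_graph 3) p d tau).
Proof.
(* One exponent serves both cycles, whatever delta and eps; A is then set to 4^8. *)
move=> delta0 eps0; exists 2; split=> // p d tau hA.
have AA : 4%:R ^+ 8 <= 4%:R ^+ 8 :> R by [].
have g4 n : 0 <= n%:R * p n -> 0 <= n%:R * p n /\ (n%:R * p n) ^+ 4 = (n%:R * p n) ^+ 4 by [].
have g3 n : 0 <= n%:R * p n -> 0 <= (n%:R * p n) `^ (3 / 4) /\
    ((n%:R * p n) `^ (3 / 4)) ^+ 4 = (n%:R * p n) ^+ 3.
  move=> x0; split; first exact: powR_ge0.
  by rewrite -powR_mulrn ?powR_ge0// -powRrM divfK ?pnatr_eq0// powR_mulrn.
split; first exact: (succeeds_of_tilde_o delta0 eps0 hA AA (k := 4) _ g4).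
split; first exact: (fails_of_tilde_omega delta0 eps0 hA AA (k := 4) _ g4).
split; first exact: (succeeds_of_tilde_o delta0 eps0 hA AA (k := 3) _ g3).
exact: (fails_of_tilde_omega delta0 eps0 hA AA (k := 3) _ g3).
Qed.
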